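(* Let $k\ge 1$ be an integer, $\alpha\in\mathbb R$, $p\in\{\mathcal C,\mathcal R\}$, $q\in\{\mathcal U,\mathcal D\}$, and for $c>0$ and all sufficiently large $n$ (so that the numerator below is positive) let $$r_n^{p,q}(c)=\left(\frac{\log n+k\log\log n+\log|A_k^p|+\alpha-k\log m_k^{p,q}-\log (k+1)!}{n\,c}\right)^{1/d}.$$ Let $J_{n,k}^{p,q}(r)$ denote the number of isolated nodes of the graph $G_k^{p,q}(\mathcal P_n,r)$. Then there exists a sequence $\{c_n^{p,q}\}_{n\ge 1}\subset[m_k^{p,q},M_k^{p,q}]$ such that $c_n^{p,q}\to m_k^{p,q}$ and $$\mathbb E\big[J_{n,k}^{p,q}\big(r_n^{p,q}(c_n^{p,q})\big)\big]\to e^{-\alpha}\quad\text{as } n\to\infty.$$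
   Context: Let $d\ge 2$ be an integer and let $U=[0,1]^d$ with the toroidal metric $d(x,y)=\inf\{\|x-y+z\|: z\in\mathbb Z^d\}$. For $n\ge 1$, $\mathcal P_n$ is a homogeneous Poisson point process of intensity $n$ on $U$. Complexes and graphs. For a finite set $\mathcal X\subset U$ and $r>0$, with closed balls $B_x(r)$ in the toroidal metric: the Čech complex $\mathcal C(\mathcal X,r)$ has as $k$-faces the sets of $k+1$ distinct points $x_1,\dots,x_{k+1}\in\mathcal X$ with $\bigcap_{j=1}^{k+1}B_{x_j}(r)\ne\emptyset$; the Vietoris-Rips complex $\mathcal R(\mathcal X,r)$ has as $k$-faces the sets of $k+1$ distinct points of $\mathcal X$ whose balls of radius $r$ intersect pairwise. For $p\in\{\mathcal C,\mathcal R\}$ let $G_k^{p,\mathcal U}(\mathcal X,r)$ be the graph whose nodes are the $k$-faces of the corresponding complex ($\mathcal C$: Čech, $\mathcal R$: Vietoris-Rips), with an edge between distinct $k$-faces $\sigma,\tau$ iff $\sigma\cup\tau$ is a $(k+1)$-face (up-connectivity); let $G_k^{p,\mathcal D}(\mathcal X,r)$ be the graph with the same nodes and with an edge between distinct $\sigma,\tau$ iff $\sigma\cap\tau$ is a $(k-1)$-face (down-connectivity). An isolated node is a node with no neighbours. Constants. In $\mathbb R^d$ (Euclidean closed balls, $O$ the origin, $\oplus$ Minkowski sum, $|\cdot|$ Lebesgue measure) and for $\mathbf x=(x_1,\dots,x_{k+1})\in(\mathbb R^d)^{k+1}$ let $h_k^{\mathcal C}(\mathbf x)=\mathbf 1[\bigcap_j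 B_{x_j}(1)\neq\emptyset]$, $h_k^{\mathcal R}(\mathbf x)=\prod_{j<m}\mathbf 1[B_{x_j}(1)\cap B_{x_m}(1)\ne\emptyset]$, and $Q_k^{\mathcal C,\mathcal U}(\mathbf x)=\big(\bigcap_{j}B_{x_j}(1)\big)\oplus B_O(1)$, $Q_k^{\mathcal C,\mathcal D}(\mathbf x)=\bigcup_{i}\big[\big(\bigcap_{j\ne i}B_{x_j}(1)\big)\oplus B_O(1)\big]$, $Q_k^{\mathcal R,\mathcal U}(\mathbf x)=\bigcap_{j}B_{x_j}(2)$, $Q_k^{\mathcal R,\mathcal D}(\mathbf x)=\bigcup_{i}\bigcap_{j\neq i}B_{x_j}(2)$, with indices in $\{1,\dots,k+1\}$. Let $A_k^p=\{\mathbf y\in(\mathbb R^d)^k: h_k^p(O,\mathbf y)=1\}$, with $|A_k^p|$ its Lebesgue measure in $\mathbb R^{dk}$, and let $m_k^{p,q}=\inf\{|Q_k^{p,q}(O,\mathbf y)|:\mathbf y\in A_k^p\}$, $M_k^{p,q}=\sup\{|Q_k^{p,q}(O,\mathbf y)|:\mathbf y\in A_k^p\}$. *)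

(* Defs.v *)
From HB Require Import structures.
From mathcomp Require Import all_boot all_order all_algebra finmap.
From mathcomp Require Import all_classical all_reals all_analysis.
Set Implicit Arguments.
Unset Strict Implicit.
Unset Printing Implicit Defensive.
Import Order.TTheory GRing.Theory Num.Theory numFieldNormedType.Exports.
Local Open Scope classical_set_scope.
Local Open Scope ring_scope.

(* Powers of a sigma-finite measure, as measures on n.-tuple T; the library has
   the product sigma-algebra on tuples but no measure on it. *)
Section tuple_measure.
Context {disp : measure_display} {T : measurableType disp} {R : realType}.
Variable mu : {sigma_finite_measure set T -> \bar R}.

Definition cons_pair n (x : T * n.-tuple T) : n.+1.-tuple T :=
  [tuple of x.1 :: x.2].

Lemma measurable_cons_pair n : measurable_fun setT (@cons_pair n).
Proof. exact: (measurable_cons measurable_fst measurable_snd). Qed.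

Definition cons_measure n (nu : {sigma_finite_measure set (n.-tuple T) -> \bar R})
  : set (n.+1.-tuple T) -> \bar R := pushforward (mu \x nu)%E (@cons_pair n).

Section cons_measure_instances.
Variables (n : nat) (nu : {sigma_finite_measure set (n.-tuple T) -> \bar R}).

Let cons_measure0 : cons_measure nu set0 = 0%E.
Proof. by rewrite /cons_measure /pushforward preimage_set0 measure0. Qed.

Let cons_measure_ge0 A : (0 <= cons_measure nu A)%E.
Proof. by rewrite /cons_measure /pushforward measure_ge0. Qed.

Let cons_measure_sigma_additive : semi_sigma_additive (cons_measure nu).
Proof.
move=> F mF tF mUF; rewrite /cons_measure /pushforward preimage_bigcup.
apply: measure_semi_sigma_additive.
- by move=> k; rewrite -[X in measurable X]setTI; exact: measurable_cons_pair.
- apply/trivIsetP => /= i j _ _ ij; rewrite -preimage_setI.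
  by move/trivIsetP : tF => /(_ _ _ _ _ ij) ->//; rewrite preimage_set0.
- by rewrite -preimage_bigcup -[X in measurable X]setTI;
    exact: measurable_cons_pair.
Qed.

HB.instance Definition _ := isMeasure.Build _ _ _ (cons_measure nu)
  cons_measure0 cons_measure_ge0 cons_measure_sigma_additive.

Let cons_measure_sigma_finite : sigma_finite setT (cons_measure nu).
Proof.
have /sigma_finiteP[F [TF ndF Foo]] := sigma_finiteT mu.
have /sigma_finiteP[G [TG ndG Goo]] := sigma_finiteT nu.
pose tail (t : n.+1.-tuple T) : n.-tuple T := [tuple of behead t].
have mhd : measurable_fun setT (@thead n T).
  exact: (@measurable_tnth _ _ _ ord0).
have mtl : measurable_fun setT tail by exact: measurable_behead.
exists (fun i => @thead n T @^-1` F i `&` tail @^-1` G i).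
  apply/esym; rewrite -subTset => t _.
  have [i _ Fi] : (\bigcup_i F i) (thead t) by rewrite -TF.
  have [j _ Gj] : (\bigcup_i G i) (tail t) by rewrite -TG.
  exists (maxn i j) => //; split.
    have: F i `<=` F (maxn i j) by exact/subsetPset/ndF/leq_maxl.
    exact.
  have: G j `<=` G (maxn i j) by exact/subsetPset/ndG/leq_maxr.
  exact.
move=> i; have [mFi Fi] := Foo i; have [mGi Gi] := Goo i; split.
  by apply: measurableI; rewrite -[X in measurable X]setTI;
    [exact: mhd | exact: mtl].
rewrite /cons_measure /pushforward (_ : _ @^-1` _ = F i `*` G i).
  by rewrite product_measure1E// lte_mul_pinfty// ge0_fin_numE.
have tailK x t : tail (cons_pair (x, t)) = t by exact/val_inj.
by apply/seteqP; split => -[x t] /=; rewrite tailK.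
Qed.

HB.instance Definition _ := Measure_isSigmaFinite.Build _ _ _ (cons_measure nu)
  cons_measure_sigma_finite.

End cons_measure_instances.

Fixpoint tuple_measure n : {sigma_finite_measure set (n.-tuple T) -> \bar R} :=
  match n with
  | 0 => dirac ([tuple] : 0.-tuple T)
  | n'.+1 => cons_measure (tuple_measure n')
  end.

End tuple_measure.

(* R^d; as a type, measurableTypeR R is R. *)
Notation "'pt[' R ]_ d" := (d.-tuple (measurableTypeR R))
  (at level 8, d at level 2, format "'pt[' R ]_ d").

Inductive complex_type := Cech | Rips.
Inductive connectivity := Up | Down.

Section euclidean.
Context {R : realType} (d : nat).
Implicit Types (x y z : pt[R]_d) (A B : set pt[R]_d) (r : R).

Definition leb_Rd : {sigma_finite_measure set pt[R]_d -> \bar R} :=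
  tuple_measure (@lebesgue_measure R) d.

Definition leb_pow k : {sigma_finite_measure set (k.-tuple pt[R]_d) -> \bar R} :=
  tuple_measure leb_Rd k.

Definition enorm (v : 'I_d -> R) : R := Num.sqrt (\sum_(i < d) v i ^+ 2).

Definition origin : pt[R]_d := [tuple 0 | i < d].

Definition eball x r : set pt[R]_d :=
  [set y | enorm (fun i => tnth x i - tnth y i) <= r].

Definition mink A B : set pt[R]_d :=
  [set [tuple tnth a i + tnth b i | i < d] | a in A & b in B].

Variables (k : nat) (p : complex_type) (q : connectivity).

(* [hprop x] is h_k^p(x) = 1. *)
Definition hprop (x : k.+1.-tuple pt[R]_d) : Prop :=
  match p with
  | Cech => \bigcap_(j : 'I_k.+1) eball (tnth x j) 1 !=set0
  | Rips => forall j m : 'I_k.+1, (j < m)%N ->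
      eball (tnth x j) 1 `&` eball (tnth x m) 1 !=set0
  end.

Definition Qset (x : k.+1.-tuple pt[R]_d) : set pt[R]_d :=
  match p, q with
  | Cech, Up =>
      mink (\bigcap_(j : 'I_k.+1) eball (tnth x j) 1) (eball origin 1)
  | Cech, Down =>
      \bigcup_(i : 'I_k.+1)
        mink (\bigcap_(j in [set j : 'I_k.+1 | j != i]) eball (tnth x j) 1)
             (eball origin 1)
  | Rips, Up => \bigcap_(j : 'I_k.+1) eball (tnth x j) 2
  | Rips, Down =>
      \bigcup_(i : 'I_k.+1)
        \bigcap_(j in [set j : 'I_k.+1 | j != i]) eball (tnth x j) 2
  end.

Definition Aset : set (k.-tuple pt[R]_d) :=
  [set y : k.-tuple pt[R]_d | hprop [tuple of origin :: y]].

(* [Aset] and all the sets [Qset] are bounded, so [fine] loses nothing below. *)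
Definition Avol : R := fine (leb_pow k Aset).

Definition Qvol (y : k.-tuple pt[R]_d) : \bar R :=
  leb_Rd (Qset [tuple of origin :: y]).

Definition minQ : R := fine (ereal_inf [set Qvol y | y in Aset]).

Definition maxQ : R := fine (ereal_sup [set Qvol y | y in Aset]).

End euclidean.

Section torus.
Context {R : realType} (d : nat).
Implicit Types (x y : pt[R]_d) (X s t : {fset pt[R]_d}) (r : R).

(* Opposite faces of the cube are at [tdist] 0 but are not identified. *)
Definition torus : set pt[R]_d := [set x | forall i, 0 <= tnth x i <= 1].

Definition tdist x y : R :=
  inf [set enorm (fun i => tnth x i - tnth y i + (z i)%:~R)
      | z in [set: 'I_d -> int]].

Definition tball x r : set pt[R]_d := torus `&` [set y | tdist x y <= r].

Definition face (p : complex_type) X r (k : nat) s : Prop :=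
  [/\ s `<=` X, #|` s| = k.+1 &
    match p with
    | Cech => \bigcap_(x in [set` s]) tball x r !=set0
    | Rips => forall x y, x \in s -> y \in s -> x != y ->
        tball x r `&` tball y r !=set0
    end]%fset.

(* Edges between k-faces; in the [Down] case k >= 1 is intended. *)
Definition edge p (q : connectivity) X r k s t : Prop :=
  s != t /\
  match q with
  | Up => face p X r k.+1 (s `|` t)%fset
  | Down => face p X r k.-1 (s `&` t)%fset
  end.

Definition isolated_node p q X r k s : Prop :=
  face p X r k s /\ forall t, face p X r k t -> ~ edge p q X r k s t.

Definition nb_isolated p q X r k : nat :=
  #|` [fset s in fpowerset X | `[< isolated_node p q X r k s >]]%fset|.

End torus.

Section poisson.
Context {R : realType} (d : nat) {disp : measure_display}
  {Omega : measurableType disp}.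

Definition npoints (N : Omega -> {fset pt[R]_d}) (B : set pt[R]_d)
  (w : Omega) : nat := #|` [fset x in N w | `[< B x >]]%fset|.

(* Homogeneous Poisson point process of intensity lam on the torus, as a random
   finite set. The second argument of [poisson_prob] is a dummy, and
   [poisson_prob 0] is the Dirac mass at 0. *)
Record is_poisson_process (P : probability Omega R) (lam : R)
    (N : Omega -> {fset pt[R]_d}) : Prop := {
  pp_support : forall w x, x \in N w -> torus x ;
  pp_measurable : forall B, measurable B ->
    measurable_fun setT (npoints N B) ;
  pp_poisson : forall B, measurable B -> B `<=` @torus R d ->
    forall S : set nat, P (npoints N B @^-1` S) =
      poisson_prob (lam * fine (leb_Rd d B)) 0 S ;
  pp_independent : forall (m : nat) (B : 'I_m -> set pt[R]_d),
    (forall i, measurable (B i)) -> (forall i, B i `<=` @torus R d) ->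
    trivIset setT B ->
    forall S : 'I_m -> set nat,
      P (\bigcap_(i : 'I_m) (npoints N (B i) @^-1` S i)) =
      (\prod_(i < m) P (npoints N (B i) @^-1` S i))%E
}.

End poisson.

(* The radius r_n^{p,q}(c). It is only meaningful for n large enough that the
   numerator is positive. *)
Definition crit_radius {R : realType} (d k : nat) (p : complex_type)
    (q : connectivity) (alpha : R) (n : nat) (c : R) : R :=
  ((ln n%:R + k%:R * ln (ln n%:R) + ln (Avol d k p) + alpha
     - k%:R * ln (minQ d k p q) - ln (k.+1)`!%:R) / (n%:R * c)) `^ d%:R^-1.

(* Main.v *)
(* Cutting the cube into cells of side 1/(j+1) turns the Poisson process into a
   family of independent cell counts; letting j tend to infinity gives the Mecke
   formula for the number of isolated k-faces. For r <= 1/32, unrolling the torus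
   around the first vertex of a face and rescaling by r gives, with s = n r^d,
     E[J] = n s^k / (k + 1)! * laplace(s),
     laplace(s) = \int_{A_k} exp (- s |Q_k(O, y)|) dy.
   At r = r_n(c) one has s = L_n / c with L_n the numerator in r_n. The bound
   laplace(s) <= |A_k| exp (- s m) makes the mean at c = m at most e^{-alpha} in the
   limit. If m < M, then for 0 < e <= M - m the faces with |Q_k| <= m + e / 2 have
   positive measure, so the mean at c = m + e is eventually at least e^{-alpha}. The
   mean is continuous in c, so some c_n in [m, m + e] gives exactly e^{-alpha},
   unless the mean at m is already above it, and then c_n = m serves. *)
Require Import Defs.
From HB Require Import structures.
From mathcomp Require Import all_boot all_order all_algebra finmap.
From mathcomp Require Import all_classical all_reals all_analysis.
From mathcomp Require Import measurable_realfun.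
From mathcomp Require Import ring lra.
Set Implicit Arguments.
Unset Strict Implicit.
Unset Printing Implicit Defensive.
Import Order.TTheory GRing.Theory Num.Theory numFieldNormedType.Exports.
Local Open Scope classical_set_scope.
Local Open Scope ring_scope.

(** * Powers of a measure *)

Section tuple_measure_theory.
Context {disp : measure_display} {T : measurableType disp} {R : realType}.
Variable mu : {sigma_finite_measure set T -> \bar R}.
Local Notation mun := (tuple_measure mu).
Local Open Scope ereal_scope.

(** The process is known only through its counts in Borel sets, so neither the Mecke formula nor
    even measurability of the number of isolated faces is available at the start. The grid works
    because being a face and being adjacent are closed conditions on the vertices: asking that they
    hold somewhere in a product of cells errs on one side only, and for a fixed configuration the
    error vanishes once the mesh is small. Independence applies because isolation is emptiness of a
    single region: under both connectivities an adjacent face has exactly one vertex outside the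
    given one. For r <= 1/32, everything attached to a face lies within 5 r of its first vertex,
    well inside the range where toroidal and Euclidean distances agree. The constants in L_n are
    those for which n (L_n / m)^k |A_k| exp (- L_n) / (k + 1)! equals exp (- alpha) (L_n / log n)^k,
    and L_n ~ log n. The positive measure of the faces with nearly minimal |Q_k| rests on upper
    semicontinuity of |Q_k|. *)

Lemma measurable_preimageT d1 d2 (X : measurableType d1) (Y : measurableType d2)
    (f : X -> Y) (A : set Y) :
  measurable_fun setT f -> measurable A -> measurable (f @^-1` A).
Proof. by move=> mf mA; rewrite -[X in measurable X]setTI; exact: mf. Qed.

Lemma measurable_cons_tuple n (x : T) :
  measurable_fun setT (fun t : n.-tuple T => cons_pair (x, t)).
Proof.
exact: (measurableT_comp (@measurable_cons_pair _ T n) (measurable_pair1 x)).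
Qed.

Lemma measurable_cons_point n (t : n.-tuple T) :
  measurable_fun setT (fun x : T => cons_pair (x, t)).
Proof.
exact: (measurableT_comp (@measurable_cons_pair _ T n) (measurable_pair2 t)).
Qed.

Lemma measurable_tnth_set n (P : 'I_n -> set T) : (forall i, measurable (P i)) ->
  measurable [set t : n.-tuple T | forall i, P i (tnth t i)].
Proof.
move=> mP; rewrite (_ : [set _ | _] =
    \bigcap_(i in [set: 'I_n]) ((@tnth n T)^~ i @^-1` P i)).
  apply: fin_bigcap_measurable => // i _.
  by apply: measurable_preimageT => //; exact: measurable_tnth.
by apply/seteqP; split=> t /= h i; [move=> _|]; apply: h.
Qed.

Lemma tuple_measureS1 n (A : set (n.+1.-tuple T)) : measurable A ->
  mun n.+1 A = \int[mu]_x mun n [set t | A (cons_pair (x, t))].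
Proof.
move=> mA; rewrite /= /cons_measure /pushforward /product_measure1 /=.
apply: eq_integral => x _ /=; congr (mun n _).
by apply/seteqP; split=> t; rewrite /xsection/= inE.
Qed.

(** The product measure is determined by its values on rectangles, where both orders of slicing give
    the same product. *)
Lemma tuple_measureS2 n (A : set (n.+1.-tuple T)) : measurable A ->
  mun n.+1 A = \int[mun n]_t mu [set x | A (cons_pair (x, t))].
Proof.
move=> mA; rewrite /= /cons_measure /pushforward.
rewrite (@product_measure_unique _ _ _ _ _ mu (mun n) (mu \x^ mun n)).
- rewrite /product_measure2 /=.
  apply: eq_integral => t _ /=; congr (mu _).
  by apply/seteqP; split=> x; rewrite /ysection/= inE.
- by move=> B C mB mC; exact: product_measure2E.
- by apply: measurable_preimageT => //; exact: measurable_cons_pair.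
Qed.

Lemma ge0_integral_tupleS n (f : n.+1.-tuple T -> \bar R) :
  measurable_fun [set: n.+1.-tuple T] f -> (forall t, 0 <= f t) ->
  \int[mun n.+1]_t f t = \int[mu]_x \int[mun n]_t f (cons_pair (x, t)).
Proof.
move=> mf f0 /=.
rewrite ge0_integral_pushforward//; last exact: measurable_cons_pair.
rewrite preimage_setT fubini_tonelli1//=; last first.
  by apply: measurableT_comp => //; exact: measurable_cons_pair.
Qed.

Lemma tuple_measure_box n (B : 'I_n -> set T) : (forall i, measurable (B i)) ->
  mun n [set t | forall i, B i (tnth t i)] = \prod_(i < n) mu (B i).
Proof.
elim: n B => [|n IH] B mB.
  rewrite big_ord0 /= diracE mem_set// => -[].
  by case.
rewrite tuple_measureS1; last exact: measurable_tnth_set.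
rewrite big_ord_recl -IH; last by move=> i; exact: mB.
rewrite (eq_integral (fun x => mun n [set t | forall i, B (lift ord0 i) (tnth t i)]
    * (\1_(B ord0) x)%:E)); last first.
  move=> x _; rewrite indicE; have [xB|xB] := boolP (x \in B ord0).
    rewrite mule1; congr (mun n _); apply/seteqP; split => t /= h i.
      by have := h (lift ord0 i); rewrite tnthS.
    case: (unliftP ord0 i) => [j ->|->]; first by rewrite tnthS.
    by rewrite tnth0; exact: set_mem.
  rewrite mule0 (_ : [set t | _] = set0) ?measure0//.
  rewrite -subset0 => t /= /(_ ord0); rewrite tnth0 => Bx.
  by move/negP: xB; apply; rewrite inE.
rewrite ge0_integralZl ?integral_indic ?setIT 1?muleC//.
by apply/measurable_EFinP; exact: measurable_indic.
Qed.

End tuple_measure_theory.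

(** * Change of variables in set form *)

Section change_of_variables.
Local Open Scope ereal_scope.

Lemma ge0_integral_mrestr d (T : measurableType d) (R : realType)
    (mu : measure T R) (D : set T) (mD : measurable D) (f : T -> \bar R) :
  measurable_fun setT f -> (forall x, 0 <= f x) ->
  \int[mrestr mu mD]_x f x = \int[mu]_(x in D) f x.
Proof.
move=> mf f0.
rewrite (@ge0_negligible_integral _ _ _ (mrestr mu mD) setT (~` D))//=; last 2 first.
- exact: measurableC.
- by rewrite /mrestr setICl measure0.
rewrite setTD setCK; apply: eq_measure_integral => A mA AD.
by rewrite /= /mrestr (setIidl AD).
Qed.

(** The hypothesis says that [psi] pushes [mu] restricted to [D] forward to [c] times [nu]
    restricted to [E]. This form suits the unrolling map, which is only piecewise affine. *)
Lemma ge0_integral_transport d1 d2 (X : measurableType d1)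
    (Y : measurableType d2) (R : realType) (mu : measure X R)
    (nu : measure Y R) (D : set X) (E : set Y) (psi : X -> Y) (c : R)
    (f : Y -> \bar R) : (0 <= c)%R ->
  measurable D -> measurable E -> measurable_fun setT psi ->
  (forall B, measurable B ->
    mu (D `&` psi @^-1` B) = c%:E * nu (E `&` B)) ->
  measurable_fun setT f -> (forall y, 0 <= f y) ->
  \int[mu]_(x in D) f (psi x) = c%:E * \int[nu]_(y in E) f y.
Proof.
move=> c0 mD mE mpsi H mf f0.
rewrite -(ge0_integral_mrestr _ mD)//; last exact: measurableT_comp.
have := @ge0_integral_pushforward _ _ X Y R psi mpsi (mrestr mu mD)
  setT f measurableT mf (fun y _ => f0 y).
rewrite preimage_setT => <-.
rewrite -(ge0_integral_mrestr _ mE)//.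
rewrite -(ge0_integral_mscale _ measurableT (NngNum c0))//=.
apply: eq_measure_integral => B mB _.
by rewrite /= /pushforward /mscale /= /mrestr setIC H// setIC.
Qed.

Section tuple_transport.
Context {d : measure_display} {T : measurableType d} {R : realType}.
Variable mu : {sigma_finite_measure set T -> \bar R}.

Lemma measurable_tuple_map n (psi : 'I_n -> T -> T) :
  (forall i, measurable_fun setT (psi i)) ->
  measurable_fun setT
    (fun t : n.-tuple T => [tuple psi i (tnth t i) | i < n]).
Proof.
move=> mpsi; apply/measurable_fun_tnthP => i.
rewrite (_ : _ \o _ = psi i \o (@tnth n T)^~ i); last first.
  by apply/funext => t /=; rewrite tnth_mktuple.
by apply: measurableT_comp => //; exact: measurable_tnth.
Qed.

Lemma measurable_fun_tuple_measure n (A : set (n.+1.-tuple T)) : measurable A ->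
  measurable_fun setT (fun x => tuple_measure mu n [set t | A (cons_pair (x, t))]).
Proof.
move=> mA; apply: (eq_measurable_fun (tuple_measure mu n \o
    xsection (@cons_pair _ T n @^-1` A))).
  move=> x _ /=; congr (tuple_measure mu n _).
  by apply/seteqP; split=> t; rewrite /xsection/= inE.
apply: measurable_fun_xsection; apply: measurable_preimageT => //.
exact: measurable_cons_pair.
Qed.

Lemma measurable_fun_point_measure n (A : set (n.+1.-tuple T)) : measurable A ->
  measurable_fun setT (fun t : n.-tuple T => mu [set x | A (cons_pair (x, t))]).
Proof.
move=> mA; apply: (eq_measurable_fun (mu \o ysection (@cons_pair _ T n @^-1` A))).
  move=> t _ /=; congr (mu _).
  by apply/seteqP; split=> x; rewrite /ysection/= inE.
apply: measurable_fun_ysection; apply: measurable_preimageT => //.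
exact: measurable_cons_pair.
Qed.

(** The transport relation is stable under products: slice off the first coordinate, apply the
    induction hypothesis to the slice, and transport the remaining integral. It is used twice, from
    one real coordinate to a point of R^d and from a point to a k-tuple of points. *)
Lemma tuple_measure_transport n (D E : 'I_n -> set T) (psi : 'I_n -> T -> T)
    (c : R) : (0 <= c)%R ->
  (forall i, measurable (D i)) -> (forall i, measurable (E i)) ->
  (forall i, measurable_fun setT (psi i)) ->
  (forall i B, measurable B ->
    mu (D i `&` psi i @^-1` B) = c%:E * mu (E i `&` B)) ->
  forall A, measurable A ->
  tuple_measure mu n ([set t | forall i, D i (tnth t i)] `&`
     (fun t => [tuple psi i (tnth t i) | i < n]) @^-1` A) =
  (c ^+ n)%:E * tuple_measure mu n ([set t | forall i, E i (tnth t i)] `&` A).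
Proof.
move=> c0; elim: n D E psi => [|n IH] D E psi mD mE mpsi H A mA.
  rewrite expr0 mul1e; congr (tuple_measure mu 0 _); apply/seteqP.
  by split=> t [_ At]; (split; first by case); move: At => /=;
    rewrite (tuple0 t) (tuple0 [tuple _ | _ < _]).
have mmap := measurable_tuple_map mpsi.
have mDn : measurable [set t : n.+1.-tuple T | forall i, D i (tnth t i)].
  exact: measurable_tnth_set.
have mEn : measurable [set t : n.+1.-tuple T | forall i, E i (tnth t i)].
  exact: measurable_tnth_set.
rewrite !tuple_measureS1; [|by apply: measurableI|by apply: measurableI => //;
  exact: measurable_preimageT].
set g := fun x => tuple_measure mu n
  ([set t | forall i, E (lift ord0 i) (tnth t i)] `&` [set t | A (cons_pair (x, t))]).
have mg : measurable_fun setT g.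
  rewrite (_ : g = fun x => tuple_measure mu n [set t |
    (A `&` [set t | forall i, E (lift ord0 i) (tnth t (lift ord0 i))]) (cons_pair (x, t))]).
    apply: measurable_fun_tuple_measure; apply: measurableI => //.
    rewrite (_ : [set _ | _] = \bigcap_(i in [set: 'I_n])
        ((@tnth n.+1 T)^~ (lift ord0 i) @^-1` E (lift ord0 i))).
      apply: fin_bigcap_measurable => // i _.
      by apply: measurable_preimageT => //; exact: measurable_tnth.
    by apply/seteqP; split=> t /= h i; [move=> _|]; apply: h.
  apply/funext => x; congr (tuple_measure mu n _); apply/seteqP.
  split=> t /= [h1 h2]; split=> // i; first by rewrite tnthS.
  by have := h2 i; rewrite tnthS.
have g0 x : 0 <= g x by exact: measure_ge0.
transitivity (\int[mu]_(x in D ord0) ((c ^+ n)%:E * g (psi ord0 x))).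
  rewrite [RHS]integral_mkcond; apply: eq_integral => x _.
  rewrite patchE; case: ifPn => xD; last first.
    rewrite (_ : [set t | _] = set0) ?measure0// -subset0 => t /= [/(_ ord0)].
    by rewrite tnth0 => Dx; move/negP: xD; rewrite inE.
  have := IH (fun i => D (lift ord0 i)) (fun i => E (lift ord0 i))
    (fun i => psi (lift ord0 i)) (fun=> mD _) (fun=> mE _) (fun=> mpsi _)
    (fun=> H _) _ (measurable_preimageT (measurable_cons_tuple (psi ord0 x)) mA).
  move=> /= <-.
    congr (tuple_measure mu n _); apply/seteqP; split => t /= [h1 h2].
      split; first by move=> i; have := h1 (lift ord0 i); rewrite tnthS.
      move: h2; congr A; apply: eq_from_tnth => i; rewrite tnth_mktuple.
      by case: (unliftP ord0 i) => [j ->|->];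
        rewrite ?tnthS ?tnth_mktuple ?tnth0.
    split.
      move=> i; case: (unliftP ord0 i) => [j ->|->]; first by rewrite tnthS.
      by rewrite tnth0; exact: set_mem.
    move: h2; congr A; apply: eq_from_tnth => i; rewrite tnth_mktuple.
    by case: (unliftP ord0 i) => [j ->|->];
        rewrite ?tnthS ?tnth_mktuple ?tnth0.
rewrite ge0_integralZl//; [|by apply: measurable_funTS;
  exact: measurableT_comp|by rewrite lee_fin exprn_ge0].
rewrite (ge0_integral_transport c0 (mD ord0) (mE ord0) (mpsi ord0) (H ord0))//.
rewrite exprSr EFinM -muleA; congr (_ * (_ * _)).
rewrite integral_mkcond; apply: eq_integral => x _.
rewrite patchE; case: ifPn => xE.
  congr (tuple_measure mu n _); apply/seteqP; split => t /= [h1 h2]; split=> // i.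
    case: (unliftP ord0 i) => [j ->|->]; first by rewrite tnthS.
    by rewrite tnth0; exact: set_mem.
  by have := h1 (lift ord0 i); rewrite tnthS.
rewrite (_ : [set t | _] = set0) ?measure0// -subset0 => t /= [/(_ ord0)].
by rewrite tnth0 => Dx; move/negP: xE; rewrite inE.
Qed.

End tuple_transport.
End change_of_variables.

Lemma pushforward_measureE d1 d2 (X : measurableType d1) (Y : measurableType d2)
    (R : realType) (mu : {measure set X -> \bar R}) (f : X -> Y) :
  measurable_fun setT f ->
  exists nu : {measure set Y -> \bar R}, forall B, nu B = mu (f @^-1` B).
Proof. by move=> mf; unshelve eexists (pushforward mu f). Qed.

(** * Unrolling one coordinate of the torus *)

Section unroll.
Context {R : realType}.
Implicit Types (a r t : R) (B : set (measurableTypeR R)).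
Local Notation mu := (@lebesgue_measure R).

(** The representative of t - a modulo 1 in [-1/2, 1/2). For a and t in [0, 1] a single shift by -1,
    0 or 1 is enough. *)
Definition unroll a t : R :=
  if t - a < - 2^-1 then t - a + 1 else
  if t - a < 2^-1 then t - a else t - a - 1.

Lemma unroll_int a t : exists z : int, unroll a t = t - a + z%:~R.
Proof.
rewrite /unroll; case: ifP => _; first by exists 1.
by case: ifP => _; [exists 0; rewrite addr0|exists (-1); rewrite mulrN1z].
Qed.

Lemma unroll_itv a t : 0 <= a <= 1 -> 0 <= t <= 1 ->
  - 2^-1 <= unroll a t < 2^-1.
Proof.
rewrite /unroll => /andP[a0 a1] /andP[t0 t1].
by do 2?case: ifPn; rewrite -?leNgt; lra.
Qed.

Definition scaled_unroll r a t : measurableTypeR R := unroll a t / r.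

Lemma measurable_affine a r : measurable_fun setT
  (fun t : measurableTypeR R => (t - a) / r : measurableTypeR R).
Proof. by apply: measurable_funM => //; exact: measurable_funB. Qed.

Lemma measurable_scaled_unroll r a : measurable_fun setT (scaled_unroll r a).
Proof.
apply: measurable_funM => //; apply: measurable_fun_if => //.
- by apply: measurable_fun_ltr => //; exact: measurable_funB.
- by apply: measurable_funTS; apply: measurable_funD => //; exact: measurable_funB.
apply: measurable_funTS; apply: measurable_fun_if => //.
- by apply: measurable_fun_ltr => //; exact: measurable_funB.
- by apply: measurable_funTS; exact: measurable_funB.
- by apply: measurable_funTS; apply: measurable_funB => //; exact: measurable_funB.
Qed.

(** By uniqueness of Lebesgue measure: r^-1 times the pushforward agrees with it on half-open
    intervals. *)
Lemma lebesgue_measure_affine a r B : 0 < r -> measurable B ->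
  mu ((fun t => (t - a) / r) @^-1` B) = (r%:E * mu B)%E.
Proof.
move=> r0 mB.
have r10 : 0 <= r^-1 by rewrite invr_ge0 ltW.
have [pf pfE] := pushforward_measureE mu (measurable_affine a r).
pose nu := mscale (NngNum r10) pf.
have mu_nu : mu B = nu B.
  apply: lebesgue_measure_unique => // X /ocitvP[->|[[x y] /= xy ->]].
  by rewrite !measure0.
  rewrite /nu /mscale /= pfE.
  rewrite (_ : _ @^-1` _ = `]r * x + a, r * y + a]%classic).
    rewrite !lebesgue_measure_itv /= (lebesgue_measure_itv `]r * x + a, r * y + a]) /= !lte_fin xy ltrD2r ltr_pM2l// xy.
    rewrite -!EFinD -EFinM; congr (_%:E); field; lra.
  apply/seteqP; split=> t /=; rewrite !in_itv/= ltr_pdivlMr// ler_pdivrMr//.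
    by rewrite ltrBrDr lerBlDr ![r * _]mulrC.
  by rewrite ltrBrDr lerBlDr ![r * _]mulrC.
by rewrite mu_nu /nu /mscale /= pfE muleA -EFinM divff ?mul1e ?gt_eqF.
Qed.

(** On each of three pieces, one per integer shift, the map is affine with slope 1/r. The pieces
    partition both the unit interval and the rescaled range, so the affine formula adds up. *)
Lemma lebesgue_measure_unroll a r B : 0 < r -> 0 <= a <= 1 -> measurable B ->
  mu ([set t : measurableTypeR R | 0 <= t <= 1] `&` scaled_unroll r a @^-1` B) =
  (r%:E * mu ([set u : measurableTypeR R | (- 2^-1 <= r * u < 2^-1)%R] `&` B))%E.
Proof.
move=> r0 /andP[a0 a1] mB.
(* The rescaled values u reached with shift j, that is those with t = r u + a + j in [0, 1). *)
pose S (j : R) : set (measurableTypeR R) :=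
  [set u | (- 2^-1 <= r * u < 2^-1) && (0 <= r * u + (a + j) < 1)].
pose aff (j : R) (t : measurableTypeR R) : measurableTypeR R := (t - (a + j)) / r.
have maff j : measurable_fun setT (aff j) by exact: measurable_affine.
have mlin (b : R) : measurable_fun setT (fun u : measurableTypeR R => r * u + b).
  by apply: measurable_funD => //; exact: measurable_funM.
have mhalf (b c e : R) : measurable [set u : measurableTypeR R | b <= r * u + e < c].
  rewrite (_ : [set _ | _] = (fun u => r * u + e) @^-1` `[b, c[%classic).
    by apply: measurable_preimageT => //; exact: mlin.
  by apply/seteqP; split=> u /=; rewrite in_itv.
have mS j : measurable (S j).
  rewrite (_ : S j = [set u | - 2^-1 <= r * u + 0 < 2^-1] `&`
      [set u | 0 <= r * u + (a + j) < 1]); first exact: measurableI.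
  by apply/seteqP; split=> u; rewrite /S/= addr0; [case/andP|case=> -> ->].
have mSB j : measurable (S j `&` B) by exact: measurableI.
have maSB j : measurable (aff j @^-1` (S j `&` B)).
  by apply: measurable_preimageT.
have affE j t : r * aff j t = t - (a + j).
  by rewrite /aff mulrC divfK// gt_eqF.
have mD : measurable [set t : measurableTypeR R | 0 <= t < 1].
  by rewrite (_ : [set _ | _] = `[0, 1[%classic).
have mpsi := measurable_scaled_unroll r a.
have mDB : measurable ([set t : measurableTypeR R | 0 <= t < 1] `&` scaled_unroll r a @^-1` B).
  by apply: measurableI => //; exact: measurable_preimageT.
(* The endpoint 1 represents the same torus point as 0. Removing this null set keeps the three
   pieces disjoint after unrolling. *)
have -> : mu ([set t : measurableTypeR R | 0 <= t <= 1] `&` scaled_unroll r a @^-1` B)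
    = mu ([set t : measurableTypeR R | 0 <= t < 1] `&` scaled_unroll r a @^-1` B).
  rewrite (_ : [set t : measurableTypeR R | 0 <= t <= 1] `&` _ =
      ([set t : measurableTypeR R | 0 <= t < 1] `&` scaled_unroll r a @^-1` B)
      `|` ([set 1] `&` scaled_unroll r a @^-1` B)); last first.
    rewrite -setIUl; congr (_ `&` _); apply/seteqP; split=> t /=.
      by rewrite [t <= 1]le_eqVlt => /andP[-> /orP[/eqP ->|->]]; [right|left].
    by case=> [/andP[-> /ltW]//|->]; rewrite ler01 lexx.
  have m1 : measurable ([set 1] `&` scaled_unroll r a @^-1` B).
    apply: measurableI; last exact: measurable_preimageT.
    exact: measurable_set1.
  rewrite measureU//; last first.
    by rewrite -subset0 => t /= [[/andP[_ t1] _] [te _]]; rewrite te ltxx in t1.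
  rewrite [X in (_ + X)%E](_ : _ = 0%E) ?adde0//.
  apply/eqP; rewrite -measure_le0 -(lebesgue_measure_set1 (1:R)).
  by apply: le_measure; rewrite ?inE//; exact: measurable_set1.
have decT : [set t : measurableTypeR R | 0 <= t < 1] `&` scaled_unroll r a @^-1` B =
    aff (-1) @^-1` (S (-1) `&` B) `|` (aff 0 @^-1` (S 0 `&` B)
      `|` aff 1 @^-1` (S 1 `&` B)).
  apply/seteqP; split => t.
    move=> [/= /andP[t0 t1]]; rewrite /scaled_unroll /unroll.
    case: ifPn => [lt1 Bt|]; [left|rewrite -leNgt => ge1; case: ifPn => [lt2 Bt|]];
      last (rewrite -leNgt => ge2 Bt); [|right; left|right; right];
      split; rewrite /S /= ?affE.
    + by apply/andP; split; lra.
    + by move: Bt; congr B; rewrite /aff; congr (_ / _); ring.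
    + by apply/andP; split; lra.
    + by move: Bt; congr B; rewrite /aff; congr (_ / _); ring.
    + by apply/andP; split; lra.
    + by move: Bt; congr B; rewrite /aff; congr (_ / _); ring.
  have bnd j : (aff j @^-1` (S j `&` B)) t ->
      [/\ 0 <= t < 1, - 2^-1 <= t - (a + j) < 2^-1 & B (aff j t)].
    rewrite /S /= affE => -[/andP[-> h] Bt]; split=> //.
    by rewrite subrK in h.
  move=> [/bnd|[/bnd|/bnd]] [h1 h2 Bt]; split=> //=;
    rewrite /scaled_unroll /unroll; move: h2 Bt => /andP[h2 h3];
    rewrite /aff => Bt.
  - by rewrite ifT; [move: Bt; congr B; congr (_ / _); ring|lra].
  - rewrite ifF; last by apply/negbTE; rewrite -leNgt; lra.
    by rewrite ifT; [move: Bt; congr B; congr (_ / _); ring|lra].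
  - rewrite ifF; last by apply/negbTE; rewrite -leNgt; lra.
    rewrite ifF; last by apply/negbTE; rewrite -leNgt; lra.
    by move: Bt; congr B; congr (_ / _); ring.
have decS : [set u : measurableTypeR R | - 2^-1 <= r * u < 2^-1] `&` B =
    (S (-1) `&` B) `|` ((S 0 `&` B) `|` (S 1 `&` B)).
  rewrite -!setIUl; congr (_ `&` _); apply/seteqP; split=> u; rewrite /S /=.
    move=> /andP[h1 h2]; rewrite h1 h2 /=.
    have [h3|h3] := ltP (r * u + a) 0; first by right; right; lra.
    by have [h4|h4] := ltP (r * u + a) 1; [right; left|left]; lra.
  by move=> [|[|]] /andP[].
have rS j : mu (aff j @^-1` (S j `&` B)) = (r%:E * mu (S j `&` B))%E.
  exact: lebesgue_measure_affine.
have SS i j : i + 1 <= j -> (S i `&` B) `&` (S j `&` B) = set0.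
  move=> ij; rewrite -subset0 => u; rewrite /S /=.
  by move=> -[[/andP[_ h1] _] [/andP[_ h2] _]]; lra.
have aSS i j : i + 1 <= j ->
    (aff i @^-1` (S i `&` B)) `&` (aff j @^-1` (S j `&` B)) = set0.
  move=> ij; rewrite -subset0 => t; rewrite /S /= !affE.
  by move=> -[[/andP[h1 h1'] _] [/andP[h2 h2'] _]]; lra.
have mU (X1 X2 X3 : set (measurableTypeR R)) : measurable X1 -> measurable X2 ->
    measurable X3 -> X1 `&` X2 = set0 -> X1 `&` X3 = set0 -> X2 `&` X3 = set0 ->
    mu (X1 `|` (X2 `|` X3)) = (mu X1 + (mu X2 + mu X3))%E.
  move=> m1 m2 m3 d12 d13 d23; rewrite measureU//; last 2 first.
  - exact: measurableU.
  - by rewrite setIUr d12 d13 setU0.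
  by rewrite measureU.
rewrite decT decS !mU//; try by [apply: SS; lra|apply: aSS; lra].
by rewrite !ge0_muleDr ?adde_ge0//= !rS.
Qed.

End unroll.

(** * Toroidal distance and closed conditions on tuples *)

Section euclidean_norm.
Context {R : realType} (d : nat).
Implicit Types (u v : 'I_d -> R) (x y w : pt[R]_d).

Lemma enorm_ge0 u : 0 <= enorm u.
Proof. exact: sqrtr_ge0. Qed.

Lemma enormE u : enorm u ^+ 2 = \sum_(i < d) u i ^+ 2.
Proof. by rewrite sqr_sqrtr// sumr_ge0// => i _; rewrite sqr_ge0. Qed.

Lemma ler_abs_enorm u i : `|u i| <= enorm u.
Proof.
rewrite -sqrtr_sqr ler_sqrt ?sumr_ge0// => [|j _]; last exact: sqr_ge0.
by rewrite (bigD1 i)//= lerDl sumr_ge0// => j _; rewrite sqr_ge0.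
Qed.

Lemma enormZ (c : R) u : enorm (fun i => c * u i) = `|c| * enorm u.
Proof.
rewrite /enorm; under eq_bigr do rewrite exprMn.
by rewrite -mulr_sumr sqrtrM ?sqr_ge0// sqrtr_sqr.
Qed.

Lemma eq_enorm u v : u =1 v -> enorm u = enorm v.
Proof. by move=> uv; congr (Num.sqrt _); apply: eq_bigr => i _; rewrite uv. Qed.

Lemma enorm0 : enorm (fun _ : 'I_d => 0 : R) = 0.
Proof. by rewrite /enorm big1 ?sqrtr0// => i _; rewrite expr0n. Qed.

Lemma enormB u v : enorm (fun i => u i - v i) = enorm (fun i => v i - u i).
Proof.
rewrite (@eq_enorm _ (fun i => - 1 * (v i - u i))) ?enormZ ?normrN1 ?mul1r//.
by move=> i; rewrite mulN1r opprB.
Qed.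

Lemma enorm_le_sum u : enorm u <= \sum_i `|u i|.
Proof.
have h : 0 <= \sum_i `|u i| by apply: sumr_ge0.
rewrite -(ger0_norm h) -sqrtr_sqr ler_sqrt ?sqr_ge0// expr2 mulr_suml.
apply: ler_sum => i _; rewrite -(real_normK (num_real (u i))) expr2 ler_wpM2l//.
by rewrite (bigD1 i)//= lerDl sumr_ge0.
Qed.

Lemma enorm_le_max u (e : R) : (forall i, `|u i| <= e) -> enorm u <= d%:R * e.
Proof.
move=> ue; apply: le_trans (enorm_le_sum u) _.
apply: le_trans (ler_sum _ (fun i _ => ue i)) _.
by rewrite sumr_const card_ord mulr_natl.
Qed.

Lemma enorm_eq0 u : enorm u = 0 -> forall i, u i = 0.
Proof.
by move=> u0 i; apply/eqP; rewrite -normr_le0 -u0 ler_abs_enorm.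
Qed.

(* Weighted AM-GM, [2 u_i v_i <= (b / a) u_i^2 + (a / b) v_i^2] with [a] and [b]
   the two norms, gives Cauchy-Schwarz after summation. *)
Lemma ler_enormD u v : enorm (fun i => u i + v i) <= enorm u + enorm v.
Proof.
have [u0|a0] := eqVneq (enorm u) 0.
  rewrite (@eq_enorm _ v) ?lerDr ?enorm_ge0// => i.
  by rewrite (enorm_eq0 u0) add0r.
have [v0|b0] := eqVneq (enorm v) 0.
  rewrite (@eq_enorm _ u) ?lerDl ?enorm_ge0// => i.
  by rewrite (enorm_eq0 v0) addr0.
set a := enorm u in a0 *; set b := enorm v in b0 *.
have {}a0 : 0 < a by rewrite lt_def a0 enorm_ge0.
have {}b0 : 0 < b by rewrite lt_def b0 enorm_ge0.
rewrite -ler_sqr ?nnegrE ?addr_ge0 ?enorm_ge0// enormE.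
rewrite [leRHS](_ : _ = \sum_(i < d) ((1 + b / a) * u i ^+ 2 + (1 + a / b) * v i ^+ 2)).
  apply: ler_sum => i _; rewrite -subr_ge0.
  rewrite [leRHS](_ : _ = (a * b)^-1 * (b * u i - a * v i) ^+ 2).
    by rewrite mulr_ge0 ?sqr_ge0// invr_ge0 mulr_ge0 ?ltW.
  by field; rewrite !gt_eqF.
rewrite big_split/= -!mulr_sumr -!enormE -/a -/b.
by field; rewrite !gt_eqF.
Qed.

Definition edist x y : R := enorm (fun i => tnth x i - tnth y i).

Lemma edistC x y : edist x y = edist y x.
Proof. exact: enormB. Qed.

Lemma edist_triangle y x z : edist x z <= edist x y + edist y z.
Proof.
apply: le_trans (ler_enormD _ _).
rewrite le_eqVlt; apply/orP; left; apply/eqP; apply: eq_enorm => i.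
by rewrite addrA subrK.
Qed.

Lemma edistxx x : edist x x = 0.
Proof. by rewrite /edist (@eq_enorm _ (fun=> 0)) ?enorm0// => i; rewrite subrr. Qed.

Definition pclose (e : R) x y := forall i, `|tnth x i - tnth y i| <= e.

Lemma pclose_edist e x y : pclose e x y -> edist x y <= d%:R * e.
Proof. exact: enorm_le_max. Qed.

Lemma edist_lip e x x' w w' : pclose e x x' -> pclose e w w' ->
  edist x' w' <= edist x w + d%:R * 2 * e.
Proof.
move=> /pclose_edist xx' /pclose_edist ww'.
have := edist_triangle x x' w'; have := edist_triangle w x w'.
by rewrite (edistC x' x); lra.
Qed.

Local Notation tset x y := [set enorm (fun i => tnth x i - tnth y i + (z i)%:~R)
      | z in [set: 'I_d -> int]].

Lemma tdist_has_inf x y : has_inf (tset x y).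
Proof.
split; first by exists (enorm (fun i => tnth x i - tnth y i + (0 : int)%:~R)), (fun=> 0).
by exists 0 => _ [z _ <-]; exact: enorm_ge0.
Qed.

Lemma tdist_le x y (z : 'I_d -> int) :
  tdist x y <= enorm (fun i => tnth x i - tnth y i + (z i)%:~R).
Proof. by apply: ge_inf; [case: (tdist_has_inf x y)|exists z]. Qed.

Lemma tdist_ge0 x y : 0 <= tdist x y.
Proof.
apply: lb_le_inf; first by case: (tdist_has_inf x y).
by move=> _ [z _ <-]; exact: enorm_ge0.
Qed.

(** The distance is an infimum over integer translates; approximate minimisers replace an attained
    minimum. *)
Lemma tdist_leP x y (r : R) : (forall e, 0 < e -> exists z : 'I_d -> int,
    enorm (fun i => tnth x i - tnth y i + (z i)%:~R) <= r + e) <-> tdist x y <= r.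
Proof.
split=> [H|xyr e e0].
  apply/ler_addgt0Pr => e e0; have [z] := H e e0.
  exact: le_trans (tdist_le _ _ _).
have [_ [z _ <-]] := inf_adherent e0 (tdist_has_inf x y).
by move=> /ltW h; exists z; rewrite (le_trans h)// lerD2r.
Qed.

Lemma tdist_lip e x x' w w' : pclose e x x' -> pclose e w w' ->
  tdist x' w' <= tdist x w + d%:R * 2 * e.
Proof.
move=> xx' ww'; apply/tdist_leP => e1 e10.
have [z hz] := (@tdist_leP x w (tdist x w)).2 (lexx _) e1 e10.
exists z; apply: (@le_trans _ _ (enorm (fun i => tnth x i - tnth w i + (z i)%:~R) +
  enorm (fun i => (tnth x' i - tnth x i) + (tnth w i - tnth w' i)))).
  apply: le_trans (ler_enormD _ _).
  rewrite le_eqVlt [X in _ == X](_ : _ = enorm (fun i => tnth x' i - tnth w' i + (z i)%:~R)) ?eqxx//.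
  by apply: eq_enorm => i; ring.
have : enorm (fun i => (tnth x' i - tnth x i) + (tnth w i - tnth w' i)) <= d%:R * (e + e).
  apply: enorm_le_max => i; apply: le_trans (ler_normD _ _) _.
  by rewrite lerD// distrC.
by move: hz; lra.
Qed.

Lemma tdistxx x : tdist x x = 0.
Proof.
apply/eqP; rewrite eq_le tdist_ge0 andbT; apply: le_trans (tdist_le x x (fun=> 0)) _.
by rewrite (@eq_enorm _ (fun=> 0)) ?enorm0// => i; rewrite subrr addr0.
Qed.

Definition pbox (a b : R) : set pt[R]_d := [set x | forall i, a <= tnth x i <= b].

Lemma pbox_cluster (a b : R) (w : nat -> pt[R]_d) : (forall n, pbox a b (w n)) ->
  exists2 v, pbox a b v & forall e, 0 < e -> forall N, exists2 n, (N <= n)%N & pclose e v (w n).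
Proof.
move=> wab; pose V (n : nat) : 'rV[R]_d := \row_i tnth (w n) i.
have cpt : compact [set v : 'rV[R]_d | forall i : 'I_d, (fun=> `[a, b]%classic) i (v ord0 i)].
  by apply: (@rV_compact _ d (fun=> `[a, b]%classic)) => i; exact: segment_compact.
have [|v [vab cv]] := cpt (V @ \oo)%classic _.
  by exists 0%N => // n _ /= i; rewrite /V mxE /= in_itv /=; exact: wab.
pose v' : pt[R]_d := [tuple v ord0 i | i < d].
exists v' => [i|e e0 N]; first by rewrite tnth_mktuple; have := vab i; rewrite /= in_itv.
have [||u [[n Nn <-] Bu]] := cv [set V n | n in [set n | (N <= n)%N]] (ball v e).
- by exists N => // n Nn /=; exists n.
- exact: nbhsx_ballx.
exists n => // i; rewrite tnth_mktuple.
by have := Bu.2 ord0 i; rewrite /V mxE /ball /= => /ltW.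
Qed.

Variables (dist : pt[R]_d -> pt[R]_d -> R) (C : R).
Hypothesis dist_lip : forall e x x' w w', pclose e x x' -> pclose e w w' ->
  dist x' w' <= dist x w + C * e.

(** The witnesses for e = 1/(n+1) stay in a compact box; the Lipschitz bound carries the
    inequalities over to a cluster point. An abstract [dist] lets the lemma serve both the torus and
    R^d. *)
Lemma common_point_closed (I : eqType) (J : seq I) (x : I -> pt[R]_d) (a b r : R) :
  (forall e, 0 < e -> exists2 w, pbox a b w & forall j, j \in J -> dist (x j) w <= r + e) ->
  exists2 w, pbox a b w & forall j, j \in J -> dist (x j) w <= r.
Proof.
move=> H.
have /choice [w hw] : forall n : nat, exists w, pbox a b w /\
    forall j, j \in J -> dist (x j) w <= r + n.+1%:R^-1.
  by move=> n; have [//|w] := H n.+1%:R^-1 _; exists w.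
have [v vab cv] := pbox_cluster (fun n => (hw n).1).
exists v => // j jJ; apply/ler_addgt0Pr => e e0.
pose C' := Num.max C 1.
have C'1 : 1 <= C' by rewrite /C' le_max lexx orbT.
have CC' : C <= C' by rewrite /C' le_max lexx.
have C'0 : 0 < C' by apply: lt_le_trans C'1.
pose N := Num.truncn (2 / e).
have e'0 : 0 < e / 2 / C' by rewrite !divr_gt0.
have [n Nn vn] := cv (e / 2 / C') e'0 N.
have xx : pclose (e / 2 / C') (x j) (x j) by move=> i; rewrite subrr normr0 ltW.
have vn' : pclose (e / 2 / C') (w n) v by move=> i; rewrite distrC.
have := dist_lip xx vn'.
have : n.+1%:R^-1 <= e / 2.
  rewrite -[leRHS]invrK lef_pV2 ?posrE ?invr_gt0 ?divr_gt0// invf_div.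
  rewrite (le_trans (ltW (truncnS_gt _)))// ler_nat ltnS; exact: Nn.
have : C * (e / 2 / C') <= e / 2.
  by rewrite mulrCA mulrA -mulrA ger_pMr ?divr_gt0// ler_pdivrMr// mul1r.
have := (hw n).2 j jJ.
move: (C * _) (n.+1%:R^-1) => u1 u2; lra.
Qed.

End euclidean_norm.

(** * Closed conditions and nerves *)

Section closed_sets.
Context {R : realType} (d : nat).

(** Closedness for the sup metric on all coordinates. It is the property behind the grid
    approximation: a tuple violating [h] still violates it after each point moves within a small
    enough cell. *)
Definition pclosed m (h : set (m.-tuple pt[R]_d)) := forall x, ~ h x ->
  exists2 e : R, 0 < e &
    forall y, (forall j, pclose e (tnth x j) (tnth y j)) -> ~ h y.

Lemma pclosed_le m (h : set (m.-tuple pt[R]_d)) x : pclosed h -> ~ h x ->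
  \forall e \near (0 : R)^'+,
    forall y, (forall j, pclose e (tnth x j) (tnth y j)) -> ~ h y.
Proof.
move=> ch /ch [e e0 H]; near=> e' => y xy; apply: H => j i.
by apply: le_trans (xy j i) _; near: e'; exact: nbhs_right_le.
Unshelve. all: by end_near. Qed.

Lemma pclosed_ex m (I : finType) (h : I -> set (m.-tuple pt[R]_d)) :
  (forall i, pclosed (h i)) -> pclosed [set t | exists i, h i t].
Proof.
move=> ch x /forallNP hx.
have : \forall e \near (0 : R)^'+, forall i, forall y,
    (forall j, pclose e (tnth x j) (tnth y j)) -> ~ h i y.
  by apply: filter_forall => i; exact: (pclosed_le (ch i) (hx i)).
move=> H; near (0 : R)^'+ => e.
exists e => // y xy [i hi]; have : forall i, forall y,
    (forall j, pclose e (tnth x j) (tnth y j)) -> ~ h i y by near: e.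
by move=> /(_ i y xy).
Unshelve. all: by end_near. Qed.

(** The complement is a countable union of boxes with rational centres and half-sides 1/(n+1). *)
Lemma measurable_pclosed m (h : set (m.-tuple pt[R]_d)) :
  pclosed h -> measurable h.
Proof.
move=> ch; rewrite -(setCK h); apply: measurableC.
pose slab (c n : R) : set (measurableTypeR R) := [set u | `|u - c| <= n].
pose cell (n : nat) (q : d.-tuple rat) : set pt[R]_d :=
  [set x | forall i, slab (ratr (tnth q i)) n.+1%:R^-1 (tnth x i)].
pose box (nq : nat * m.-tuple (d.-tuple rat)) : set (m.-tuple pt[R]_d) :=
  [set t | forall j, cell nq.1 (tnth nq.2 j) (tnth t j)].
have mslab c n : measurable (slab c n).
  rewrite (_ : slab c n = `[c - n, c + n]%classic)//.
  by apply/seteqP; split=> u; rewrite /slab /= in_itv /= ler_distl.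
have mcell n q : measurable (cell n q).
  apply: (@measurable_tnth_set _ _ d (fun i => slab (ratr (tnth q i)) n.+1%:R^-1)).
  by move=> i; exact: mslab.
have mbox nq : measurable (box nq).
  exact: (@measurable_tnth_set _ _ m (fun j => cell nq.1 (tnth nq.2 j))).
rewrite (_ : ~` h = \bigcup_nq (if pselect (box nq `<=` ~` h) then box nq else set0)).
  apply: countable_bigcupT_measurable => // nq.
  by case: pselect => _ /=; [exact: mbox|exact: measurable0].
apply/seteqP; split=> [x hx|x [nq _]]; last by case: pselect => //= bs bx; exact: bs.
have [e e0 H] := ch x hx.
(* Both the given point and any other point of the box are within 1/(n+1) of the rational centre,
   hence the 2. *)
pose n := Num.truncn (2 / e).
have ne : 2 * n.+1%:R^-1 <= e.
  rewrite ler_pdivrMr// mulrC -ler_pdivrMr//.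
  exact: ltW (truncnS_gt _).
have n0 : 0 < n.+1%:R^-1 :> R by rewrite invr_gt0.
have /choice[q hq] : forall ji : 'I_m * 'I_d, exists q : rat,
    `|tnth (tnth x ji.1) ji.2 - ratr q| <= n.+1%:R^-1.
  move=> ji; have := @rat_in_itvoo R (tnth (tnth x ji.1) ji.2)
    (tnth (tnth x ji.1) ji.2 + n.+1%:R^-1).
  rewrite ltrDl => /(_ n0) [q]; rewrite in_itv/= => /andP[q1 q2].
  exists q; rewrite ler_distl; apply/andP; split.
    by rewrite lerBlDr ltW.
  by rewrite (le_trans (ltW q1))// lerDl ltW.
pose nq : nat * m.-tuple (d.-tuple rat) :=
  (n, [tuple [tuple q (j, i) | i < d] | j < m]).
have tq j i : tnth (tnth nq.2 j) i = q (j, i) by rewrite !tnth_mktuple.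
exists nq => //; case: pselect => [_ j i /=|[]].
  by rewrite tq; exact: (hq (j, i)).
move=> y yb; apply: H => j i; apply: le_trans ne.
have := yb j i; have := hq (j, i); rewrite /= tq distrC => h1 h2.
have := ler_normD (tnth (tnth x j) i - ratr (q (j, i))) (ratr (q (j, i)) - tnth (tnth y j) i).
rewrite addrA subrK => /le_trans; apply.
by rewrite mulr_natl mulr2n lerD// distrC.
Qed.

Implicit Types (p : complex_type) (B : pt[R]_d -> set pt[R]_d) (s : seq pt[R]_d).

(** One predicate for both complexes and any family of balls, so that toroidal and Euclidean
    simplices are treated alike. In the Rips case x = y is allowed, which only asks that each ball
    be nonempty. *)
Definition nerve p B s : Prop :=
  match p with
  | Cech => exists w, forall x, x \in s -> B x w
  | Rips => forall x y, x \in s -> y \in s -> exists w, B x w /\ B y w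
  end.

Lemma nerve_sub p B s s' : {subset s' <= s} -> nerve p B s -> nerve p B s'.
Proof.
case: p => /= ss; first by move=> [w hw]; exists w => x /ss; exact: hw.
by move=> H x y /ss xs /ss ys; exact: H.
Qed.

Lemma nerve_pair p B s x y : nerve p B s -> x \in s -> y \in s ->
  exists w, B x w /\ B y w.
Proof.
case: p => /= [[w hw] xs ys|H]; first by exists w; split; exact: hw.
exact: H.
Qed.

(** The Rips condition is a conjunction of Cech conditions on pairs, so the Cech case suffices. *)
Lemma nerve_pclosed p B m :
  (forall J : seq 'I_m, pclosed [set t | nerve Cech B [seq tnth t j | j <- J]]) ->
  forall J : seq 'I_m, pclosed [set t | nerve p B [seq tnth t j | j <- J]].
Proof.
case: p => // cC J x /=.
move=> /existsNP[x1 /existsNP[x2 /not_implyP[/mapP[j1 j1J ->] /not_implyP[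
  /mapP[j2 j2J ->] H]]]].
have [|e e0 He] := cC [:: j1; j2] x.
  move=> /= -[w hw]; apply: H; exists w.
  by split; apply: hw; rewrite !inE eqxx ?orbT.
exists e => // y xy Hy; apply: (He y xy) => /=.
have [w [w1 w2]] := Hy _ _ (map_f (tnth y) j1J) (map_f (tnth y) j2J).
by exists w => z; rewrite !inE => /orP[/eqP->|/eqP->].
Qed.

Lemma nerve_tball_pclosed p r m (J : seq 'I_m) :
  pclosed [set t | nerve p (fun x => tball x r) [seq tnth t j | j <- J]].
Proof.
apply: nerve_pclosed => {}J x /= hx; apply: contrapT => He; apply: hx.
have [|w wab hw] := @common_point_closed R d _ _ (@tdist_lip R d) _ J (tnth x) 0 1 r.
  (* The Lipschitz constant of the distance is 2 d; adding 1 allows division also when d = 0. *)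
  move=> e e0; have C0 : 0 < d%:R * 2 + 1 :> R by rewrite ltr_wpDl// mulr_ge0.
  have e'0 : 0 < e / (d%:R * 2 + 1) by rewrite divr_gt0.
  have /existsNP[y /not_implyP[xy /contrapT [w hw]]] :
      ~ forall y, (forall j, pclose (e / (d%:R * 2 + 1)) (tnth x j) (tnth y j)) ->
        ~ (exists w, forall z, z \in [seq tnth y j | j <- J] -> tball z r w).
    by move=> H; apply: He; exists (e / (d%:R * 2 + 1)).
  have [[j0 j0J]|J0] := pselect (exists j, j \in J); last first.
    exists [tuple 0 | i < d]; first by move=> i; rewrite tnth_mktuple lexx ler01.
    by move=> j jJ; case: J0; exists j.
  exists w; first by have [] := hw _ (map_f (tnth y) j0J).
  move=> j jJ; have [_ /= yw] := hw _ (map_f (tnth y) jJ).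
  have yx : pclose (e / (d%:R * 2 + 1)) (tnth y j) (tnth x j).
    by move=> i; rewrite distrC; exact: xy.
  have ww : pclose (e / (d%:R * 2 + 1)) w w by move=> i; rewrite subrr normr0 ltW.
  apply: le_trans (tdist_lip yx ww) _; apply: lerD => //.
  by rewrite mulrA ler_pdivrMr// mulrC ler_wpM2l ?ltW// ltrDl.
by exists w => z /mapP[j jJ ->]; split; [exact: wab|exact: hw].
Qed.

End closed_sets.

(** * Discretization of the Poisson process *)

Section cells.
Context {R : realType} (d : nat).
Local Notation pt := pt[R]_d.

Lemma measurable_torus : measurable (@torus R d).
Proof.
apply: (@measurable_tnth_set _ _ d (fun=> [set u : measurableTypeR R | 0 <= u <= 1])).
by move=> _; rewrite (_ : [set _ | _] = `[0, 1]%classic).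
Qed.

Lemma leb_Rd_torus : leb_Rd d (@torus R d) = 1%E.
Proof.
rewrite /leb_Rd (_ : torus (d:=d) = [set t | forall i,
    (fun=> [set u : measurableTypeR R | 0 <= u <= 1]) i (tnth t i)])//.
have e : [set u : measurableTypeR R | 0 <= u <= 1] = `[0, 1]%classic by [].
rewrite (@tuple_measure_box _ _ R lebesgue_measure d
  (fun=> [set u : measurableTypeR R | 0 <= u <= 1])); last by move=> _; rewrite e.
rewrite big1// => i _; rewrite e.
transitivity (lebesgue_measure (`[0, 1]%classic : set R)); first by [].
by rewrite lebesgue_measure_itv /= lte_fin ltr01 oppr0 adde0.
Qed.

(** There are n + 1 intervals per axis, with indices 0 to n; the index n + 1 catches the coordinate
    1. *)
Definition cell_index n (x : pt) : d.-tuple 'I_n.+2 :=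
  [tuple inord (Num.truncn (n.+1%:R * tnth x i)) | i < d].

Definition cell n (l : d.-tuple 'I_n.+2) : set pt :=
  @torus R d `&` cell_index n @^-1` [set l].

Lemma cell_indexP n (l : d.-tuple 'I_n.+2) x i : torus x ->
  (tnth (cell_index n x) i == tnth l i) =
  ((tnth l i)%:R <= n.+1%:R * tnth x i < (tnth l i).+1%:R).
Proof.
move=> /(_ i)/andP[x0 x1]; rewrite tnth_mktuple.
rewrite -truncn_eq ?mulr_ge0// -val_eqE /= inordK//.
rewrite truncn_lt_nat ?mulr_ge0//.
by apply: (@le_lt_trans _ _ n.+1%:R); rewrite ?ltr_nat// ler_piMr.
Qed.

Lemma cell_pclose n x y : torus x -> torus y ->
  cell_index n x = cell_index n y -> pclose n.+1%:R^-1 x y.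
Proof.
move=> tx ty xy i.
have := cell_indexP (cell_index n x) i tx; rewrite eqxx => /esym/andP[x1 x2].
have := cell_indexP (cell_index n x) i ty; rewrite -xy eqxx => /esym/andP[y1 y2].
rewrite -(ler_pM2l (ltr0Sn R n)) divff ?pnatr_eq0//.
rewrite -[X in X * `|_|]ger0_norm// -normrM ler_norml mulrBr.
move: x1 x2 y1 y2; move: (nat_of_ord _) => c.
have -> : c.+1%:R = c%:R + 1 :> R by rewrite natr1.
by move: (_ * tnth x i) (_ * tnth y i) (c%:R) => a b e; lra.
Qed.

Lemma measurable_cell n (l : d.-tuple 'I_n.+2) : measurable (cell l).
Proof.
pose s (i : 'I_d) : set (measurableTypeR R) := [set u | (tnth l i)%:R <= n.+1%:R * u < (tnth l i).+1%:R].
have ms i : measurable (s i).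
  rewrite (_ : s i = `[(tnth l i)%:R / n.+1%:R, (tnth l i).+1%:R / n.+1%:R[%classic)//.
  apply/seteqP; split=> u; rewrite /s /= in_itv /= ler_pdivrMr// ltr_pdivlMr//;
  by rewrite ![u * _]mulrC.
rewrite (_ : cell l = @torus R d `&` [set x | forall i, s i (tnth x i)]).
  apply: measurableI; first exact: measurable_torus.
  exact: measurable_tnth_set.
apply/seteqP; split=> [x [tx /= xl]|x [tx /= xs]]; split=> //.
  by move=> i; rewrite /s /= -cell_indexP// xl.
apply: eq_from_tnth => i; apply/eqP; rewrite cell_indexP//; exact: xs.
Qed.

(** An outer approximation of [h] by products of cells. For closed [h] the excess at a given tuple
    disappears as the mesh shrinks. *)
Definition cellwise n m (h : set (m.-tuple pt)) : set (m.-tuple (d.-tuple 'I_n.+2)) :=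
  [set i | exists x, [/\ forall j, torus (tnth x j), map_tuple (cell_index n) x = i & h x]].

Arguments cellwise n {m} h _.

Lemma cellwise_near m (h : set (m.-tuple pt)) x : pclosed h ->
  (forall j, torus (tnth x j)) ->
  \forall n \near \oo, cellwise n h (map_tuple (cell_index n) x) <-> h x.
Proof.
move=> ch tx; have [hx|hx] := pselect (h x).
  by near=> n; split=> // _; exists x.
have [e e0 He] := ch x hx.
near=> n; split=> // -[y [ty yx hy]].
exfalso; apply: (He y) hy => j i.
have ne : n.+1%:R^-1 <= e.
  by apply: ltW; near: n; exact: (near_infty_natSinv_lt (PosNum e0)).
apply: le_trans ne; apply: cell_pclose => //.
by have := congr1 (fun t => tnth t j) yx; rewrite !tnth_map.
Unshelve. all: by end_near. Qed.

(** The diagonal is closed in the set of pairs, so [cellwise_near] applies to it. *)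
Lemma cell_index_near x y : torus x -> torus y -> x <> y ->
  \forall n \near \oo, cell_index n x <> cell_index n y.
Proof.
move=> tx ty xy.
have ch : pclosed [set t : 2.-tuple pt | thead t = tnth t (lift ord0 ord0)].
  move=> t /= tt; have /existsNP[i ti] : ~ forall i, tnth (thead t) i = tnth (tnth t (lift ord0 ord0)) i.
    by move=> H; apply: tt; exact: eq_from_tnth.
  have t0 : 0 < `|tnth (thead t) i - tnth (tnth t (lift ord0 ord0)) i|.
    by rewrite normr_gt0 subr_eq0; exact/eqP.
  exists (`|tnth (thead t) i - tnth (tnth t (lift ord0 ord0)) i| / 3); first by rewrite divr_gt0.
  move=> u tu eu; have := tu ord0 i; have := tu (lift ord0 ord0) i.
  rewrite -eu /thead; move: t0; rewrite /thead.
  set a : R := tnth (tnth t ord0) i; set b : R := tnth _ i.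
  set c : R := tnth (tnth u ord0) i => t0 h1 h2.
  have := ler_normD (a - c) (c - b); rewrite addrA subrK (distrC c b).
  by move: h1 h2 t0; clear; move: `|a - c| `|b - c| `|a - b| => p1 p2 p3; lra.
have txy j : torus (tnth [tuple x; y] j).
  by case: (unliftP ord0 j) => [i ->|->]; rewrite ?tnthS ?tnth0// ord1 tnth0.
have := cellwise_near ch txy; apply: filterS => n [H _] nxy.
apply: xy; apply: H; exists [tuple x; x]; split => //.
- by move=> j; case: (unliftP ord0 j) => [i ->|->]; rewrite ?tnthS ?tnth0// ord1 tnth0.
- by apply: val_inj => /=; rewrite nxy.
Qed.

End cells.

Arguments cellwise {R d} n {m} h _.

(** * Isolated tuples seen through cell counts *)

Section cell_counting.
Context {R : realType} (d : nat).
Local Notation pt := pt[R]_d.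
Variables (m : nat) (h : set (m.-tuple pt)) (g : set (m.+1.-tuple pt)).
Hypotheses (ch : pclosed h) (cg : pclosed g).
Implicit Types (S : {fset pt}).

Definition count_in S (B : set pt) : nat := #|` [fset x in S | `[< B x >]]%fset|.

Lemma count_in0P S B : reflect (forall x, x \in S -> ~ B x) (count_in S B == 0%N).
Proof.
apply: (iffP eqP) => [/cardfs0_eq S0 x xS Bx|H].
  have : x \in [fset x in S | `[< B x >]]%fset.
    by rewrite !inE/= xS /=; exact/asboolP.
  by rewrite S0 inE.
apply/eqP; rewrite cardfs_eq0; apply/eqP/fsetP => x; rewrite !inE/=.
by apply/negbTE/negP => /andP[/H Bx /asboolP].
Qed.

Lemma count_in1P S B : reflect (exists2 x, x \in S /\ B x &
  forall y, y \in S -> B y -> y = x) (count_in S B == 1%N).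
Proof.
apply: (iffP idP) => [/cardfs1P[x Sx]|[x [xS Bx] H]]; [exists x|apply/cardfs1P; exists x].
- have : x \in [fset x in S | `[< B x >]]%fset by rewrite Sx inE.
  by rewrite !inE/= => /andP[-> /asboolP].
- move=> y yS By; apply/eqP; rewrite -in_fset1 -Sx !inE/= yS.
  exact/asboolP.
- apply/fsetP => y; rewrite !inE/=; apply/andP/eqP => [[yS /asboolP By]|->].
    exact: H.
  by split=> //; exact/asboolP.
Qed.

(** Tuples are ordered, so each vertex set is counted m! times when [h] and [g] ignore the order of
    its points; this matches an integral over m-tuples. Entries live in the finite type of [S] to
    make this a finite set. *)
Definition isolated_tuples S : {set m.-tuple S} :=
  [set t : m.-tuple S | uniq t && `[< h (map_tuple val t) /\
    forall y, y \in S -> y \notin map val t ->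
      ~ g (cons_tuple y (map_tuple val t)) >]]%SET.

Variable n : nat.
Local Notation I := (d.-tuple 'I_n.+2).

(** The cells of [i] are excluded, so that this region is disjoint from them and its count is
    independent of theirs. *)
Definition cell_neighbours (i : m.-tuple I) : set pt :=
  [set z | [/\ torus z, cell_index n z \notin i &
     cellwise n g (cons_tuple (cell_index n z) i)]].

Definition isolated_cells S : {set m.-tuple I} :=
  [set i : m.-tuple I | [&& uniq i, `[< cellwise n h i >],
    [forall j, count_in S (cell (tnth i j)) == 1%N] &
    count_in S (cell_neighbours i) == 0%N]]%SET.

Definition cells_of S (t : m.-tuple S) : m.-tuple I :=
  map_tuple (cell_index n \o val) t.

Lemma isolated_cells_sub S :
  isolated_cells S \subset [set cells_of t | t in [set: m.-tuple S]]%SET.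
Proof.
apply/fintype.subsetP => i; rewrite inE => /and4P[_ _ /forallP i1 _].
have /choice[x hx] : forall j, exists x : S, cell (tnth i j) (val x).
  move=> j; have /count_in1P[x [xS cx] _] := i1 j.
  by exists [` xS]%fset.
apply/imsetP; exists [tuple x j | j < m]; rewrite ?inE//.
by apply: eq_from_tnth => j; rewrite tnth_map tnth_mktuple /=; case: (hx j).
Qed.

Variable S : {fset pt}.
Hypothesis Storus : forall x, x \in S -> torus x.
(** This and the next two hypotheses describe a mesh fine enough for the finite set [S]; for closed
    [h] and [g] they hold for all large n. *)
Hypothesis S_inj : forall x y : S, cell_index n (val x) = cell_index n (val y) -> x = y.
Hypothesis S_h : forall t : m.-tuple S,
  cellwise n h (map_tuple (cell_index n) (map_tuple val t)) <-> h (map_tuple val t).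
Hypothesis S_g : forall t : m.+1.-tuple S,
  cellwise n g (map_tuple (cell_index n) (map_tuple val t)) <-> g (map_tuple val t).

Lemma cells_of_inj : injective (@cells_of S).
Proof.
move=> s t st; apply: eq_from_tnth => j; apply: S_inj.
by have := congr1 (fun u => tnth u j) st; rewrite !tnth_map.
Qed.

Lemma cell_neighbours_cells_of (t : m.-tuple S) (y : S) : y \notin t ->
  cell_neighbours (cells_of t) (val y) <-> g (cons_tuple (val y) (map_tuple val t)).
Proof.
move=> yt; have e1 : map_tuple val (cons_tuple y t) = cons_tuple (val y) (map_tuple val t).
  exact: val_inj.
have e2 : map_tuple (cell_index n) (cons_tuple (val y) (map_tuple val t)) =
    cons_tuple (cell_index n (val y)) (cells_of t).
  by apply: val_inj => /=; rewrite -map_comp.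
rewrite -e1 -S_g e1 e2; split=> [[]//|gy]; split=> //; first exact: Storus (valP y).
apply: contra yt => /mapP[z zt] /S_inj yz; by rewrite yz.
Qed.

(** For such a mesh [cells_of] restricts to a bijection: points of [S] are separated by cells, and
    the cellwise conditions coincide with the true ones on tuples of [S]. *)
Lemma card_isolated_cells : #|isolated_cells S| = #|isolated_tuples S|.
Proof.
rewrite -(card_imset _ cells_of_inj); apply: eq_card => i.
apply/idP/imsetP => [iS|[t]]; last first.
  rewrite inE => /andP[ut /asboolP[ht Ht]] ->.
  rewrite inE; apply/and4P; split.
  - by rewrite map_inj_uniq// => x y; exact: S_inj.
  - apply/asboolP; rewrite (_ : cells_of t = map_tuple (cell_index n) (map_tuple val t)).
      exact/S_h.
    by apply: val_inj => /=; rewrite -map_comp.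
  - apply/forallP => j; apply/count_in1P; exists (val (tnth t j)).
      split; first exact: valP.
      by split; [apply: Storus; exact: valP|rewrite /= tnth_map].
    move=> y yS [_ /= cy]; have -> : y = val [` yS]%fset by [].
    by congr val; apply: S_inj; rewrite cy tnth_map.
  - apply/count_in0P => y yS ny.
    have yt : [` yS]%fset \notin t.
      apply/negP => yt; case: ny => _ /negP + _; apply.
      by apply/mapP; exists [` yS]%fset.
    apply: (Ht y yS); last exact/(cell_neighbours_cells_of yt).
    by apply: contra yt => /mapP[z zt yz]; rewrite (_ : [` yS]%fset = z)//; exact: val_inj.
have /imsetP[t _ it] := fintype.subsetP (isolated_cells_sub S) _ iS.
exists t => //; move: iS; rewrite it !inE => /and4P[ui /asboolP hi _ /count_in0P ni].
apply/andP; split; first by move: ui => /map_uniq.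
apply/asboolP; split.
  apply/S_h; rewrite (_ : map_tuple _ _ = cells_of t)//.
  by apply: val_inj => /=; rewrite -map_comp.
move=> y yS yt gy; apply: (ni y yS); have -> : y = val [` yS]%fset by [].
apply/cell_neighbours_cells_of => //.
by apply: contra yt => yt; apply/mapP; exists [` yS]%fset.
Qed.

End cell_counting.

Section cell_counting_near.
Context {R : realType} (d : nat).
Local Notation pt := pt[R]_d.
Variables (m : nat) (h : set (m.-tuple pt)) (g : set (m.+1.-tuple pt)).
Hypotheses (ch : pclosed h) (cg : pclosed g).

(** A finite set imposes finitely many conditions on the mesh. The threshold depends on [S], so this
    yields convergence outcome by outcome only, and passing to means requires domination. *)
Lemma card_isolated_cells_near (S : {fset pt}) : (forall x, x \in S -> torus x) ->
  \forall n \near \oo, #|isolated_cells h g n S| = #|isolated_tuples h g S|.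
Proof.
move=> St.
have tS k (t : k.-tuple S) j : torus (tnth (map_tuple val t) j).
  by rewrite tnth_map; apply: St; exact: valP.
have H1 : \forall n \near \oo, forall xy : S * S,
    cell_index n (val xy.1) = cell_index n (val xy.2) -> xy.1 = xy.2.
  apply: filter_forall => -[x y] /=.
  have [->|/eqP xy] := eqVneq x y; first exact: nearW.
  have vxy : val x <> val y by move=> /val_inj.
  have := cell_index_near (St _ (valP x)) (St _ (valP y)) vxy.
  by apply: filterS => n.
have H2 : \forall n \near \oo, forall t : m.-tuple S,
  cellwise n h (map_tuple (cell_index n) (map_tuple val t)) <-> h (map_tuple val t).
  by apply: filter_forall => t; exact: cellwise_near.
have H3 : \forall n \near \oo, forall t : m.+1.-tuple S,
  cellwise n g (map_tuple (cell_index n) (map_tuple val t)) <-> g (map_tuple val t).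
  by apply: filter_forall => t; exact: cellwise_near.
near=> n; apply: card_isolated_cells => //.
- by move=> x y; have := near H1 n; move=> /(_ _ (x, y)); apply.
- by near: n.
- by near: n.
Unshelve. all: by end_near. Qed.

End cell_counting_near.

(** * Probability of a configuration of cells *)

Section poisson_cells.
Context {R : realType} (d : nat) {disp : measure_display}
  {Omega : measurableType disp}.
Local Notation pt := pt[R]_d.
Variables (P : probability Omega R) (lam : R) (N : Omega -> {fset pt}).
Hypotheses (ppN : is_poisson_process P lam N) (lam0 : 0 <= lam).
Local Notation mu := (leb_Rd d).

(** The parameter 0 does occur: cells of index n + 1 in some coordinate are null, and there the law
    is the Dirac mass at 0. *)
Lemma poisson_prob_set0 (c : R) : 0 <= c -> poisson_prob c 0 [set 0%N] = (expR (- c))%:E.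
Proof.
rewrite le_eqVlt /poisson_prob => /predU1P[<-|c0].
  by rewrite ltxx diracE mem_set// oppr0 expR0.
by rewrite c0 esum_set1 ?lee_fin ?poisson_pmf_ge0// /poisson_pmf c0 expr0 mul1r fact0 invr1 mul1r.
Qed.

Lemma poisson_prob_set1 (c : R) : 0 <= c -> poisson_prob c 0 [set 1%N] = (c * expR (- c))%:E.
Proof.
rewrite le_eqVlt /poisson_prob => /predU1P[<-|c0].
  by rewrite ltxx diracE memNset// mul0r.
by rewrite c0 esum_set1 ?lee_fin ?poisson_pmf_ge0// /poisson_pmf c0 expr1 (_ : 1`! = 1)%N ?invr1 ?mulr1.
Qed.

Definition vol (B : set pt) : R := fine (mu B).

Lemma vol_ge0 B : 0 <= vol B.
Proof. by rewrite /vol fine_ge0. Qed.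

Lemma volE B : measurable B -> B `<=` @torus R d -> mu B = (vol B)%:E.
Proof.
move=> mB BT; rewrite /vol fineK// ge0_fin_numE//.
apply: (@le_lt_trans _ _ (mu (@torus R d))); last by rewrite leb_Rd_torus ltry.
by apply: le_measure; rewrite ?inE//; exact: measurable_torus.
Qed.

Lemma volU A B : measurable A -> measurable B -> A `<=` @torus R d ->
  B `<=` @torus R d -> A `&` B = set0 -> vol (A `|` B) = vol A + vol B.
Proof.
by move=> mA mB At Bt AB; rewrite /vol measureU//= volE// volE//.
Qed.

Variables (m : nat) (h : set (m.-tuple pt)) (g : set (m.+1.-tuple pt)).
Variable n : nat.
Local Notation idx := (d.-tuple 'I_n.+2).

Lemma cell_torus (l : idx) : cell l `<=` @torus R d.
Proof. by move=> x []. Qed.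

Lemma measurable_cells (L : set idx) : measurable (@torus R d `&` cell_index n @^-1` L).
Proof.
rewrite (_ : _ `&` _ = \bigcup_(l in L) cell l).
  by apply: fin_bigcup_measurable => // l _; exact: measurable_cell.
apply/seteqP; split=> [x [tx Lx]|x [l Ll [tx /= xl]]]; last by split=> //=; rewrite xl.
by exists (cell_index n x).
Qed.

(** The cells of [i] are put back: having exactly one point in a cell also costs a factor exp (- lam
    vol), so the volume of this union is the total exponent. *)
Definition cell_nbhd (i : m.-tuple idx) : set pt :=
  [set z | torus z /\ (cell_index n z \in i \/
     cellwise n g (cons_tuple (cell_index n z) i))].

Lemma measurable_cell_neighbours (i : m.-tuple idx) : measurable (cell_neighbours g i).
Proof.
rewrite (_ : cell_neighbours g i = @torus R d `&` cell_index n @^-1`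
    [set l | l \notin i /\ cellwise n g (cons_tuple l i)]).
  exact: measurable_cells.
by apply/seteqP; split=> z; rewrite /cell_neighbours /=; [case=> ? ? ?|case=> ? []].
Qed.

Lemma measurable_cell_nbhd (i : m.-tuple idx) : measurable (cell_nbhd i).
Proof. exact: (measurable_cells [set l | l \in i \/ cellwise n g (cons_tuple l i)]). Qed.

Lemma vol_cell_nbhd (i : m.-tuple idx) : uniq i ->
  vol (cell_nbhd i) = vol (cell_neighbours g i) + \sum_(j < m) vol (cell (tnth i j)).
Proof.
move=> ui.
have -> : cell_nbhd i = cell_neighbours g i `|` (@torus R d `&` cell_index n @^-1` [set l | l \in tval i]).
  apply/seteqP; split=> [z [tz /= zi]|z [[tz zi zg]|[tz /= zi]]].
  - by case: (boolP (cell_index n z \in i)) => H; [right|left; split=> //; case: zi => //; rewrite (negPf H)].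
  - by split=> //; right.
  - by split=> //; left.
have mA := measurable_cell_neighbours i.
have mB := measurable_cells [set l | l \in tval i].
rewrite (volU mA mB); [|by move=> z []|by move=> z []|]; last first.
  by rewrite -subset0 => z [[_ /negP zi _] [_ /=]].
congr (_ + _).
rewrite -(big_tuple _ _ i predT (fun l => vol (cell l))) /=.
move=> {mA mB}; elim: (tval i) ui => [_|l s IH /= /andP[ls us]].
  rewrite big_nil (_ : _ `&` _ = set0); first by rewrite /vol measure0.
  by rewrite -subset0 => z [_ /=].
have mA : measurable (cell l : set pt) by exact: measurable_cell.
have mB := measurable_cells [set l | l \in s].
rewrite big_cons -IH// -(volU mA mB); [|by move=> z []|by move=> z []|]; last first.
  rewrite -subset0 => z [[_ /= zl] [_ /= zs]].
  by move: ls; rewrite -zl zs.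
congr vol; apply/seteqP; split=> [z [tz /=]|z [[tz /= zl]|[tz /= zs]]].
- by rewrite inE => /orP[/eqP zl|zs]; [left|right].
- by split=> //=; rewrite inE zl eqxx.
- by split=> //=; rewrite inE zs orbT.
Qed.

Definition isolated_event (i : m.-tuple idx) : set Omega :=
  [set w | (forall j, npoints N (cell (tnth i j)) w = 1%N) /\
     npoints N (cell_neighbours g i) w = 0%N].

Lemma measurable_isolated_event i : measurable (isolated_event i).
Proof.
have mN B k : measurable B -> measurable (npoints N B @^-1` [set k]).
  by move=> mB; apply: measurable_preimageT => //; exact: (pp_measurable ppN).
rewrite (_ : isolated_event i =
   (\bigcap_(j in [set: 'I_m]) (npoints N (cell (tnth i j)) @^-1` [set 1%N])) `&`
   (npoints N (cell_neighbours g i) @^-1` [set 0%N])).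
  apply: measurableI; last by apply: mN; exact: measurable_cell_neighbours.
  by apply: fin_bigcap_measurable => // j _; apply: mN; exact: measurable_cell.
by apply/seteqP; split=> w [w1 w2]; split => // j; [move=> _|]; exact: w1.
Qed.

(** Distinct indices make the m cells and the empty region disjoint, so the probability is a product
    of m factors lam v exp (- lam v), with v the volume of a cell, and one factor exp (- lam v),
    with v the volume of the region. *)
Lemma prob_isolated_event (i : m.-tuple idx) : uniq i ->
  P (isolated_event i) =
  (lam ^+ m * \prod_(j < m) vol (cell (tnth i j)) * expR (- (lam * vol (cell_nbhd i))))%:E.
Proof.
move=> ui.
(* Index [ord0] carries the region to be empty, index [lift ord0 j] the j-th cell. *)
pose B (a : 'I_m.+1) := oapp (fun j => cell (tnth i j)) (cell_neighbours g i) (unlift ord0 a).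
pose Sv (a : 'I_m.+1) : set nat := if unlift ord0 a is Some _ then [set 1%N] else [set 0%N].
have mB a : measurable (B a).
  by rewrite /B; case: unliftP => [j _|_] /=;
    [exact: measurable_cell|exact: measurable_cell_neighbours].
have BT a : B a `<=` @torus R d.
  by rewrite /B; case: unliftP => [j _|_] /= z []//.
have tB : trivIset setT B.
  apply/trivIsetP => a b _ _; rewrite /B.
  case: (unliftP ord0 a) => [j ->|->]; case: (unliftP ord0 b) => [k ->|->] /= ab;
    rewrite -subset0 => z [].
  - move=> [_ /= zj] [_ /= zk]; move/eqP: ab; apply; congr (lift _ _).
    by apply: (tuple_uniqP _ ui); rewrite -zj -zk.
  - by move=> [_ /= zj] [_ /negP zn _]; apply: zn; rewrite zj mem_tnth.
  - by move=> [_ /negP zn _] [_ /= zj]; apply: zn; rewrite zj mem_tnth.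
  - by [].
have := pp_independent ppN mB BT tB Sv.
rewrite (_ : \bigcap_a _ = isolated_event i); last first.
  apply/seteqP; split=> w.
    move=> H; split=> [j|].
      by have := H (lift ord0 j) I; rewrite /B /Sv liftK.
    by have := H ord0 I; rewrite /B /Sv unlift_none.
  move=> [H1 H2] a _ /=; rewrite /B /Sv.
  by case: unliftP => [j _|_] /=.
move=> ->; rewrite big_ord_recl.
have mc j : measurable (cell (tnth i j) : set pt) by exact: measurable_cell.
have -> : P (npoints N (B ord0) @^-1` Sv ord0) =
    (expR (- (lam * vol (cell_neighbours g i))))%:E.
  rewrite (pp_poisson ppN)// /B /Sv unlift_none /=.
  by rewrite poisson_prob_set0// mulr_ge0// vol_ge0.
under eq_bigr => j _.
  rewrite (pp_poisson ppN)// /B /Sv liftK /= poisson_prob_set1 ?mulr_ge0 ?vol_ge0//.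
  over.
rewrite -[X in (_ * X)%E]/(\prod_(j < m) _)%E /= prodEFin -EFinM; congr (_%:E).
rewrite vol_cell_nbhd// mulrDr opprD expRD [RHS]mulrCA; congr (_ * _).
rewrite !big_split/= prodr_const card_ord; congr (_ * _).
rewrite -mulrN -sumrN mulr_sumr expR_sum; apply: eq_bigr => j _.
by rewrite mulrN.
Qed.

End poisson_cells.

Section poisson_moments.
Context {R : realType} (d : nat) {disp : measure_display}
  {Omega : measurableType disp}.
Local Notation pt := pt[R]_d.
Variables (P : probability Omega R) (lam : R) (N : Omega -> {fset pt}).
Hypotheses (ppN : is_poisson_process P lam N) (lam0 : 0 < lam).

Lemma measurable_fun_npoints (f : nat -> R) (B : set pt) : measurable B ->
  measurable_fun setT (fun w => f (npoints N B w)).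
Proof.
move=> mB; apply: (@measurableT_comp _ _ _ _ _ _ f) => //.
exact: (pp_measurable ppN).
Qed.

(** The generating function of the Poisson law: M^k times the weight for [lam] is exp (M lam - lam)
    times the weight for M lam, and the latter weights sum to 1. *)
Lemma sum_poisson_pmf (M : R) : 0 < M ->
  (\sum_(0 <= k <oo) (M ^+ k * poisson_pmf lam k)%:E = (expR (M * lam - lam))%:E)%E.
Proof.
move=> M0; have Ml : 0 < M * lam by rewrite mulr_gt0.
have := @probability_setT _ _ R (poisson_prob (M * lam) 0).
rewrite /= /poisson_prob Ml -nneseries_esumT; last first.
  by move=> *; rewrite lee_fin poisson_pmf_ge0.
move=> /(congr1 (fun x => (expR (M * lam - lam))%:E * x)%E); rewrite mule1 => <-.
rewrite -nneseriesZl; last by move=> k _; rewrite lee_fin poisson_pmf_ge0.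
apply: eq_eseriesr => k _; rewrite -EFinM; congr (_%:E).
rewrite /poisson_pmf Ml lam0 exprMn expRD !expRN.
by field; rewrite !gt_eqF ?expR_gt0// ltr0n fact_gt0.
Qed.

Lemma integrable_exp_npoints (M : R) : 0 < M ->
  P.-integrable setT (EFin \o (fun w => M ^+ npoints N (@torus R d) w)).
Proof.
move=> M0; have mT := @measurable_torus R d.
have mf : measurable_fun setT (EFin \o (fun w => M ^+ npoints N (@torus R d) w)).
  exact/measurable_EFinP/(measurable_fun_npoints (fun k => M ^+ k) mT).
apply/integrableP; split => //.
rewrite (eq_integral (EFin \o (fun w => M ^+ npoints N (@torus R d) w))); last first.
  by move=> w _ /=; rewrite ger0_norm// exprn_ge0// ltW.
pose F k := npoints N (@torus R d) @^-1` [set k].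
have FT : [set: Omega] = \bigcup_k F k.
  by apply/esym; rewrite -subTset => w _; exists (npoints N (@torus R d) w).
have mF k : measurable (F k).
  by apply: measurable_preimageT => //; exact: (pp_measurable ppN).
rewrite FT ge0_integral_bigcup//; last 3 first.
- by rewrite -FT.
- by move=> w _; rewrite lee_fin exprn_ge0// ltW.
- by apply/trivIsetP => i j _ _ /eqP ij; rewrite -subset0 => w [/= iw jw];
  apply: ij; rewrite -iw -jw.
rewrite (eq_eseriesr (g := fun k => (M ^+ k * poisson_pmf lam k)%:E)); last first.
  move=> k _; rewrite (eq_integral (cst (M ^+ k)%:E)); last first.
    by move=> w /set_mem /= ->.
  transitivity ((M ^+ k)%:E * P (F k))%E; first exact: integral_cst.
  rewrite /F (pp_poisson ppN)// leb_Rd_torus /= mulr1.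
  by rewrite /poisson_prob lam0 esum_set1 ?lee_fin ?poisson_pmf_ge0.
by rewrite sum_poisson_pmf// ltry.
Qed.

End poisson_moments.

(** * Tuples with repeated points *)

Section null_sets.
Context {R : realType} (d : nat).
Hypothesis d0 : (0 < d)%N.
Local Notation pt := pt[R]_d.

Lemma measurable_pt_set1 (x : pt) : measurable [set x].
Proof.
rewrite (_ : [set x] = [set y | forall i, [set tnth x i] (tnth y i)]).
  by apply: (@measurable_tnth_set _ _ d (fun i => [set tnth x i])) => i; exact: measurable_set1.
by apply/seteqP; split=> [y -> //|y xy]; apply: eq_from_tnth => i; rewrite xy.
Qed.

Lemma leb_Rd_set1 (x : pt) : leb_Rd d [set x] = 0%E.
Proof.
have -> : [set x] = [set y | forall i, [set tnth x i] (tnth y i)].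
  by apply/seteqP; split=> [y -> //|y xy]; apply: eq_from_tnth => i; rewrite xy.
rewrite /leb_Rd (@tuple_measure_box _ _ R lebesgue_measure d (fun i => [set tnth x i])); last first.
  by move=> i; exact: measurable_set1.
rewrite (bigD1 (Ordinal d0))//=.
by rewrite [X in (X * _)%E](_ : _ = 0%E) ?mul0e//; exact: lebesgue_measure_set1.
Qed.

Lemma seq_set_cons (x : pt) s : [set` x :: s] = [set x] `|` [set` s].
Proof.
apply/seteqP; split=> y /=; rewrite inE.
  by move=> /orP[/eqP ->|ys]; [left|right].
by move=> [->|ys]; rewrite ?eqxx// ys orbT.
Qed.

Lemma measurable_seq_set (s : seq pt) : measurable [set` s].
Proof.
elim: s => [|x s IH]; first by rewrite (_ : [set` [::]] = set0)// -subset0 => x.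
rewrite seq_set_cons; apply: measurableU => //; exact: measurable_pt_set1.
Qed.

Lemma leb_Rd_seq_set (s : seq pt) : leb_Rd d [set` s] = 0%E.
Proof.
elim: s => [|x s IH].
  by rewrite (_ : [set` [::]] = set0) ?measure0// -subset0 => x.
rewrite seq_set_cons; apply/eqP; rewrite -measure_le0.
have : (leb_Rd d ([set x] `|` [set` s]) <= leb_Rd d [set x] + leb_Rd d [set` s])%E.
  by apply: measureU2; [exact: measurable_pt_set1|exact: measurable_seq_set].
by rewrite leb_Rd_set1 IH adde0.
Qed.

Lemma measurable_tnth_eq m (i j : 'I_m) :
  measurable [set x : m.-tuple pt | tnth x i = tnth x j].
Proof.
apply: measurable_pclosed => x /= xij.
have /existsNP[l xl] : ~ forall l, tnth (tnth x i) l = tnth (tnth x j) l.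
  by move=> H; apply: xij; exact: eq_from_tnth.
pose a : R := tnth (tnth x i) l; pose b : R := tnth (tnth x j) l.
have ab : 0 < `|a - b| by rewrite normr_gt0 subr_eq0; exact/eqP.
exists (`|a - b| / 3); first by rewrite divr_gt0.
move=> y xy yij; have := xy i l; have := xy j l; rewrite -yij -/a -/b.
set c : R := tnth _ l => h1 h2.
have := ler_normD (a - c) (c - b); rewrite addrA subrK (distrC c b).
move: h1 h2 ab; clear; move: `|a - c| `|b - c| `|a - b| => p1 p2 p3; lra.
Qed.

Lemma measurable_nonuniq m : measurable [set x : m.-tuple pt | ~~ uniq x].
Proof.
rewrite (_ : [set _ | _] = \bigcup_(ij in [set ij : 'I_m * 'I_m | ij.1 != ij.2])
    [set x | tnth x ij.1 = tnth x ij.2]).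
  by apply: fin_bigcup_measurable => // ij _; exact: measurable_tnth_eq.
apply/seteqP; split=> [x /= /tuple_uniqP xu|x [[i j] /= ij xij]]; last first.
  by apply/tuple_uniqP => xu; move/eqP: ij; apply; exact: xu.
apply: contrapT => H; apply: xu => i j xij; apply/eqP/negPn/negP => ij.
by apply: H; exists (i, j).
Qed.

(** By induction: off the null set of tails with a repetition, the first point is confined to the
    finite, hence null, set of entries of the tail. *)
Lemma leb_pow_nonuniq m : leb_pow d m [set x : m.-tuple pt | ~~ uniq x] = 0%E.
Proof.
elim: m => [|m IH].
  rewrite (_ : [set _ | _] = set0) ?measure0// -subset0 => x /=.
  by rewrite tuple0.
rewrite /leb_pow tuple_measureS2; last exact: measurable_nonuniq.
pose D := [set x : m.-tuple pt | ~~ uniq x].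
have mD : measurable D by exact: measurable_nonuniq.
rewrite (@ge0_negligible_integral _ _ _ (tuple_measure (leb_Rd d) m) setT D)//.
- rewrite integral0_eq// => t [_ /= /negP]; rewrite negbK => ut.
  rewrite (_ : [set x | _] = [set` tval t]) ?leb_Rd_seq_set//.
  by apply/seteqP; split=> x /=; rewrite ut andbT negbK.
- exact: (measurable_fun_point_measure (leb_Rd d) (@measurable_nonuniq m.+1)).
Qed.

End null_sets.

(** * Mecke formula for isolated tuples *)

Section mecke.
Context {R : realType} (d : nat) {disp : measure_display}
  {Omega : measurableType disp}.
Hypothesis d0 : (0 < d)%N.
Local Notation pt := pt[R]_d.
Variables (P : probability Omega R) (lam : R) (N : Omega -> {fset pt}).
Hypotheses (ppN : is_poisson_process P lam N) (lam0 : 0 < lam).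
Variables (m : nat) (h : set (m.-tuple pt)) (g : set (m.+1.-tuple pt)).
Hypotheses (ch : pclosed h) (cg : pclosed g).
Local Notation mu := (leb_Rd d).
Local Notation torus := (@torus R d).

Definition g_nbhd (x : m.-tuple pt) : set pt :=
  [set z | torus z /\ g (cons_tuple z x)].

(** The integrand of the Mecke formula: the intensity lam^m of m-tuples times the probability that
    the process has no point in [g_nbhd x]. *)
Definition isolation_density (x : m.-tuple pt) : R :=
  `[< (forall j, torus (tnth x j)) /\ h x >]%:R *
  (lam ^+ m * expR (- (lam * vol (g_nbhd x)))).

Definition cell_density n (i : m.-tuple (d.-tuple 'I_n.+2)) : R :=
  (uniq i && `[< cellwise n h i >])%:R *
  (lam ^+ m * expR (- (lam * vol (cell_nbhd g i)))).

Definition cell_box n (i : m.-tuple (d.-tuple 'I_n.+2)) : set (m.-tuple pt) :=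
  [set x | forall j, cell (tnth i j) (tnth x j)].

Lemma measurable_cell_box n i : measurable (@cell_box n i).
Proof.
apply: (@measurable_tnth_set _ _ m (fun j => cell (tnth i j))) => j.
exact: measurable_cell.
Qed.

Lemma cell_boxP n i x : (forall j, torus (tnth x j)) ->
  @cell_box n i x <-> map_tuple (cell_index n) x = i.
Proof.
move=> tx; split=> [H|<- j].
  by apply: eq_from_tnth => j; rewrite tnth_map; case: (H j).
by rewrite tnth_map; split.
Qed.

(** A step function, constant on products of cells, whose integral is exactly the expected number of
    isolated cell tuples. *)
Definition cell_sum n (x : m.-tuple pt) : R :=
  \sum_i @cell_density n i * \1_(cell_box i) x.

Lemma density_bounds (b : bool) (B : set pt) :
  0 <= b%:R * (lam ^+ m * expR (- (lam * vol B))) <= lam ^+ m.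
Proof.
have lm : 0 <= lam ^+ m by rewrite exprn_ge0 ?ltW.
have e1 : expR (- (lam * vol B)) <= 1.
  by rewrite -expR0 ler_expR oppr_le0 mulr_ge0 ?vol_ge0 ?ltW.
case: b; rewrite ?mul0r ?lexx ?mul1r// mulr_ge0 ?expR_ge0//=.
exact: ler_piMr.
Qed.

Lemma cell_density_ge0 n i : 0 <= @cell_density n i.
Proof. by have /andP[] := density_bounds (uniq i && `[< cellwise n h i >]) (cell_nbhd g i). Qed.

Lemma cell_sumE n x : (forall j, torus (tnth x j)) ->
  cell_sum n x = cell_density (map_tuple (cell_index n) x).
Proof.
move=> tx; rewrite /cell_sum (bigD1 (map_tuple (cell_index n) x))//=.
rewrite indicE mem_set ?mulr1; last exact/cell_boxP.
rewrite big1 ?addr0// => i ix; rewrite indicE memNset ?mulr0//.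
by move=> /cell_boxP => /(_ tx) e; rewrite e eqxx in ix.
Qed.

Lemma cell_sum_out n x : ~ (forall j, torus (tnth x j)) -> cell_sum n x = 0.
Proof.
move=> tx; rewrite /cell_sum big1// => i _; rewrite indicE memNset ?mulr0//.
by move=> H; apply: tx => j; case: (H j).
Qed.

Lemma integral_cell_sum n : (\int[leb_pow d m]_x (cell_sum n x)%:E =
  \sum_(i : m.-tuple (d.-tuple 'I_n.+2)) (cell_density i *
     \prod_(j < m) vol (cell (tnth i j) : set pt))%:E)%E.
Proof.
rewrite /cell_sum.
under eq_integral do rewrite -sumEFin.
rewrite ge0_integral_sum//; last 2 first.
- move=> i; apply/measurable_EFinP; apply: measurable_funM => //.
  by apply: measurable_indic; exact: measurable_cell_box.
- by move=> i x _; rewrite lee_fin mulr_ge0// cell_density_ge0.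
apply: eq_bigr => i _.
under eq_integral do rewrite EFinM.
rewrite ge0_integralZl//; last 2 first.
- by apply/measurable_EFinP; apply: measurable_indic; exact: measurable_cell_box.
- by rewrite lee_fin cell_density_ge0.
rewrite integral_indic//; last exact: measurable_cell_box.
rewrite setIT [RHS]EFinM; congr (_ * _)%E.
transitivity (\prod_(j < m) mu (cell (tnth i j) : set pt))%E.
  apply: (@tuple_measure_box _ _ R mu m (fun j => cell (tnth i j))) => j.
  exact: measurable_cell.
rewrite -prodEFin; apply: eq_bigr => j _; apply: volE.
  exact: measurable_cell.
exact: cell_torus.
Qed.

Lemma count_cellsE n w : #|isolated_cells h g n (N w)|%:R =
  \sum_(i : m.-tuple (d.-tuple 'I_n.+2))
    (uniq i && `[< cellwise n h i >])%:R * \1_(isolated_event N g i) w :> R.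
Proof.
rewrite -sum1_card natr_sum big_mkcond; apply: eq_bigr => i _.
rewrite inE andbA; case: (uniq i && _); rewrite ?mul0r//= mul1r indicE.
rewrite (_ : (w \in _) = [forall j, count_in (N w) (cell (tnth i j)) == 1%N] &&
  (count_in (N w) (cell_neighbours g i) == 0%N)); first by case: ifP.
apply/idP/andP => [/set_mem[H1 H2]|[/forallP H1 /eqP H2]].
  by split; [apply/forallP => j; apply/eqP; exact: H1|apply/eqP].
by apply/mem_set; split=> // j; apply/eqP; exact: H1.
Qed.

Lemma expected_isolated_cells n :
  (\int[P]_w (#|isolated_cells h g n (N w)|%:R)%:E =
   \int[leb_pow d m]_x (cell_sum n x)%:E)%E.
Proof.
rewrite integral_cell_sum.
pose c (i : m.-tuple (d.-tuple 'I_n.+2)) : R := (uniq i && `[< cellwise n h i >])%:R.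
under eq_integral do rewrite count_cellsE -sumEFin.
have c0 i : 0 <= c i by rewrite /c.
rewrite ge0_integral_sum//; last first.
- move=> i; apply/measurable_EFinP; apply: measurable_funM => //.
  by apply: measurable_indic; exact: (measurable_isolated_event ppN).
apply: eq_bigr => i _.
under eq_integral do rewrite EFinM.
rewrite ge0_integralZl//; last first.
  by apply/measurable_EFinP; apply: measurable_indic; exact: (measurable_isolated_event ppN).
rewrite integral_indic//; last exact: (measurable_isolated_event ppN).
rewrite setIT; transitivity ((c i)%:E * P (isolated_event N g i))%E; first by [].
rewrite /cell_density -/(c i) /c.
have [ui|] := boolP (uniq i); last by rewrite !mul0r mul0e.
rewrite (prob_isolated_event ppN (ltW lam0) g ui) -EFinM; congr (_%:E).
by ring.
Qed.

Lemma measurable_count_cells n :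
  measurable_fun setT (fun w => (#|isolated_cells h g n (N w)|%:R : R)%:E).
Proof.
apply/measurable_EFinP; rewrite (_ : (fun w => _) =
    fun w => \sum_(i : m.-tuple (d.-tuple 'I_n.+2))
      (uniq i && `[< cellwise n h i >])%:R * \1_(isolated_event N g i) w).
  apply: measurable_sum => i; apply: measurable_funM => //.
  by apply: measurable_indic; exact: (measurable_isolated_event ppN).
by apply/funext => w; exact: count_cellsE.
Qed.

Lemma measurable_g_nbhd x : measurable (g_nbhd x).
Proof.
apply: measurableI; first exact: measurable_torus.
exact: (measurable_preimageT (measurable_cons_point x) (measurable_pclosed cg)).
Qed.

(** Indicators converge at every z other than the entries of x: on fine grids z lies in none of
    their cells, and closedness of [g] decides the rest. The entries form a null set. *)
Lemma vol_cell_nbhd_cvg x : (forall j, torus (tnth x j)) ->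
  vol (cell_nbhd g (map_tuple (cell_index n) x)) @[n --> \oo] --> vol (g_nbhd x).
Proof.
move=> tx; have mT := @measurable_torus R d.
have mN n := measurable_cell_nbhd g (map_tuple (cell_index n) x).
have mG := measurable_g_nbhd x.
have [//|||||_ _ cv] := @dominated_convergence _ _ _ mu torus mT
  (fun n z => (\1_(cell_nbhd g (map_tuple (cell_index n) x)) z)%:E)
  (fun z => (\1_(g_nbhd x) z)%:E) (cst 1%E).
- by move=> n; apply/measurable_EFinP; exact: measurable_indic.
- by apply/measurable_EFinP; exact: measurable_indic.
- exists [set` tval x]; split.
  + exact: measurable_seq_set.
  + exact: leb_Rd_seq_set.
  move=> z /= /not_implyP[tz zcv]; apply: contrapT => zx; apply: zcv.
  have zxj j : \forall n \near \oo, cell_index n z <> cell_index n (tnth x j).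
    apply: cell_index_near => // zj; apply: zx; rewrite zj; exact: mem_tnth.
  have tc j : torus (tnth (cons_tuple z x) j).
    by case: (unliftP ord0 j) => [i ->|->]; rewrite ?tnthS ?tnth0.
  have gn := cellwise_near cg tc.
  have zn : \forall n \near \oo, forall j, cell_index n z <> cell_index n (tnth x j).
    exact: filter_forall.
  apply: cvg_near_cst; near=> n.
  congr (_%:E); rewrite !indicE; congr (_%:R); congr nat_of_bool.
  have gnn : cellwise n g (map_tuple (cell_index n) (cons_tuple z x)) <-> g (cons_tuple z x).
    by near: n.
  have e : map_tuple (cell_index n) (cons_tuple z x) =
    cons_tuple (cell_index n z) (map_tuple (cell_index n) x) by exact: val_inj.
  rewrite e in gnn.
  have znn : forall j, cell_index n z <> cell_index n (tnth x j) by near: n.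
  apply/idP/idP => /set_mem; rewrite /cell_nbhd /g_nbhd /=.
    move=> [_ [zc|/gnn gz]]; last by rewrite inE.
    by move: zc => /tnthP[j]; rewrite tnth_map => /znn.
  by move=> [_ /gnn gz]; rewrite inE; split=> //; right.
- apply/integrableP; split=> //.
  rewrite (eq_integral (cst 1%E)); last by move=> z _; rewrite /= normr1.
  by rewrite integral_cst// mul1e [X in (X < _)%E]leb_Rd_torus ltry.
- apply: aeW => z n _ /=.
  by rewrite indicE; case: (_ \in _); rewrite ?normr1 ?normr0 lee_fin.
have volT (B : set pt) : measurable B -> B `<=` torus ->
    (\int[mu]_(z in torus) (\1_B z)%:E = (vol B)%:E)%E.
  by move=> mB BT; rewrite integral_indic// setIidl//; exact: volE.
suff : (vol (cell_nbhd g (map_tuple (cell_index n) x)))%:E @[n --> \oo] -->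
    (vol (g_nbhd x))%:E by move=> /fine_cvgP[].
rewrite -volT//; last by move=> z [].
apply: cvg_trans cv; apply: near_eq_cvg; apply: nearW => n /=.
by rewrite volT// => z [].
Unshelve. all: by end_near. Qed.

(** Distinct entries are required, because [cell_density] vanishes as soon as two of them share a
    cell. *)
Lemma cell_sum_cvg (x : m.-tuple pt) : uniq x -> cell_sum n x @[n --> \oo] --> isolation_density x.
Proof.
move=> ux; have [tx|tx] := pselect (forall j, torus (tnth x j)); last first.
  rewrite /isolation_density (_ : `[< _ >] = false); last by apply/asboolPn => -[].
  by rewrite mul0r; apply: cvg_near_cst; apply: nearW => n; rewrite cell_sum_out.
have hn := cellwise_near ch tx.
have un : \forall n \near \oo, uniq (map_tuple (cell_index n) x).
  have : \forall n \near \oo, forall ij : 'I_m * 'I_m, ij.1 != ij.2 ->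
      cell_index n (tnth x ij.1) <> cell_index n (tnth x ij.2).
    apply: filter_forall => -[i j] /=; have [->|ij] := eqVneq i j.
      by apply: nearW.
    have xij : tnth x i <> tnth x j.
      by move=> xij; move/eqP: ij; apply; exact: (tuple_uniqP _ ux).
    by have := cell_index_near (tx i) (tx j) xij; apply: filterS.
  apply: filterS => n H; apply/tuple_uniqP => i j; rewrite !tnth_map => cij.
  by apply/eqP/negPn/negP => ij; exact: (H (i, j) ij).
rewrite (_ : (fun n => _) = fun n => cell_density (map_tuple (cell_index n) x)); last first.
  by apply/funext => n; rewrite cell_sumE.
rewrite /isolation_density /cell_density.
apply: cvgM.
  apply: cvg_near_cst; near=> n; congr (nat_of_bool _)%:R.
  have -> /= : uniq (map_tuple (cell_index n) x) by near: n.
  have H : cellwise n h (map_tuple (cell_index n) x) <-> h x by near: n.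
  apply/idP/idP => /asboolP Hx; apply/asboolP; first by split=> //; apply/H.
  by apply/H; exact: Hx.2.
apply: cvgMl_tmp; apply: continuous_cvg; first exact: continuous_expR.
by apply: cvgN; apply: cvgMl_tmp; exact: vol_cell_nbhd_cvg.
Unshelve. all: by end_near. Qed.

Lemma measurable_isolation_density : measurable_fun setT isolation_density.
Proof.
apply: measurable_funM.
  rewrite (_ : (fun x => _) = \1_[set x : m.-tuple pt | (forall j, torus (tnth x j)) /\ h x]).
    apply: measurable_indic; apply: measurableI; last exact: measurable_pclosed.
    apply: (@measurable_tnth_set _ _ m (fun=> torus)) => _; exact: measurable_torus.
  apply/funext => x; by rewrite indicE.
apply: measurable_funM => //; apply: measurableT_comp => //.
apply: measurableT_comp => //; apply: measurable_funM => //.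
rewrite (_ : (fun x => _) = fine \o (fun x : m.-tuple pt =>
    mu [set z | (@thead _ _ @^-1` torus `&` g) (cons_pair (z, x))])).
  apply: measurableT_comp => //.
  apply: (measurable_fun_point_measure mu); apply: measurableI; last exact: measurable_pclosed.
  apply: measurable_preimageT; last exact: measurable_torus.
  exact: (@measurable_tnth _ _ _ ord0).
by apply/funext => x.
Qed.

(** With a points there are at most a^m tuples, and a <= 2^a. The exponential form makes the bound
    integrable through the generating function. *)
Lemma count_cells_le n w :
  (#|isolated_cells h g n (N w)|%:R : R) <= (2 ^+ m) ^+ npoints N torus w.
Proof.
have tw := pp_support ppN.
have -> : npoints N torus w = #|{: N w}|.
  rewrite /npoints -cardfE; congr (#|` _ |); apply/fsetP => x; rewrite !inE/=.
  by case: (boolP (x \in N w)) => //= xN; apply/asboolP/(tw w).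
rewrite -exprM mulnC exprM -!natrX ler_nat.
apply: leq_trans (subset_leq_card (isolated_cells_sub h g n (N w))) _.
apply: leq_trans (leq_imset_card _ _) _.
have leqX (a b e : nat) : (a <= b)%N -> (a ^ e <= b ^ e)%N.
  by move=> ab; case: e => // e; rewrite leq_exp2r.
by rewrite cardsT card_tuple leqX// ltnW// ltn_expl.
Qed.

Lemma count_cells_cvg w : (#|isolated_cells h g n (N w)|%:R : R)%:E @[n --> \oo] -->
  (#|isolated_tuples h g (N w)|%:R : R)%:E.
Proof.
apply: cvg_near_cst.
have := card_isolated_cells_near ch cg (pp_support ppN (w := w)).
by apply: filterS => n ->.
Qed.

(** A pointwise limit of functions of finitely many cell counts, the only quantities whose
    measurability is given. *)
Lemma measurable_count_tuples :
  measurable_fun setT (fun w => (#|isolated_tuples h g (N w)|%:R : R)%:E).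
Proof.
apply: (emeasurable_fun_cvg _ _ measurable_count_cells) => w _.
exact: count_cells_cvg.
Qed.

(* The cell counts are dominated by [(2 ^ m) ^ N(torus)], which is integrable, and
   the cell densities by [lam ^ m] on the cube, so both sides pass to the limit. *)
Lemma mecke_formula : (\int[P]_w (#|isolated_tuples h g (N w)|%:R)%:E =
  \int[leb_pow d m]_x (isolation_density x)%:E)%E.
Proof.
have M0 : 0 < (2 : R) ^+ m by rewrite exprn_gt0.
have cvL : (\int[P]_w (#|isolated_cells h g n (N w)|%:R : R)%:E @[n --> \oo] -->
    \int[P]_w (#|isolated_tuples h g (N w)|%:R : R)%:E)%E.
  apply: (dominated_cvg measurableT measurable_count_cells _ _
    (integrable_exp_npoints ppN lam0 M0)) => //.
    by move=> w _; exact: count_cells_cvg.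
  by move=> n w _; rewrite /= ger0_norm// lee_fin count_cells_le.
pose U := [set x : m.-tuple pt | forall j, torus (tnth x j)].
have mU : measurable U.
  by apply: (@measurable_tnth_set _ _ m (fun=> torus)) => _; exact: measurable_torus.
have mcs n : measurable_fun setT (fun x => (cell_sum n x)%:E).
  apply/measurable_EFinP; apply: measurable_sum => i.
  by apply: measurable_funM => //; apply: measurable_indic; exact: measurable_cell_box.
have [//|||||_ _ cvR] := @dominated_convergence _ _ _ (leb_pow d m) setT measurableT
  (fun n x => (cell_sum n x)%:E) (fun x => (isolation_density x)%:E)
  (fun x => (lam ^+ m * \1_U x)%:E).
- by apply/measurable_EFinP; exact: measurable_isolation_density.
- exists [set x : m.-tuple pt | ~~ uniq x]; split.
  + exact: measurable_nonuniq.
  + exact: leb_pow_nonuniq.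
  move=> x /= /not_implyP[_ xcv]; apply/negP => ux; apply: xcv.
  apply: cvg_EFin; first exact: nearW.
  exact: cell_sum_cvg.
- apply/integrableP; split.
    by apply/measurable_EFinP; apply: measurable_funM => //; exact: measurable_indic.
  rewrite (eq_integral (fun x => (lam ^+ m)%:E * (\1_U x)%:E)%E); last first.
    by move=> x _; rewrite /= ger0_norm ?EFinM// mulr_ge0// exprn_ge0// ltW.
  rewrite ge0_integralZl//; last first.
  + by rewrite lee_fin exprn_ge0 ?ltW.
  + by apply/measurable_EFinP; exact: measurable_indic.
  rewrite integral_indic// setIT lte_mul_pinfty ?lee_fin ?exprn_ge0 ?ltW//.
  rewrite [X in (X < _)%E](_ : _ = 1%E) ?ltry//.
  transitivity (\prod_(i < m) mu torus)%E.
    by apply: (@tuple_measure_box _ _ R mu m (fun=> torus)) => _; exact: measurable_torus.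
  by rewrite big1// => i _; exact: leb_Rd_torus.
- apply: aeW => x n _ /=; have [tx|tx] := pselect (forall j, torus (tnth x j)).
    rewrite cell_sumE// indicE mem_set// mulr1 lee_fin ger0_norm ?cell_density_ge0//.
    by have /andP[] := density_bounds (uniq (map_tuple (cell_index n) x) &&
      `[< cellwise n h (map_tuple (cell_index n) x) >]) (cell_nbhd g (map_tuple (cell_index n) x)).
  by rewrite cell_sum_out// normr0 lee_fin mulr_ge0// exprn_ge0// ltW.
rewrite -(cvg_lim _ cvL)//; apply: cvg_lim => //; apply: cvg_trans cvR.
apply: near_eq_cvg; apply: nearW => n /=.
by rewrite -expected_isolated_cells.
Qed.

End mecke.

(** * Isolated faces as isolated tuples *)

Section orderings.
Variables (K : choiceType) (X : {fset K}) (m : nat) (Q : {fset K} -> bool).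
Implicit Types (t : m.-tuple X) (S : {set X}).

Let vals S : {fset K} := [fsetval y in S]%fset.

Let mem_vals S (x : X) : (val x \in vals S) = (x \in S).
Proof.
apply/imfsetP/idP => [[y /= yS /val_inj ->//]|xS].
by exists x.
Qed.

Let vals_inj : injective vals.
Proof. by move=> S1 S2 e; apply/setP => x; rewrite -!mem_vals e. Qed.

Let card_vals S : #|` vals S| = #|S|.
Proof. by rewrite card_imfset ?cardE//; exact: val_inj. Qed.

Lemma card_orderings (A : {set m.-tuple X}) :
  (forall t, (t \in A) = uniq t && Q [fset x in map val t]%fset) ->
  #|A| = (#|` [fset s in fpowerset X | Q s && (#|` s| == m)]%fset| * m`!)%N.
Proof.
move=> AE; pose F : {set {set X}} := [set S : {set X} | Q (vals S) && (#|S| == m)]%SET.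
have tvals t : vals [set x in t]%SET = [fset x in map val t]%fset.
  apply/fsetP => y; rewrite !inE/=; apply/imfsetP/mapP => -[x /= xt ->].
    by exists x => //; rewrite inE in xt.
  by exists x => //=; rewrite inE.
have -> : #|` [fset s in fpowerset X | Q s && (#|` s| == m)]%fset| = #|F|.
  rewrite (_ : [fset s in _ | _]%fset = [fset vals S | S in F]%fset).
    by rewrite card_imfset ?cardE//; exact: vals_inj.
  apply/fsetP => s; rewrite !inE/= fpowersetE; apply/andP/imfsetP => [[sX /andP[Qs sm]]|[S /=]].
    pose S := [set x : X | val x \in s]%SET.
    have sS : s = vals S.
      apply/fsetP => x; apply/idP/imfsetP => [xs|[y /= + ->]]; last by rewrite inE.
      by exists [` fsubsetP sX _ xs]%fset => //=; rewrite inE.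
    by exists S => //=; rewrite inE -sS Qs -card_vals -sS.
  rewrite inE => /andP[QS Sm] ->; rewrite QS card_vals Sm; split=> //.
  by apply/fsubsetP => x /imfsetP[y /= _ ->]; exact: valP.
rewrite -sum1_card (partition_big (fun t => [set x in t]%SET) (mem F)) /=; last first.
  move=> t; rewrite AE inE tvals => /andP[ut ->] /=.
  by rewrite cardsE; have /card_uniqP -> := ut; rewrite size_tuple.
rewrite -sum_nat_const; apply: eq_bigr => S; rewrite inE => /andP[QS /eqP Sm].
rewrite sum1_card.
have := card_uniq_tuples m (mem S); rewrite Sm ffactnn => <-.
apply: eq_card => t; rewrite -[LHS]/((t \in A) && ([set x in t]%SET == S)) inE AE.
apply/idP/idP => [/andP[/andP[ut _] /eqP tS]|/andP[/allP tS ut]].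
  by rewrite ut andbT; apply/allP => x xt; rewrite -[mem S x]/(x \in S) -tS inE.
have tSE : [set x in t]%SET = S.
  apply/eqP; rewrite eqEcard cardsE; have /card_uniqP -> := ut.
  by rewrite size_tuple Sm leqnn andbT; apply/fintype.subsetP => x; rewrite inE; exact: tS.
by rewrite tSE eqxx andbT ut /= -tvals tSE.
Qed.

End orderings.

(** * Isolation expressed through one extra vertex *)

Section isolated_nodes.
Context {R : realType} (d : nat).
Local Notation pt := pt[R]_d.
Variables (p : complex_type) (q : connectivity) (r : R).
Hypothesis r0 : 0 <= r.
Implicit Types (X s t : {fset pt}).
Local Notation nerve_r := (nerve p (fun x : pt => tball x r)).

Lemma tball_self (x : pt) : torus x -> tball x r x.
Proof. by move=> tx; split => //=; rewrite tdistxx. Qed.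

Lemma face_nerve X k s : (forall x, x \in X -> torus x) ->
  face p X r k s <-> [/\ (s `<=` X)%fset, #|` s| = k.+1 & nerve_r s].
Proof.
move=> XT; rewrite /face; case: p; split=> -[sX sk H]; split=> //.
- move=> x y xs ys; have [->|xy] := eqVneq x y.
    have Ty : torus y by apply: XT; exact: (fsubsetP sX).
    by exists y; split; exact: tball_self.
  by have [w [w1 w2]] := H x y xs ys xy; exists w.
- by move=> x y xs ys xy; have [w [w1 w2]] := H x y xs ys; exists w.
Qed.

Definition adjacent s y : Prop :=
  match q with
  | Up => nerve_r (y |` s)%fset
  | Down => exists2 x, x \in s & nerve_r (y |` (s `\ x))%fset
  end.

(** A face t adjacent to s has a vertex y outside s. In the Up case the union of s and t is s with y
    added; in the Down case t is s with some x replaced by y. Conversely, s with x replaced by y is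
    an adjacent face, where in the Up case x may be any vertex of s. *)
Lemma isolated_nodeP X k s : (1 <= k)%N -> (forall x, x \in X -> torus x) ->
  isolated_node p q X r k s <-> [/\ (s `<=` X)%fset, #|` s| = k.+1, nerve_r s &
    forall y, y \in X -> y \notin s -> ~ adjacent s y].
Proof.
move=> k1 XT; rewrite /isolated_node face_nerve//.
have swap x y : (s `<=` X)%fset -> #|` s| = k.+1 -> x \in s -> y \in X -> y \notin s ->
    [/\ (y |` (s `\ x) `<=` X)%fset, #|` (y |` (s `\ x))%fset| = k.+1 &
       s != (y |` (s `\ x))%fset].
  move=> sX sk xs yX ys; split.
  - rewrite fsubUset fsub1set yX /=; apply: fsubset_trans sX; exact: fsubD1set.
  - rewrite cardfsU1 !inE (negPf ys) andbF /= add1n.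
    by move: sk; rewrite (cardfsD1 x) xs add1n => -[->].
  - by apply/eqP => e; move: ys; rewrite e !inE eqxx.
split=> [[[sX sk sn] H]|[sX sk sn H]].
  split=> // y yX ys; rewrite /adjacent; case: q H => H.
    move=> yn; have /fset0Pn[x xs] : s != fset0 by rewrite -cardfs_gt0 sk.
    have [tX tk st] := swap x y sX sk xs yX ys.
    apply: (H (y |` (s `\ x))%fset).
      apply/face_nerve => //; split=> //; apply: nerve_sub yn => z.
      by rewrite !inE => /orP[->//|/andP[_ ->]]; rewrite orbT.
    split=> //; have -> : (s `|` (y |` (s `\ x)) = y |` s)%fset.
      apply/fsetP => z; rewrite !inE; case: (z \in s); rewrite ?orbT ?andbF ?orbF//.
    apply/face_nerve => //; split=> //.
      by rewrite fsubUset fsub1set yX.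
    by rewrite cardfsU1 ys sk.
  move=> [x xs yn]; have [tX tk st] := swap x y sX sk xs yX ys.
  apply: (H (y |` (s `\ x))%fset); first exact/face_nerve.
  split=> //; have -> : (s `&` (y |` (s `\ x)) = s `\ x)%fset.
    apply/fsetP => z; rewrite !inE; have [->|zy] := eqVneq z y => /=.
      by rewrite (negPf ys) andbF.
    by case: (z \in s); rewrite ?andbF.
  apply/face_nerve => //; split.
  - by apply: fsubset_trans sX; exact: fsubD1set.
  - by rewrite prednK//; move: sk; rewrite (cardfsD1 x) xs add1n => -[].
  - by apply: nerve_sub sn => z; rewrite !inE => /andP[].
split=> // t /face_nerve => /(_ XT)[tX tk tn] [st E].
have /fsubsetPn[y yt ys] : ~~ (t `<=` s)%fset.
  apply/negP => ts; move: st; rewrite eq_sym eqEfcard ts sk tk leqnn//.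
have yX : y \in X by exact: (fsubsetP tX).
apply: (H y yX ys); rewrite /adjacent; case: q E => /face_nerve => /(_ XT)[sX' sk' sn'].
  apply: nerve_sub sn' => z; rewrite !inE => /orP[/eqP ->|->//].
  by rewrite yt orbT.
have /fsubsetPn[x xs xt] : ~~ (s `<=` t)%fset.
  by apply/negP => ts; move: st; rewrite eqEfcard ts sk tk leqnn.
exists x => //; apply: nerve_sub tn => z; rewrite !inE => /orP[/eqP ->//|].
have -> : (z != x) && (z \in s) = (z \in s `\ x)%fset by rewrite !inE.
have -> : (s `\ x = s `&` t)%fset.
  apply/esym/eqP; rewrite eqEfcard; apply/andP; split.
    apply/fsubsetP => u; rewrite !inE => /andP[us ut]; rewrite us andbT.
    by apply: contra xt => /eqP <-.
  by rewrite sk' prednK//; move: sk; rewrite (cardfsD1 x) xs add1n => -[->].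
by rewrite !inE => /andP[].
Qed.

(** Positions in (y, x_0, ..., x_k) whose points must span a simplex: all of them for Up, all but
    x_i for Down. Since y comes first, x_i sits at [lift ord0 i]. *)
Definition nbr_index k (i : 'I_k.+1) : seq 'I_k.+2 :=
  match q with
  | Up => enum 'I_k.+2
  | Down => [seq j <- enum 'I_k.+2 | j != lift ord0 i]
  end.

(* The first entry of the tuple is the additional point, the others form the
   k-face. *)
Definition nbr_tuples (B : pt -> set pt) k : set (k.+2.-tuple pt) :=
  [set t | exists i : 'I_k.+1, nerve p B [seq tnth t j | j <- nbr_index i]].

Lemma mem_nbr_index_up k (y : pt) (t : k.+1.-tuple pt) :
  [seq tnth (cons_tuple y t) j | j <- enum 'I_k.+2] =i y :: t.
Proof. by move=> z; rewrite map_tnth_enum. Qed.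

Lemma mem_nbr_index_down k (y : pt) (t : k.+1.-tuple pt) (i : 'I_k.+1) :
  [seq tnth (cons_tuple y t) j | j <- [seq j <- enum 'I_k.+2 | j != lift ord0 i]] =i
  y :: [seq tnth t j | j <- [seq j <- enum 'I_k.+1 | j != i]].
Proof.
move=> z; rewrite inE; apply/mapP/orP => [[j]|].
  rewrite mem_filter => /andP[ji _] ->.
  move: ji; case: (unliftP ord0 j) => [j' ->|->]; last by rewrite tnth0 eqxx; left.
  rewrite tnthS => ji; right; apply/mapP; exists j' => //.
  by rewrite mem_filter mem_enum andbT; apply: contra ji => /eqP ->.
move=> [/eqP ->|/mapP[j]].
  by exists ord0; rewrite ?tnth0// mem_filter mem_enum andbT.
rewrite mem_filter => /andP[ji _] ->; exists (lift ord0 j); last by rewrite tnthS.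
by rewrite mem_filter mem_enum andbT; apply: contra ji => /eqP/lift_inj ->.
Qed.

Lemma adjacent_nbr k s (t : k.+1.-tuple pt) y : uniq t -> s =i t ->
  adjacent s y <-> nbr_tuples (fun x : pt => tball x r) (cons_tuple y t).
Proof.
move=> ut st; rewrite /adjacent /nbr_tuples /nbr_index; case: q; split.
- move=> yn; exists ord0; apply: nerve_sub yn => z.
  by rewrite mem_nbr_index_up !inE st.
- move=> [_ yn]; apply: nerve_sub yn => z.
  by rewrite mem_nbr_index_up !inE st.
- move=> [x]; rewrite st => /tnthP[i ->] yn; exists i.
  apply: nerve_sub yn => z; rewrite mem_nbr_index_down !inE => /orP[->//|].
  move=> /mapP[j]; rewrite mem_filter => /andP[ji _] ->; rewrite st mem_tnth andbT.
  by apply/orP; right; apply: contra ji => /eqP/(tuple_uniqP _ ut) ->.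
- move=> [i yn]; exists (tnth t i); first by rewrite st mem_tnth.
  apply: nerve_sub yn => z; rewrite mem_nbr_index_down !inE => /orP[->//|].
  rewrite st => /andP[zi /tnthP[j zj]]; apply/orP; right; apply/mapP; exists j => //.
  by rewrite mem_filter mem_enum andbT; apply: contra zi => /eqP <-; rewrite zj.
Qed.

Lemma nb_isolated_tuples X k : (1 <= k)%N -> (forall x, x \in X -> torus x) ->
  (nb_isolated p q X r k * (k.+1)`! =
   #|isolated_tuples [set t : k.+1.-tuple pt | nerve_r t]
      (nbr_tuples (fun x : pt => tball x r) (k := k)) X|)%N.
Proof.
move=> k1 XT.
pose Q s := `[< nerve_r s /\ forall y, y \in X -> y \notin s -> ~ adjacent s y >].
rewrite (@card_orderings _ X k.+1 Q).
  congr (_ * _)%N; congr (#|` _|); apply/fsetP => s; rewrite !inE/= fpowersetE.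
  apply: andb_id2l => sX; apply/asboolP/andP.
    by move=> /isolated_nodeP => /(_ k1 XT)[_ sk sn H]; split; [exact/asboolP|exact/eqP].
  by move=> [/asboolP[sn H] /eqP sk]; apply/isolated_nodeP.
move=> t; rewrite inE; apply: andb_id2l => ut.
have uvt : uniq (map_tuple val t) by rewrite map_inj_uniq//; exact: val_inj.
have memt : [fset x in map val t]%fset =i map_tuple val t by move=> x; rewrite !inE.
apply/asboolP/asboolP => -[hn H]; split.
- by apply: nerve_sub hn => x; rewrite memt.
- move=> y yX; rewrite memt => yt /(adjacent_nbr _ uvt memt).
  exact: H.
- by apply: nerve_sub hn => x; rewrite memt.
- move=> y yX yt /(adjacent_nbr _ uvt memt).
  by apply: H => //; rewrite memt.
Qed.

End isolated_nodes.

(** * Euclidean simplices and the sets Q *)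

Section euclidean_nerve.
Context {R : realType} (d : nat).
Local Notation pt := pt[R]_d.
Implicit Types (x y z w : pt).

(** Witnesses for e <= 1 stay within r + 1 of one centre, hence in a fixed box, so the compactness
    argument applies in R^d too. *)
Lemma cech_eball_limit (I : eqType) (J : seq I) (x : I -> pt) (r : R) :
  (forall e, 0 < e -> exists w, forall j, j \in J -> eball (x j) (r + e) w) ->
  exists w, forall j, j \in J -> eball (x j) r w.
Proof.
have [[j0 j0J] H|J0 _] := pselect (exists j, j \in J); last first.
  by exists (origin d) => j jJ; case: J0; exists j.
pose M : R := \sum_i `|tnth (x j0) i| + (`|r| + 1).
have [|w _ hw] := @common_point_closed R d _ _ (@edist_lip R d) _ J x (- M) M r; last by exists w.
move=> e e0; have e1 : 0 < Num.min 1 e by rewrite lt_min ltr01.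
have [w hw] := H _ e1; exists w => [i|j jJ]; last first.
  by apply: le_trans (hw j jJ) _; rewrite lerD2l ge_min lexx orbT.
rewrite -ler_norml.
have h1 : `|tnth (x j0) i - tnth w i| <= r + 1.
  apply: le_trans (ler_abs_enorm (fun i => tnth (x j0) i - tnth w i) i) _.
  by apply: le_trans (hw _ j0J) _; rewrite lerD2l ge_min lexx.
have h3 : `|tnth (x j0) i| <= \sum_i `|tnth (x j0) i|.
  by rewrite (bigD1 i)//= lerDl sumr_ge0.
have h4 := ler_norm r; rewrite /M; move: h1 h3 h4; clear.
move: (tnth (x j0) i : R) (tnth w i : R) => a c.
move: (\sum_i _) => S h1 h3 h4.
have := ler_normB a (a - c); rewrite opprB addrC subrK => h6.
by move: h1 h3 h4 h6; move: `|a - c| `|c| `|a| `|r| => u1 u2 u3 u4; lra.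
Qed.

Lemma nerve_eball_pclosed p r m (J : seq 'I_m) :
  pclosed [set t | nerve p (fun x : pt => eball x r) [seq tnth t j | j <- J]].
Proof.
apply: nerve_pclosed => {}J x /= hx; apply: contrapT => He; apply: hx.
have [|w hw] := @cech_eball_limit _ J (tnth x) r; last first.
  by exists w => z /mapP[j jJ ->]; exact: hw.
move=> e e0; have C0 : 0 < d%:R * 2 + 1 :> R by rewrite ltr_wpDl// mulr_ge0.
pose e' := e / (d%:R * 2 + 1).
have e'0 : 0 < e' by rewrite divr_gt0.
have /existsNP[y /not_implyP[xy /contrapT [w hw]]] :
    ~ forall y : m.-tuple pt, (forall j, pclose e' (tnth x j) (tnth y j)) ->
      ~ (exists w, forall z, z \in [seq tnth y j | j <- J] -> eball z r w).
  by move=> H; apply: He; exists e'.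
exists w => j jJ; have /= yw := hw _ (map_f (tnth y) jJ).
have yx : pclose e' (tnth y j) (tnth x j) by move=> i; rewrite distrC; exact: xy.
have ww : pclose e' w w by move=> i; rewrite subrr normr0 ltW.
apply: le_trans (edist_lip yx ww) _; apply: lerD => //.
by rewrite mulrA ler_pdivrMr// mulrC ler_wpM2l ?ltW// ltrDl.
Qed.

Lemma eball_self x (r : R) : 0 <= r -> eball x r x.
Proof. by move=> r0; rewrite /eball /= -/(edist x x) edistxx. Qed.

(** Triangle inequality one way, midpoint the other. This is how the radius 2 in the Rips sets Q
    arises from pairs of unit balls. *)
Lemma eball_pair x y : (exists w, eball x 1 w /\ eball y 1 w) <-> eball x 2 y.
Proof.
split=> [[w [xw yw]]|xy].
  apply: le_trans (edist_triangle w x y) _; rewrite (edistC w y).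
  by rewrite (_ : 2 = 1 + 1)// lerD.
pose w : pt := [tuple (tnth x i + tnth y i) / 2 | i < d].
exists w; split; rewrite /eball /=.
  rewrite (@eq_enorm _ _ _ (fun i => 2^-1 * (tnth x i - tnth y i))).
    by rewrite enormZ ger0_norm// mulrC ler_pdivrMr// mul1r.
  by move=> i; rewrite tnth_mktuple; field.
rewrite (@eq_enorm _ _ _ (fun i => - 2^-1 * (tnth x i - tnth y i))).
  by rewrite enormZ normrN ger0_norm// mulrC ler_pdivrMr// mul1r.
by move=> i; rewrite tnth_mktuple; field.
Qed.

Lemma mink_eball (A : set pt) z :
  mink A (eball (origin d) 1) z <-> exists2 w, A w & eball z 1 w.
Proof.
split=> [[a Aa [b b1 <-]]|[w Aw zw]].
  exists a => //; move: b1; rewrite /eball /= => b1.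
  rewrite (@eq_enorm _ _ _ (fun i => tnth b i - tnth (origin d) i)) 1?enormB//.
  by move=> i; rewrite !tnth_mktuple subr0 addrAC subrr add0r.
exists w => //; exists [tuple tnth z i - tnth w i | i < d].
  rewrite /eball /= enormB.
  by rewrite (@eq_enorm _ _ _ (fun i => tnth z i - tnth w i))// => i; rewrite !tnth_mktuple subr0.
by apply: eq_from_tnth => i; rewrite !tnth_mktuple addrC subrK.
Qed.

Local Notation nerve1 p := (nerve p (fun x : pt => eball x 1)).

Lemma hprop_nerve k p (x : k.+1.-tuple pt) : hprop p x <-> nerve1 p x.
Proof.
case: p => /=; split=> H.
- by case: H => w Hw; exists w => z /tnthP[j ->]; exact: Hw.
- by case: H => w Hw; exists w => j _; apply: Hw; exact: mem_tnth.
- move=> _ _ /tnthP[i ->] /tnthP[j ->].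
  have [ij|ij|ij] := ltngtP i j.
  + by have [w [w1 w2]] := H i j ij; exists w.
  + by have [w [w1 w2]] := H j i ij; exists w.
  + have -> : i = j by exact: val_inj.
    by exists (tnth x j); split; exact: eball_self.
- move=> i j _; have [w [w1 w2]] := H _ _ (mem_tnth i x) (mem_tnth j x).
  by exists w.
Qed.

Lemma nerve1_cons p (s : seq pt) z : nerve1 p s ->
  nerve1 p (z :: s) <-> match p with
    | Cech => exists2 w, (forall x, x \in s -> eball x 1 w) & eball z 1 w
    | Rips => forall x, x \in s -> eball x 2 z
    end.
Proof.
case: p => /= sn; split.
- move=> [w H]; exists w; last by apply: H; rewrite mem_head.
  by move=> x xs; apply: H; rewrite inE xs orbT.
- move=> [w H zw]; exists w => x; rewrite inE => /orP[/eqP ->//|]; exact: H.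
- move=> H x xs; apply/eball_pair; apply: H; rewrite ?mem_head//.
  by rewrite inE xs orbT.
- move=> H x y; rewrite !inE => /orP[/eqP ->|xs] /orP[/eqP ->|ys].
  + by exists z; split; exact: eball_self.
  + by have /eball_pair[w [w1 w2]] := H y ys; exists w.
  + by have /eball_pair := H x xs.
  + exact: sn.
Qed.

(** For the Rips complex, Q tests only the pairs containing z; the remaining pairs are supplied by
    [hprop]. *)
Lemma Qset_nbr k p q (x : k.+1.-tuple pt) z : hprop p x ->
  Qset p q x z <-> nbr_tuples p q (fun x : pt => eball x 1) (cons_tuple z x).
Proof.
move=> /hprop_nerve hx; rewrite /nbr_tuples /nbr_index /=; case: q.
  have -> : (exists i : 'I_k.+1, nerve1 p [seq tnth (cons_tuple z x) j | j <- enum 'I_k.+2])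
      <-> nerve1 p (z :: x).
    by rewrite map_tnth_enum /=; split=> [[]//|H]; exists ord0.
  rewrite nerve1_cons//; case: p {hx} => /=.
    rewrite mink_eball; split=> -[w Hw zw]; exists w => //.
      by move=> _ /tnthP[j ->]; exact: Hw.
    by move=> j _; apply: Hw; exact: mem_tnth.
  by split=> [H _ /tnthP[j ->]|H j _]; [exact: H|apply: H; exact: mem_tnth].
have nE i : nerve1 p [seq tnth (cons_tuple z x) j | j <- [seq j <- enum 'I_k.+2 | j != lift ord0 i]]
    <-> nerve1 p (z :: [seq tnth x j | j <- [seq j <- enum 'I_k.+1 | j != i]]).
  split; apply: nerve_sub => y; [rewrite -mem_nbr_index_down|rewrite mem_nbr_index_down]; exact.
have hi i : nerve1 p [seq tnth x j | j <- [seq j <- enum 'I_k.+1 | j != i]].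
  by apply: nerve_sub hx => y /mapP[j _ ->]; exact: mem_tnth.
have mi i y : y \in [seq tnth x j | j <- [seq j <- enum 'I_k.+1 | j != i]] <->
    exists2 j, j != i & y = tnth x j.
  split=> [/mapP[j]|[j ji ->]]; first by rewrite mem_filter => /andP[ji _] ->; exists j.
  by apply: map_f; rewrite mem_filter ji mem_enum.
have nC i := nerve1_cons z (hi i).
case: p {hx hi} nE nC => /= nE nC.
  split=> [[i _ /mink_eball[w Hw zw]]|[i /nE/nC[w Hw zw]]].
    exists i; apply/nE/nC; exists w => // y /mi[j ji ->]; exact: Hw.
  exists i => //; apply/mink_eball; exists w => // j ji.
  by apply: Hw; apply/mi; exists j.
split=> [[i _ H]|[i /nE/nC H]]; exists i => //.
  by apply/nE/nC => y /mi[j ji ->]; exact: H.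
by move=> j ji; apply: H; apply/mi; exists j.
Qed.

End euclidean_nerve.

(** * Unrolling the torus *)

Section unroll_points.
Context {R : realType} (d : nat).
Local Notation pt := pt[R]_d.
Variables (r : R) (a : pt).
Hypotheses (r0 : 0 < r) (r32 : r <= 32^-1) (ta : torus a).
Local Notation mu := (leb_Rd d).
Implicit Types (x y z w u v : pt).

Definition unroll_pt x : pt :=
  [tuple scaled_unroll r (tnth a i) (tnth x i) | i < d].

Definition half_box : set pt := [set u | forall i, - 2^-1 <= r * tnth u i < 2^-1].

Lemma unroll_ptE x i : r * tnth (unroll_pt x) i = unroll (tnth a i) (tnth x i).
Proof. by rewrite tnth_mktuple /scaled_unroll mulrC divfK// gt_eqF. Qed.

Lemma unroll_pt_self : unroll_pt a = origin d.
Proof.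
apply: eq_from_tnth => i; rewrite !tnth_mktuple /scaled_unroll /unroll subrr.
by rewrite ifF ?ifT ?mul0r ?invr_gt0//; apply/negbTE; rewrite -leNgt; lra.
Qed.

Lemma measurable_unroll_pt : measurable_fun setT unroll_pt.
Proof.
apply: (@measurable_tuple_map _ _ d (fun i => scaled_unroll r (tnth a i))) => i.
exact: measurable_scaled_unroll.
Qed.

Lemma unroll_pt_box x : torus x -> half_box (unroll_pt x).
Proof. by move=> tx i; rewrite unroll_ptE; apply: unroll_itv. Qed.

Lemma measurable_half_box1 :
  measurable [set u : measurableTypeR R | - 2^-1 <= r * u < 2^-1].
Proof.
rewrite (_ : [set _ | _] = `[- 2^-1 / r, 2^-1 / r[%classic)//.
apply/seteqP; split=> u /=; rewrite in_itv /= ler_pdivrMr// ltr_pdivlMr//;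
by rewrite ![u * _]mulrC.
Qed.

Lemma measurable_half_box : measurable half_box.
Proof.
apply: (@measurable_tnth_set _ _ d (fun=> [set u : measurableTypeR R | - 2^-1 <= r * u < 2^-1])).
by move=> _; exact: measurable_half_box1.
Qed.

Lemma leb_Rd_unroll_pt B : measurable B ->
  mu (@torus R d `&` unroll_pt @^-1` B) = ((r ^+ d)%:E * mu (half_box `&` B))%E.
Proof.
move=> mB.
apply: (@tuple_measure_transport _ _ R lebesgue_measure d
  (fun=> [set t : measurableTypeR R | 0 <= t <= 1])
  (fun=> [set u : measurableTypeR R | - 2^-1 <= r * u < 2^-1])
  (fun i => scaled_unroll r (tnth a i)) r (ltW r0)) => //.
- by move=> _; rewrite (_ : [set _ | _] = `[0, 1]%classic).
- by move=> _; exact: measurable_half_box1.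
- by move=> i; exact: measurable_scaled_unroll.
- by move=> i C mC; exact: (lebesgue_measure_unroll r0 (ta i) mC).
Qed.

Lemma unroll_pt_surj v : half_box v -> exists2 w, torus w & unroll_pt w = v.
Proof.
(* Shift back by the base point and wrap into [0, 1]. *)
move=> bv; pose f (b u : R) := if b + r * u < 0 then b + r * u + 1 else
  if b + r * u <= 1 then b + r * u else b + r * u - 1.
exists [tuple f (tnth a i) (tnth v i) | i < d].
  move=> i; rewrite tnth_mktuple /f; have := ta i; have := bv i.
  move: (tnth a i : R) (tnth v i : R) => b u /andP[u1 u2] /andP[b0 b1].
  by do 2?case: ifPn; rewrite -?leNgt -?ltNge => *; lra.
apply: eq_from_tnth => i; rewrite !tnth_mktuple /scaled_unroll.
have := ta i; have := bv i.
move: (tnth a i : R) (tnth v i : R) => b u /andP[u1 u2] /andP[b0 b1].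
suff -> : unroll b (f b u) = r * u by rewrite mulrAC divff ?mul1r// gt_eqF.
rewrite /f; case: ifPn => [|]; rewrite -?leNgt => ?;
  [|case: ifPn => [|]; rewrite -?ltNge => ?];
  by rewrite /unroll; do 2?[case: ifPn => [|]; rewrite -?leNgt => ?]; lra.
Qed.

(** The bound is in the units of the torus, before division by r, so that c compares directly with
    1/4 and 1/2. *)
Definition near_origin (c : R) v := forall i, `|r * tnth v i| <= c.

Lemma near_originW c c' v : c <= c' -> near_origin c v -> near_origin c' v.
Proof. by move=> cc cv i; exact: le_trans (cv i) cc. Qed.

Lemma near_origin_eball c (rho : R) u v : near_origin c u -> eball u rho v ->
  near_origin (c + r * rho) v.
Proof.
move=> cu uv i; have h : `|tnth u i - tnth v i| <= rho.
  exact: le_trans (ler_abs_enorm (fun i => tnth u i - tnth v i) i) uv.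
have h2 : `|r * (tnth u i - tnth v i)| <= r * rho by rewrite normrM gtr0_norm// ler_pM2l.
have := ler_normB (r * tnth u i) (r * (tnth u i - tnth v i)).
rewrite -mulrBr opprB addrC subrK => /le_trans; apply.
by rewrite lerD.
Qed.

Lemma near_origin_box c v : c < 2^-1 -> near_origin c v -> half_box v.
Proof.
move=> c2 cv i; have := cv i; rewrite ler_norml => /andP[h1 h2].
by move: h1 h2; move: (r * tnth v i) => u h1 h2; apply/andP; split; lra.
Qed.

(** Coordinates of the two unrolled points differ by at most 1/2 + 1/4. A nearly optimal translate
    has coordinates at most r + 1/32 <= 1/16. The two differ by an integer of absolute value below
    1, hence they are equal. *)
Lemma tdist_unroll x w : torus x -> torus w -> near_origin 4^-1 (unroll_pt w) ->
  tdist x w <= r <-> eball (unroll_pt x) 1 (unroll_pt w).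
Proof.
move=> tx tw cw.
have /choice[zx hx] : forall i, exists z : int,
    r * tnth (unroll_pt x) i = tnth x i - tnth a i + z%:~R.
  by move=> i; rewrite unroll_ptE; exact: unroll_int.
have /choice[zw hw] : forall i, exists z : int,
    r * tnth (unroll_pt w) i = tnth w i - tnth a i + z%:~R.
  by move=> i; rewrite unroll_ptE; exact: unroll_int.
pose D i := r * tnth (unroll_pt x) i - r * tnth (unroll_pt w) i.
have eD : enorm D = r * enorm (fun i => tnth (unroll_pt x) i - tnth (unroll_pt w) i).
  rewrite (@eq_enorm _ _ _ (fun i => r * (tnth (unroll_pt x) i - tnth (unroll_pt w) i))).
    by rewrite enormZ gtr0_norm.
  by move=> i; rewrite mulrBr.
have -> : eball (unroll_pt x) 1 (unroll_pt w) <-> enorm D <= r.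
  by rewrite eD /eball /= ger_pMr.
split=> [xw|xw]; last first.
  apply: le_trans (tdist_le x w (fun i => zx i - zw i)) _.
  rewrite (@eq_enorm _ _ _ D)// => i; rewrite /D hx hw intrB.
  by move: (tnth x i : R) (tnth w i : R) (tnth a i : R) => *; ring.
apply/ler_addgt0Pr => e e0.
have e'0 : 0 < Num.min e 32^-1 by rewrite lt_min e0 /= invr_gt0 ltr0n.
have [z hz] := (tdist_leP x w r).2 xw _ e'0.
have hz1 : enorm (fun i => tnth x i - tnth w i + (z i)%:~R) <= r + e.
  by apply: le_trans hz _; rewrite lerD2l ge_min lexx.
have hz2 : enorm (fun i => tnth x i - tnth w i + (z i)%:~R) <= 16^-1.
  apply: le_trans hz _; have : Num.min e 32^-1 <= 32^-1 by rewrite ge_min lexx orbT.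
  by move: r32; move: (Num.min _ _) => c; lra.
apply: le_trans hz1; rewrite le_eqVlt; apply/orP; left; apply/eqP; apply: eq_enorm => i.
have Di : D i = tnth x i - tnth w i + (zx i - zw i)%:~R.
  rewrite /D hx hw intrB.
  by move: (tnth x i : R) (tnth w i : R) (tnth a i : R) => *; ring.
have := le_trans (ler_abs_enorm (fun i => tnth x i - tnth w i + (z i)%:~R) i) hz2.
have := unroll_pt_box tx i; have := cw i.
suff Z : `|(z i - (zx i - zw i))%:~R : R| < 1 -> D i = tnth x i - tnth w i + (z i)%:~R.
  move=> h1 h2 h3; apply: Z.
  have -> : (z i - (zx i - zw i))%:~R = (tnth x i - tnth w i + (z i)%:~R) - D i.
    rewrite Di [in LHS]intrB.
    by move: (tnth x i : R) (tnth w i : R) => b c; ring.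
  move: h1 h2 h3; rewrite /D; move: (r * _) (r * _) (_ + _) => u v c.
  rewrite !ler_norml ltr_norml => /andP[? ?] /andP[? ?] /andP[? ?].
  by apply/andP; split; lra.
move=> Z; rewrite Di; congr (_ + _%:~R).
apply/eqP; rewrite eq_sym -subr_eq0; apply/eqP.
by apply/eqP; move: Z; rewrite -intr_norm ltrz1 -normr_le0; case: (`|_|) => [[|]|].
Qed.


Lemma tdistC x y : tdist x y = tdist y x.
Proof.
have H u v : tdist u v <= tdist v u.
  apply/tdist_leP => e e0; have [z hz] := (tdist_leP v u _).2 (lexx _) e e0.
  exists (fun i => - z i); apply: le_trans hz.
  rewrite (@eq_enorm _ _ _ (fun i => - 1 * (tnth v i - tnth u i + (z i)%:~R))).
    by rewrite enormZ normrN1 mul1r.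
  by move=> i; rewrite intrN; move: (tnth v i : R) (tnth u i : R) => b c; ring.
by apply/eqP; rewrite eq_le !H.
Qed.

Lemma eballC (rho : R) u v : eball u rho v -> eball v rho u.
Proof. by rewrite /eball /= enormB. Qed.

Lemma cech_unroll (s : seq pt) x0 c : (forall x, x \in s -> torus x) ->
  x0 \in s -> near_origin c (unroll_pt x0) -> c + r <= 4^-1 ->
  (exists w, forall x, x \in s -> tball x r w) <->
  (exists w, forall x, x \in s -> eball (unroll_pt x) 1 w).
Proof.
move=> ts x0s cx0 cr.
have c4 : c <= 4^-1 by apply: le_trans cr; rewrite lerDl ltW.
split=> -[w Hw].
  have [tw wx0] := Hw x0 x0s.
  have ww : near_origin 4^-1 (unroll_pt w).
    apply: (near_originW cr); rewrite -[r]mulr1; apply: (near_origin_eball cx0).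
    apply: eballC; apply/tdist_unroll => //; [exact: ts|exact: (near_originW c4 cx0)|].
    by rewrite tdistC.
  exists (unroll_pt w) => x xs; apply/tdist_unroll => //; first exact: ts.
  by have [] := Hw x xs.
have nw : near_origin 4^-1 w.
  apply: (near_originW cr); rewrite -[r]mulr1; apply: (near_origin_eball cx0).
  exact: Hw.
have [|w' tw' w'w] := unroll_pt_surj (v := w).
  by apply: near_origin_box nw; lra.
exists w' => x xs; split => //=; apply/tdist_unroll => //; first exact: ts.
  by rewrite w'w.
by rewrite w'w; exact: Hw.
Qed.

(** In the Rips case every vertex is within 2 r of x0, and a common point of two balls lies another
    r away; this is the 3 r in the hypothesis. *)
Lemma nerve_unroll p (s : seq pt) x0 c : (forall x, x \in s -> torus x) ->
  x0 \in s -> near_origin c (unroll_pt x0) -> c + 3 * r <= 4^-1 ->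
  nerve p (fun x : pt => tball x r) s <->
  nerve p (fun x : pt => eball x 1) (map unroll_pt s).
Proof.
move=> ts x0s cx0 cr.
have c1 : c + r <= 4^-1 by move: cr r0; lra.
have mapE (u : seq pt) : (exists w, forall x, x \in u -> eball (unroll_pt x) 1 w) <->
    (exists w, forall x, x \in map unroll_pt u -> eball x 1 w).
  split=> -[w Hw]; exists w => x; last by move=> xu; apply: Hw; exact: map_f.
  by move=> /mapP[y yu ->]; exact: Hw.
case: p => /=; first by rewrite (cech_unroll ts x0s cx0 c1).
have pairE x y (e : R) : near_origin e (unroll_pt x) -> e + r <= 4^-1 -> x \in s -> y \in s ->
    (exists w, tball x r w /\ tball y r w) <->
    (exists w, eball (unroll_pt x) 1 w /\ eball (unroll_pt y) 1 w).
  move=> ex er xs ys; have := @cech_unroll [:: x; y] x e _ (mem_head _ _) ex er.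
  have tp z : z \in [:: x; y] -> torus z.
    by rewrite !inE => /orP[/eqP ->|/eqP ->]; exact: ts.
  move=> /(_ tp) H; split.
    move=> [w [xw yw]]; have [|w' Hw'] := H.1.
      by exists w => z; rewrite !inE => /orP[/eqP ->|/eqP ->].
    by exists w'; split; apply: Hw'; rewrite !inE eqxx ?orbT.
  move=> [w [xw yw]]; have [|w' Hw'] := H.2.
    by exists w => z; rewrite !inE => /orP[/eqP ->|/eqP ->].
  by exists w'; split; apply: Hw'; rewrite !inE eqxx ?orbT.
have small x w : eball (unroll_pt x0) 1 w -> eball (unroll_pt x) 1 w ->
    near_origin (c + 2 * r) (unroll_pt x).
  move=> x0w xw; have := near_origin_eball (near_origin_eball cx0 x0w) (eballC xw).
  by apply: near_originW; move: r0; lra.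
have c2 : c + 2 * r + r <= 4^-1 by move: cr; lra.
split=> H.
  move=> _ _ /mapP[x xs ->] /mapP[y ys ->].
  have [w [w1 w2]] := (pairE _ _ _ cx0 c1 x0s xs).1 (H _ _ x0s xs).
  by apply/(pairE _ _ _ (small _ _ w1 w2) c2 xs ys); exact: H.
move=> x y xs ys.
have [w [w1 w2]] := H _ _ (map_f unroll_pt x0s) (map_f unroll_pt xs).
apply/(pairE _ _ _ (small _ _ w1 w2) c2 xs ys).
exact: (H _ _ (map_f unroll_pt xs) (map_f unroll_pt ys)).
Qed.

End unroll_points.

(** * The mean after unrolling and rescaling *)

Section mean_formula.
Context {R : realType} (d : nat).
Local Notation pt := pt[R]_d.
Local Notation mu := (leb_Rd d).
Variables (p : complex_type) (q : connectivity).
Local Notation tnerve r := (nerve p (fun x : pt => tball x r)).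
Local Notation nerve1 := (nerve p (fun x : pt => eball x 1)).

Lemma fine_scale (c : R) (x : \bar R) : 0 < c -> fine (c%:E * x)%E = c * fine x.
Proof.
by move=> c0; case: x => [x||] /=; rewrite ?gt0_muley ?gt0_muleNy ?lte_fin ?mulr0.
Qed.

Definition Qnbr k (x : k.+1.-tuple pt) : set pt :=
  [set z | nbr_tuples p q (fun x : pt => eball x 1) (cons_tuple z x)].

Lemma nbr_tuples_tball_pclosed r k : pclosed (nbr_tuples p q (fun x : pt => tball x r) (k := k)).
Proof.
apply: (@pclosed_ex _ _ k.+2 _ (fun i => [set t : k.+2.-tuple pt |
  tnerve r [seq tnth t j | j <- nbr_index q i]])) => i.
exact: nerve_tball_pclosed.
Qed.

Lemma nbr_tuples_eball_pclosed r k : pclosed (nbr_tuples p q (fun x : pt => eball x r) (k := k)).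
Proof.
apply: (@pclosed_ex _ _ k.+2 _ (fun i => [set t : k.+2.-tuple pt |
  nerve p (fun x : pt => eball x r) [seq tnth t j | j <- nbr_index q i]])) => i.
exact: nerve_eball_pclosed.
Qed.

Lemma face_tuples_tball_pclosed r k : pclosed [set t : k.-tuple pt | tnerve r t].
Proof.
have := @nerve_tball_pclosed R d p r k (enum 'I_k).
by congr pclosed; apply/funext => t /=; rewrite map_tnth_enum.
Qed.

Lemma face_tuples_eball_pclosed r k :
  pclosed [set t : k.-tuple pt | nerve p (fun x : pt => eball x r) t].
Proof.
have := @nerve_eball_pclosed R d p r k (enum 'I_k).
by congr pclosed; apply/funext => t /=; rewrite map_tnth_enum.
Qed.

Lemma measurable_Qnbr k (x : k.+1.-tuple pt) : measurable (Qnbr x).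
Proof.
exact: (measurable_preimageT (measurable_cons_point x)
  (measurable_pclosed (@nbr_tuples_eball_pclosed 1 k))).
Qed.

Definition face_weight k (s : R) (y : k.-tuple pt) : R :=
  `[< nerve1 (cons_tuple (origin d) y) >]%:R *
  expR (- (s * vol (Qnbr (cons_tuple (origin d) y)))).

Lemma measurable_faces k : measurable [set y : k.-tuple pt | nerve1 (cons_tuple (origin d) y)].
Proof.
exact: (measurable_preimageT (measurable_cons_tuple (origin d))
  (measurable_pclosed (@face_tuples_eball_pclosed 1 k.+1))).
Qed.

Lemma measurable_vol_Qnbr k :
  measurable_fun setT (fun y : k.-tuple pt => vol (Qnbr (cons_tuple (origin d) y))).
Proof.
apply: (@measurableT_comp _ _ _ _ _ _ fine) => //.
apply: (@measurableT_comp _ _ _ _ _ _ (fun x : k.+1.-tuple pt => mu (Qnbr x))).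
  apply: (measurable_fun_point_measure mu).
  exact: (measurable_pclosed (@nbr_tuples_eball_pclosed 1 k)).
exact: measurable_cons_tuple.
Qed.

Lemma measurable_face_weight k s : measurable_fun setT (@face_weight k s).
Proof.
apply: measurable_funM.
  rewrite (_ : (fun x => _) = \1_[set y : k.-tuple pt | nerve1 (cons_tuple (origin d) y)]).
    by apply: measurable_indic; exact: measurable_faces.
  by apply/funext => x; rewrite indicE.
apply: measurableT_comp => //; apply: measurableT_comp => //.
by apply: measurable_funM => //; exact: measurable_vol_Qnbr.
Qed.

Lemma face_weight_ge0 k s y : 0 <= @face_weight k s y.
Proof. by rewrite mulr_ge0 ?expR_ge0. Qed.

Variables (r : R) (k : nat).
Hypotheses (r0 : 0 < r) (r32 : r <= 32^-1) (k1 : (1 <= k)%N).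

Lemma nerve1_near (s : seq pt) x y c : nerve1 s -> x \in s -> y \in s ->
  near_origin r c x -> near_origin r (c + 2 * r) y.
Proof.
move=> sn xs ys cx; have [w [xw yw]] := nerve_pair sn xs ys.
have := near_origin_eball r0 (near_origin_eball r0 cx xw) (eballC yw).
by apply: near_originW; rewrite !mulr1 mulr_natl mulr2n addrA.
Qed.

Lemma near_origin0 : near_origin r 0 (origin d).
Proof. by move=> i; rewrite tnth_mktuple mulr0 normr0. Qed.

Lemma nerve1_half_box (y : k.-tuple pt) : nerve1 (cons_tuple (origin d) y) ->
  forall j, half_box r (tnth y j).
Proof.
move=> yn j; apply: (@near_origin_box _ _ _ (0 + 2 * r)).
  by move: r32; lra.
by apply: (nerve1_near yn _ _ near_origin0); rewrite ?mem_head// inE mem_tnth orbT.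
Qed.

(** Even when x_i is left out, some x_j remains because k >= 1. It ties the extra point to the face
    and so bounds its distance. *)
Lemma nbr_index_other (i : 'I_k.+1) : exists2 j : 'I_k.+1,
  (ord0 : 'I_k.+2) \in nbr_index q i & lift ord0 j \in nbr_index q i.
Proof.
rewrite /nbr_index; case: q => /=.
  by exists ord0; rewrite mem_enum.
have [j ij] : exists j : 'I_k.+1, j != i.
  have [->|i0] := eqVneq i ord0; last by exists ord0; rewrite eq_sym.
  by exists ord_max; rewrite -val_eqE /= -lt0n.
by exists j; rewrite mem_filter mem_enum andbT// (inj_eq lift_inj).
Qed.

Lemma Qnbr_half_box (y : k.-tuple pt) : nerve1 (cons_tuple (origin d) y) ->
  Qnbr (cons_tuple (origin d) y) `<=` half_box r.
Proof.
move=> yn z [i zn]; have [j i0 ij] := nbr_index_other i.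
pose T := cons_tuple z (cons_tuple (origin d) y).
have zn' := map_f (tnth T) i0; have jn := map_f (tnth T) ij.
rewrite tnth0 in zn'; rewrite tnthS in jn.
have jy : near_origin r (0 + 2 * r) (tnth (cons_tuple (origin d) y) j).
  by apply: (nerve1_near yn _ _ near_origin0); rewrite ?mem_head// mem_tnth.
apply: (@near_origin_box _ _ _ (0 + 2 * r + 2 * r)); first by move: r32; lra.
exact: (nerve1_near zn jn zn' jy).
Qed.

Section fixed_base_point.
Variable a : pt.
Hypothesis ta : torus a.
Local Notation psi := (unroll_pt r a).

Lemma map_tuple_cons (f : pt -> pt) m (x : pt) (t : m.-tuple pt) :
  map_tuple f (cons_tuple x t) = cons_tuple (f x) (map_tuple f t).
Proof. exact: val_inj. Qed.

Lemma face_unroll (t : k.-tuple pt) : (forall j, torus (tnth t j)) ->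
  tnerve r (cons_tuple a t) <-> nerve1 (cons_tuple (origin d) (map_tuple psi t)).
Proof.
move=> tt; rewrite -(unroll_pt_self r a) -map_tuple_cons.
apply: (nerve_unroll r0 r32 ta p (x0 := a) (c := 0)) => //.
- by move=> x; rewrite inE => /orP[/eqP ->//|/tnthP[j ->]].
- exact: mem_head.
- by rewrite unroll_pt_self//; exact: near_origin0.
- by move: r32; lra.
Qed.

Lemma nbr_unroll (t : k.-tuple pt) z : (forall j, torus (tnth t j)) -> torus z ->
  nerve1 (cons_tuple (origin d) (map_tuple psi t)) ->
  nbr_tuples p q (fun x : pt => tball x r) (cons_tuple z (cons_tuple a t)) <->
  Qnbr (cons_tuple (origin d) (map_tuple psi t)) (psi z).
Proof.
move=> tt tz yn; rewrite /Qnbr /nbr_tuples /=.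
pose T := cons_tuple z (cons_tuple a t).
have mE i : [seq tnth (cons_tuple (psi z) (cons_tuple (origin d) (map_tuple psi t))) j | j <- nbr_index q i] =
    map psi [seq tnth T j | j <- nbr_index q i].
  rewrite -map_comp; apply: eq_map => j /=.
  by rewrite -(unroll_pt_self r a) -!map_tuple_cons tnth_map.
have tT j : torus (tnth T j).
  by case: (unliftP ord0 j) => [i ->|->]; rewrite ?tnth0// tnthS;
   case: (unliftP ord0 i) => [i' ->|->]; rewrite ?tnth0// tnthS.
have iE i : tnerve r [seq tnth T j | j <- nbr_index q i] <->
   nerve1 [seq tnth (cons_tuple (psi z) (cons_tuple (origin d) (map_tuple psi t))) j | j <- nbr_index q i].
  have [j _ ij] := nbr_index_other i; rewrite mE.
  apply: (nerve_unroll r0 r32 ta p (x0 := tnth T (lift ord0 j)) (c := 0 + 2 * r)).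
  - by move=> _ /mapP[j' _ ->].
  - exact: map_f.
  - have -> : psi (tnth T (lift ord0 j)) = tnth (cons_tuple (origin d) (map_tuple psi t)) j.
      by rewrite tnthS -(unroll_pt_self r a) -map_tuple_cons tnth_map.
    by apply: (nerve1_near yn _ _ near_origin0); rewrite ?mem_head// mem_tnth.
  - by move: r32; lra.
by split=> -[i /iE H]; exists i.
Qed.

(** The region that has to be empty unrolls to Q of the rescaled face. Q fits into the half box, so
    no part of it is lost and the volume is r^d |Q|. *)
Lemma density_unroll lam (t : k.-tuple pt) : (forall j, torus (tnth t j)) ->
  isolation_density lam [set t : k.+1.-tuple pt | tnerve r t]
    (nbr_tuples p q (fun x : pt => tball x r) (k := k)) (cons_tuple a t) =
  lam ^+ k.+1 * face_weight (lam * r ^+ d) (map_tuple psi t).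
Proof.
move=> tt; rewrite /isolation_density /face_weight mulrCA.
have tat j : torus (tnth (cons_tuple a t) j).
  by case: (unliftP ord0 j) => [i ->|->]; rewrite ?tnth0// tnthS.
have -> : `[< (forall j, torus (tnth (cons_tuple a t) j)) /\
     [set t : k.+1.-tuple pt | tnerve r t] (cons_tuple a t) >] =
     `[< nerve1 (cons_tuple (origin d) (map_tuple psi t)) >].
  by apply/asbool_equiv_eq; rewrite -face_unroll//; split=> [[]|].
case: asboolP => yn; last by rewrite !mul0r.
rewrite !mul1r; congr (_ * expR (- _)); rewrite -mulrA; congr (_ * _).
have mQ := measurable_Qnbr (cons_tuple (origin d) (map_tuple psi t)).
have -> : g_nbhd (nbr_tuples p q (fun x : pt => tball x r) (k := k)) (cons_tuple a t) =
    @torus R d `&` psi @^-1` Qnbr (cons_tuple (origin d) (map_tuple psi t)).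
  by apply/seteqP; split=> z [tz zn]; split=> //; apply/(nbr_unroll tt tz yn).
rewrite /vol (leb_Rd_unroll_pt r0 ta mQ) setIidr; last exact: Qnbr_half_box.
by rewrite fine_scale// exprn_gt0.
Qed.

End fixed_base_point.

(** The inner integral is the same for every base point in the torus, whose volume is 1. Each of the
    k other points contributes a factor r^d under unrolling. *)
Lemma integral_density lam : 0 < lam ->
  (\int[leb_pow d k.+1]_x (isolation_density lam [set t : k.+1.-tuple pt | tnerve r t]
    (nbr_tuples p q (fun x : pt => tball x r) (k := k)) x)%:E =
  (lam ^+ k.+1 * (r ^+ d) ^+ k)%:E *
    \int[leb_pow d k]_y (face_weight (lam * r ^+ d) y)%:E)%E.
Proof.
move=> lam0; have rd0 : 0 <= r ^+ d by rewrite exprn_ge0 ?ltW.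
pose C := ((lam ^+ k.+1 * (r ^+ d) ^+ k)%:E *
    \int[leb_pow d k]_y (face_weight (lam * r ^+ d) y)%:E)%E.
set D := isolation_density _ _ _.
have D0 x : 0 <= D x by rewrite /D /isolation_density !mulr_ge0 ?exprn_ge0 ?expR_ge0// ltW.
have mD : measurable_fun setT (fun x => (D x)%:E).
  apply/measurable_EFinP; apply: measurable_isolation_density.
    exact: face_tuples_tball_pclosed.
  exact: nbr_tuples_tball_pclosed.
rewrite /leb_pow ge0_integral_tupleS//.
pose U : set (k.-tuple pt) := [set t | forall j, torus (tnth t j)].
have mU : measurable U.
  by apply: (@measurable_tnth_set _ _ k (fun=> @torus R d)) => _; exact: measurable_torus.
pose E : set (k.-tuple pt) := [set t | forall j, half_box r (tnth t j)].
have mE : measurable E.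
  by apply: (@measurable_tnth_set _ _ k (fun=> half_box r)) => _; exact: measurable_half_box.
have inner a : torus a ->
    (\int[tuple_measure mu k]_t (D (cons_pair (a, t)))%:E = C)%E.
  move=> ta; pose F (t : k.-tuple pt) : \bar R := (lam ^+ k.+1 * face_weight (lam * r ^+ d) t)%:E.
  have F0 t : (0 <= F t)%E by rewrite lee_fin mulr_ge0 ?face_weight_ge0 ?exprn_ge0 ?ltW.
  have mF : measurable_fun setT F.
    by apply/measurable_EFinP; apply: measurable_funM => //; exact: measurable_face_weight.
  transitivity (\int[tuple_measure mu k]_(t in U)
     F [tuple (fun=> unroll_pt r a) i (tnth t i) | i < k])%E.
    rewrite [RHS]integral_mkcond; apply: eq_integral => t _.
    rewrite patchE; case: ifPn => [/set_mem tU|tU].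
      rewrite /F (_ : [tuple _ | i < k] = map_tuple (unroll_pt r a) t).
        by rewrite -density_unroll.
      by apply: eq_from_tnth => j; rewrite tnth_mktuple tnth_map.
    rewrite /D /isolation_density (_ : `[< _ >] = false) ?mul0r//.
    apply/asboolPn => -[H _]; move/negP: tU; apply; apply/mem_set => j.
    by have := H (lift ord0 j); rewrite tnthS.
  rewrite (@ge0_integral_transport _ _ _ _ R (tuple_measure mu k) (tuple_measure mu k) U E
    (fun t => [tuple (fun=> unroll_pt r a) i (tnth t i) | i < k]) ((r ^+ d) ^+ k) F)//.
  - rewrite /C (mulrC (lam ^+ k.+1)) EFinM -muleA; congr (_ * _)%E.
    rewrite -ge0_integralZl//; [|by apply/measurable_EFinP; exact: measurable_face_weight|
      by move=> t _; rewrite lee_fin face_weight_ge0|by rewrite lee_fin exprn_ge0 ?ltW].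
    rewrite integral_mkcond; apply: eq_integral => t _.
    rewrite patchE /F EFinM; case: ifPn => // tE.
    rewrite /face_weight (_ : `[< _ >] = false) ?mul0r ?mule0//.
    apply/asboolPn => H; move/negP: tE; apply; apply/mem_set => j.
    exact: nerve1_half_box.
  - by rewrite exprn_ge0.
  - apply: (@measurable_tuple_map _ _ k (fun=> unroll_pt r a)) => _.
    exact: measurable_unroll_pt.
  - move=> B mB; apply: (@tuple_measure_transport _ _ R mu k (fun=> @torus R d)
      (fun=> half_box r) (fun=> unroll_pt r a) (r ^+ d)) => //.
    + by move=> _; exact: measurable_torus.
    + by move=> _; exact: measurable_half_box.
    + by move=> _; exact: measurable_unroll_pt.
    + by move=> _ B' mB'; exact: leb_Rd_unroll_pt.
rewrite -/C (eq_integral (fun a => C * (\1_(@torus R d) a)%:E)%E); last first.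
  move=> a _; rewrite indicE; have [ta|ta] := boolP (a \in @torus R d).
    by rewrite mule1 inner//; exact: set_mem.
  rewrite mule0 integral0_eq// => t _.
  rewrite /D /isolation_density (_ : `[< _ >] = false) ?mul0r//.
  apply/asboolPn => -[H _]; move/negP: ta; apply; apply/mem_set.
  by have := H ord0; rewrite tnth0.
rewrite ge0_integralZl//.
- rewrite integral_indic ?setIT//; last exact: measurable_torus.
  by transitivity (C * 1)%E; [congr (_ * _)%E; exact: leb_Rd_torus|rewrite mule1].
- by apply/measurable_EFinP; apply: measurable_indic; exact: measurable_torus.
- apply: mule_ge0; first by rewrite lee_fin mulr_ge0 ?exprn_ge0 ?ltW.
  by apply: integral_ge0 => y _; rewrite lee_fin face_weight_ge0.
Qed.

End mean_formula.

Section expected_number.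
Context {R : realType} (d : nat) {disp : measure_display}
  {Omega : measurableType disp}.
Local Notation pt := pt[R]_d.
Variables (P : probability Omega R) (lam : R) (N : Omega -> {fset pt}).
Hypotheses (ppN : is_poisson_process P lam N) (lam0 : 0 < lam).
Hypotheses (d0 : (0 < d)%N).
Variables (p : complex_type) (q : connectivity) (r : R) (k : nat).
Hypotheses (r0 : 0 < r) (r32 : r <= 32^-1) (k1 : (1 <= k)%N).

Lemma expected_nb_isolated :
  ('E_P[fun w => (nb_isolated p q (N w) r k)%:R] =
   (lam ^+ k.+1 * (r ^+ d) ^+ k / (k.+1)`!%:R)%:E *
     \int[leb_pow d k]_y (face_weight p q (lam * r ^+ d) y)%:E)%E.
Proof.
have f0 : 0 < (k.+1)`!%:R :> R by rewrite ltr0n fact_gt0.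
pose h := [set t : k.+1.-tuple pt | nerve p (fun x : pt => tball x r) t].
pose g := nbr_tuples p q (fun x : pt => tball x r) (k := k).
have ch : pclosed h by exact: face_tuples_tball_pclosed.
have cg : pclosed g by exact: nbr_tuples_tball_pclosed.
rewrite unlock.
rewrite (eq_integral (fun w => ((k.+1)`!%:R^-1)%:E * (#|isolated_tuples h g (N w)|%:R)%:E)%E); last first.
  move=> w _; rewrite -(nb_isolated_tuples p q (ltW r0) k1 (pp_support ppN (w := w))).
  by rewrite natrM -EFinM mulrC mulfK// gt_eqF.
rewrite ge0_integralZl//; last first.
  exact: (measurable_count_tuples ppN ch cg).
rewrite (mecke_formula d0 ppN lam0 ch cg) (integral_density d p q r0 r32 k1 lam0).
by rewrite muleA -EFinM mulrC.
Qed.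

End expected_number.

(** * Volumes of the neighbourhoods *)

Section volume_bounds.
Context {R : realType} (d k : nat) (p : complex_type) (q : connectivity).
Local Notation pt := pt[R]_d.
Local Notation mu := (leb_Rd d).
Local Notation nerve1 := (nerve p (fun x : pt => eball x 1)).
Hypothesis k1 : (1 <= k)%N.
Implicit Types (x y : k.-tuple pt) (z w : pt).

(** The unrolling estimates are reused at the fixed radius 1/32, only to enclose all faces and their
    sets Q in one bounded box. *)
Let r32 : (32^-1 : R) <= 32^-1. Proof. exact: lexx. Qed.
Let r0 : 0 < (32^-1 : R). Proof. by rewrite invr_gt0. Qed.

Definition faces : set (k.-tuple pt) := [set y | nerve1 (cons_tuple (origin d) y)].

Definition nbr_vol (y : k.-tuple pt) : R := vol (Qnbr p q (cons_tuple (origin d) y)).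

(** Read off the unrolling formula applied to the whole space: 1 = r^d |half_box|. *)
Lemma leb_Rd_half_box : (mu (half_box (32^-1 : R)) < +oo)%E.
Proof.
have to : torus (origin d : pt) by move=> i; rewrite tnth_mktuple lexx ler01.
have := leb_Rd_unroll_pt r0 to measurableT.
rewrite preimage_setT !setIT leb_Rd_torus.
have : 0 < (32^-1 : R) ^+ d by rewrite exprn_gt0.
by case: (mu _) => [c _ _||] //=; rewrite ?ltry// => c0; rewrite gt0_muley.
Qed.

Lemma Aset_faces : @Aset R d k p = faces.
Proof. by apply/seteqP; split=> y; rewrite /Aset /faces /mkset hprop_nerve. Qed.

Lemma measurable_facesE : measurable faces.
Proof. exact: measurable_faces. Qed.

Lemma leb_faces_lty : (leb_pow d k faces < +oo)%E.
Proof.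
have mH : measurable [set y : k.-tuple pt | forall j, half_box (32^-1 : R) (tnth y j)].
  by apply: (@measurable_tnth_set _ _ k (fun=> half_box (32^-1 : R))) => _; exact: measurable_half_box.
apply: (@le_lt_trans _ _ (leb_pow d k [set y : k.-tuple pt | forall j, half_box (32^-1 : R) (tnth y j)])).
  apply: le_measure; rewrite ?inE//; first exact: measurable_facesE.
  by move=> y; exact: nerve1_half_box.
rewrite (_ : leb_pow d k _ = \prod_(j < k) mu (half_box (32^-1 : R)))%E; last first.
  by apply: (@tuple_measure_box _ _ R mu k (fun=> half_box (32^-1 : R))) => _;
    exact: measurable_half_box.
have /fineK <- : mu (half_box (32^-1 : R)) \is a fin_num.
  by rewrite ge0_fin_numE ?leb_Rd_half_box.
by rewrite prodEFin ltry.
Qed.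

Lemma Qnbr_volE y : faces y ->
  mu (Qnbr p q (cons_tuple (origin d) y)) = (nbr_vol y)%:E.
Proof.
move=> Ay; rewrite /nbr_vol /vol fineK// ge0_fin_numE//.
apply: (le_lt_trans _ leb_Rd_half_box); apply: le_measure; rewrite ?inE.
- exact: measurable_Qnbr.
- exact: measurable_half_box.
- exact: Qnbr_half_box.
Qed.

Lemma nbr_vol_le y : faces y -> nbr_vol y <= vol (half_box (32^-1 : R) : set pt).
Proof.
move=> Ay; rewrite -lee_fin -Qnbr_volE// /vol fineK ?ge0_fin_numE ?leb_Rd_half_box//.
apply: le_measure; rewrite ?inE.
- exact: measurable_Qnbr.
- exact: measurable_half_box.
- exact: Qnbr_half_box.
Qed.

Lemma Qvol_faces y : faces y -> Qvol p q y = (nbr_vol y)%:E.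
Proof.
move=> Ay; rewrite /Qvol -Qnbr_volE//; congr (mu _).
apply/seteqP; split=> z /=.
  by move=> /Qset_nbr; apply; apply/hprop_nerve.
by move=> zn; apply/Qset_nbr => //; apply/hprop_nerve.
Qed.

Definition cube w (h : R) : set pt := [set z | forall i, `|tnth w i - tnth z i| <= h].

Lemma interval_set (a h : R) : [set u : measurableTypeR R | `|a - u| <= h] = `[a - h, a + h]%classic.
Proof. by apply/seteqP; split=> u /=; rewrite in_itv/= -ler_distl distrC. Qed.

Lemma measurable_cube w h : measurable (cube w h).
Proof.
apply: (@measurable_tnth_set _ _ d (fun i => [set u : measurableTypeR R | `|tnth w i - u| <= h])).
by move=> i; rewrite interval_set.
Qed.

Lemma leb_Rd_cube w h : 0 < h -> mu (cube w h) = ((2 * h) ^+ d)%:E.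
Proof.
move=> h0; rewrite (_ : mu _ = \prod_(i < d)
    lebesgue_measure ([set u : measurableTypeR R | (`|tnth w i - u| <= h)%R]))%E; last first.
  apply: (@tuple_measure_box _ _ R lebesgue_measure d
    (fun i => [set u : measurableTypeR R | `|tnth w i - u| <= h])) => i.
  by rewrite interval_set.
rewrite (eq_bigr (fun=> (2 * h)%:E)); last first.
  move=> i _; rewrite interval_set (lebesgue_measure_itv `[_, _]) /= lte_fin.
  rewrite ifT; last by rewrite ltrBlDr -addrA ltrDl addr_gt0.
  rewrite -EFinD; congr (_%:E).
  by move: (tnth w i : R) => a; ring.
by rewrite prodEFin prodr_const card_ord.
Qed.

Lemma cube_edist w h z : cube w h z -> edist w z <= d%:R * h.
Proof. exact: pclose_edist. Qed.

Lemma ler_enorm_sum (I : Type) (s : seq I) (P : pred I) (u : I -> 'I_d -> R) :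
  enorm (fun i => \sum_(j <- s | P j) u j i) <= \sum_(j <- s | P j) enorm (u j).
Proof.
elim: s => [|j s IH].
  by rewrite big_nil (@eq_enorm _ _ _ (fun=> 0)) ?enorm0// => i; rewrite big_nil.
rewrite big_cons; case: ifPn => Pj.
  rewrite (@eq_enorm _ _ _ (fun i => u j i + \sum_(j <- s | P j) u j i)).
    by apply: le_trans (ler_enormD _ _) _; rewrite lerD2l.
  by move=> i; rewrite big_cons Pj.
by rewrite (@eq_enorm _ _ _ (fun i => \sum_(j <- s | P j) u j i)) => [|i]//;
  rewrite big_cons (negPf Pj).
Qed.

(* For the Rips complex the centroid is within [2 k / (k + 1)] of all vertices. *)
Lemma Qnbr_center (x : k.+1.-tuple pt) : nerve1 x ->
  exists w, forall z, edist z w <= k.+1%:R^-1 -> Qnbr p q x z.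
Proof.
move=> xn; have k0 : 0 < k.+1%:R :> R by [].
suff [w H] : exists w, forall z, edist z w <= k.+1%:R^-1 -> nerve1 (z :: x).
  exists w => z /H zn; exists ord0; apply: nerve_sub zn => y /mapP[j _ ->].
  have -> : z :: x = cons_tuple z x by [].
  exact: mem_tnth.
have := xn; case: p => /= pn.
  have [w Hw] := pn; exists w => z zw; apply/(@nerve1_cons _ _ Cech) => //.
  exists w => //; apply: le_trans zw _.
  by rewrite invf_le1// ler1n.
pose w : pt := [tuple k.+1%:R^-1 * \sum_(j < k.+1) tnth (tnth x j) i | i < d].
exists w => z zw; apply/(@nerve1_cons _ _ Rips) => // _ /tnthP[i ->].
apply: le_trans (edist_triangle w _ _) _.
suff h : edist (tnth x i) w <= 2 - k.+1%:R^-1 * 2.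
  move: h zw; rewrite (edistC z); have : 0 < k.+1%:R^-1 :> R by rewrite invr_gt0.
  by move: (edist _ _) (edist _ _) (k.+1%:R^-1) => a b c; lra.
rewrite /edist (@eq_enorm _ _ _ (fun l => k.+1%:R^-1 *
    \sum_(j < k.+1) (tnth (tnth x i) l - tnth (tnth x j) l))); last first.
  have avg (c : R) : k.+1%:R^-1 * (c *+ k.+1) = c.
    by rewrite -[c *+ _]mulr_natl mulrA mulVf ?mul1r// gt_eqF.
  by move=> l; rewrite tnth_mktuple sumrB sumr_const card_ord mulrBr avg.
rewrite enormZ gtr0_norm ?invr_gt0// -ler_pdivlMl ?invr_gt0// invrK.
have -> : k.+1%:R * (2 - k.+1%:R^-1 * 2) = k%:R * 2 :> R.
  by rewrite mulrBr mulrA divff ?gt_eqF// -natr1; ring.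
apply: le_trans (ler_enorm_sum _ _ _) _; rewrite (bigD1 i)//= -/(edist _ _) edistxx add0r.
apply: (@le_trans _ _ (\sum_(j < k.+1 | j != i) 2)).
  apply: ler_sum => j _; apply: (eball_pair (tnth x i) (tnth x j)).1.
  exact: pn (mem_tnth _ _) (mem_tnth _ _).
rewrite sumr_const (_ : #|_| = k) ?mulr_natl//.
transitivity #|predC1 i|; first by apply: eq_card => j; rewrite !inE.
by rewrite cardC1 card_ord.
Qed.

Lemma nbr_vol_lb : exists2 v, 0 < v & forall y, faces y -> v <= nbr_vol y.
Proof.
(* A cube of half-side h lies in the ball of radius d h <= 1/(k+1) about its centre, which is the
   radius granted by [Qnbr_center]. *)
pose h : R := (d.+1%:R * k.+1%:R)^-1.
have h0 : 0 < h by rewrite invr_gt0 mulr_gt0.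
exists ((2 * h) ^+ d); first by rewrite exprn_gt0// mulr_gt0.
move=> y Ay; have [w H] := Qnbr_center Ay.
rewrite -lee_fin -(leb_Rd_cube w h0) -Qnbr_volE//.
apply: le_measure; rewrite ?inE; [exact: measurable_cube|exact: measurable_Qnbr|].
move=> z zw; apply: H; rewrite edistC; apply: le_trans (cube_edist zw) _.
by rewrite /h invfM mulrA ler_piMl ?invr_ge0// ler_pdivrMr// mul1r ler_nat.
Qed.

End volume_bounds.

(** * Faces of nearly minimal neighbourhood volume *)

Section near_minimizers.
Context {R : realType} (d : nat) (p : complex_type) (q : connectivity).
Local Notation pt := pt[R]_d.
Local Notation mu := (leb_Rd d).
Local Notation nerver r := (nerve p (fun x : pt => eball x r)).
Implicit Types (z w : pt).

Lemma nerve_eball_le (r r' : R) (s : seq pt) : r <= r' -> nerver r s -> nerver r' s.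
Proof.
move=> rr'; have H x w : eball x r w -> eball x r' w by move=> /le_trans; apply.
case: p => /=; first by move=> [w Hw]; exists w => x /Hw/H.
by move=> Hs x y xs ys; have [w [w1 w2]] := Hs x y xs ys; exists w; split; exact: H.
Qed.

Lemma nerve_eball_limit (r : R) (s : seq pt) :
  (forall e, 0 < e -> nerver (r + e) s) -> nerver r s.
Proof.
case: p => /= H; first exact: (@cech_eball_limit _ _ _ s id).
move=> x y xs ys; have [|w Hw] := @cech_eball_limit R d _ [:: x; y] id r.
  move=> e e0; have [w [w1 w2]] := H e e0 x y xs ys.
  by exists w => z; rewrite !inE => /orP[/eqP ->|/eqP ->].
by exists w; split; apply: Hw; rewrite !inE eqxx ?orbT.
Qed.

Lemma nerve_eball_move (I : eqType) (J : seq I) (f g : I -> pt) (r e : R) :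
  (forall j, edist (f j) (g j) <= e) ->
  nerver r (map f J) -> nerver (r + e) (map g J).
Proof.
move=> fg; have H j w : eball (f j) r w -> eball (g j) (r + e) w.
  move=> fw; apply: le_trans (edist_triangle (f j) _ _) _.
  by rewrite [leRHS]addrC lerD// edistC.
case: p => /= [[w Hw]|Hs].
  by exists w => _ /mapP[j jJ ->]; apply: H; apply: Hw; exact: map_f.
move=> _ _ /mapP[i iJ ->] /mapP[j jJ ->].
have [w [w1 w2]] := Hs _ _ (map_f f iJ) (map_f f jJ).
by exists w; split; exact: H.
Qed.

Definition scale_pt (c : R) (x : pt) : pt := [tuple c * tnth x i | i < d].

Lemma edist_scale c x y : 0 <= c -> edist (scale_pt c x) (scale_pt c y) = c * edist x y.
Proof.
move=> c0; rewrite -[in RHS](ger0_norm c0) -enormZ; apply: eq_enorm => i.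
by rewrite !tnth_mktuple mulrBr.
Qed.

Lemma scale_origin c : scale_pt c (origin d) = origin d.
Proof. by apply: eq_from_tnth => i; rewrite !tnth_mktuple mulr0. Qed.

Lemma edist_scale_self c x : 0 <= c <= 1 ->
  edist (scale_pt c x) x = (1 - c) * edist x (origin d).
Proof.
move=> /andP[c0 c1]; rewrite edistC; have c10 : 0 <= 1 - c by rewrite subr_ge0.
rewrite -(ger0_norm c10) -enormZ; apply: eq_enorm => i.
by rewrite !tnth_mktuple subr0 mulrBl mul1r.
Qed.

Lemma nerve_scale c (s : seq pt) : 0 <= c -> nerver 1 s ->
  nerver c (map (scale_pt c) s).
Proof.
move=> c0; have H x w : eball x 1 w -> eball (scale_pt c x) c (scale_pt c w).
  move=> xw; change (edist (scale_pt c x) (scale_pt c w) <= c).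
  by rewrite edist_scale//; apply: ler_piMr.
case: p => /= [[w Hw]|Hs].
  by exists (scale_pt c w) => _ /mapP[x xs ->]; apply: H; exact: Hw.
move=> _ _ /mapP[x xs ->] /mapP[y ys ->].
by have [w [w1 w2]] := Hs x y xs ys; exists (scale_pt c w); split; exact: H.
Qed.

Variable k : nat.
Hypothesis k1 : (1 <= k)%N.
Local Notation faces := (@faces R d k p).
Local Notation nbr_vol := (@nbr_vol R d k p q).
Implicit Types (y : k.-tuple pt).

(** The shrunk face is already a simplex for radius c; the slack 1 - c pays for moving its
    vertices. *)
Lemma face_move y y' c : 0 <= c <= 1 -> faces y ->
  (forall j, edist (scale_pt c (tnth y j)) (tnth y' j) <= 1 - c) -> faces y'.
Proof.
move=> /andP[c0 c1] Fy yy'; have := nerve_scale c0 Fy.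
have -> : map (scale_pt c) (cons_tuple (origin d) y) =
    map (fun j => tnth (map_tuple (scale_pt c) (cons_tuple (origin d) y)) j) (enum 'I_k.+1).
  by rewrite map_tnth_enum.
move=> /(@nerve_eball_move _ _ _ (fun j => tnth (cons_tuple (origin d) y') j) c (1 - c)).
rewrite (_ : c + (1 - c) = 1) ?map_tnth_enum; last by rewrite addrC subrK.
apply=> j.
rewrite tnth_map; case: (unliftP ord0 j) => [i ->|->]; first by rewrite !tnthS.
by rewrite !tnth0 scale_origin edistxx subr_ge0.
Qed.

Lemma face_norm y j : faces y -> edist (tnth y j) (origin d) <= 2.
Proof.
move=> Fy; apply: (eball_pair _ _).1; apply: (nerve_pair Fy).
  by rewrite inE mem_tnth orbT.
exact: mem_head.
Qed.

Definition Qwide (e : R) y : set pt := [set z |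
  nbr_tuples p q (fun x : pt => eball x (1 + e)) (cons_tuple z (cons_tuple (origin d) y))].

(** Vertices have norm at most 2, so shrinking moves them by at most 2 (1 - c), and the perturbation
    adds 1 - c; this gives the factor 3. *)
Lemma Qnbr_move y y' c : 0 <= c <= 1 -> faces y ->
  (forall j, edist (scale_pt c (tnth y j)) (tnth y' j) <= 1 - c) ->
  Qnbr p q (cons_tuple (origin d) y') `<=` Qwide (3 * (1 - c)) y.
Proof.
move=> c01 Fy yy' z [i zn]; exists i; apply: nerve_eball_move zn => j.
have c10 : 0 <= 1 - c by rewrite subr_ge0; case/andP: c01.
have c30 : 0 <= 3 * (1 - c) by rewrite mulr_ge0.
case: (unliftP ord0 j) => [j' ->|->]; last by rewrite !tnth0 edistxx.
rewrite !tnthS; case: (unliftP ord0 j') => [l ->|->]; last by rewrite !tnth0 edistxx.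
rewrite !tnthS; apply: le_trans (edist_triangle (scale_pt c (tnth y l)) _ _) _.
rewrite edist_scale_self// edistC.
have h : (1 - c) * edist (tnth y l) (origin d) <= (1 - c) * 2.
  by rewrite ler_wpM2l// face_norm.
have := yy' l; move: h; move: (edist (scale_pt _ _) _) (_ * edist _ _) => a b.
lra.
Qed.

Lemma measurable_Qwide e y : measurable (Qwide e y).
Proof.
exact: (measurable_preimageT (measurable_cons_point (cons_tuple (origin d) y))
  (measurable_pclosed (@nbr_tuples_eball_pclosed R d p q (1 + e) k))).
Qed.

Lemma Qwide_half_box y : faces y -> Qwide 1 y `<=` half_box 32^-1.
Proof.
move=> Fy z [i zn]; have [j i0 ij] := nbr_index_other q k1 i.
have r0 : 0 < (32^-1 : R) by rewrite invr_gt0.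
pose T := cons_tuple z (cons_tuple (origin d) y).
have zn' := map_f (tnth T) i0; have jn := map_f (tnth T) ij.
rewrite tnth0 in zn'; rewrite tnthS in jn.
have jy : near_origin 32^-1 (0 + 2 * 32^-1) (tnth (cons_tuple (origin d) y) j).
  apply: (nerve1_near r0 Fy _ _ (@near_origin0 R d 32^-1)); rewrite ?mem_head//.
  exact: mem_tnth.
have [w [jw zw]] := nerve_pair zn jn zn'.
have := near_origin_eball r0 (near_origin_eball r0 jy jw) (eballC zw).
by apply: near_origin_box; lra.
Qed.

(** The index i witnessing membership may change with n. There are finitely many, and if each failed
    at radius 1 then, by closedness, all would fail together for large n. *)
Lemma Qwide_bigcap y :
  \bigcap_n Qwide n.+1%:R^-1 y = Qnbr p q (cons_tuple (origin d) y).
Proof.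
apply/seteqP; split=> z; last first.
  move=> [i zn] n _; exists i; apply: nerve_eball_le zn.
  by rewrite lerDl invr_ge0.
move=> H; apply: contrapT => /forallNP zn.
have Hi (i : 'I_k.+1) : \forall n \near \oo, ~ nerver (1 + n.+1%:R^-1)
    [seq tnth (cons_tuple z (cons_tuple (origin d) y)) j | j <- nbr_index q i].
  have /existsNP[e /not_implyP[e0 en]] : ~ forall e, 0 < e -> nerver (1 + e)
      [seq tnth (cons_tuple z (cons_tuple (origin d) y)) j | j <- nbr_index q i].
    by move=> /nerve_eball_limit; exact: zn.
  near=> n => nn; apply: en; apply: nerve_eball_le nn; rewrite lerD2l.
  by apply: ltW; near: n; exact: (near_infty_natSinv_lt (PosNum e0)).
have HN : \forall n \near \oo, forall i : 'I_k.+1, ~ nerver (1 + n.+1%:R^-1)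
    [seq tnth (cons_tuple z (cons_tuple (origin d) y)) j | j <- nbr_index q i].
  exact: filter_forall.
have [N _ /(_ N (leqnn N)) HNN] := HN.
by have [i zi] := H N I; exact: (HNN i zi).
Unshelve. all: by end_near. Qed.

(** Continuity of the measure from above; finiteness comes from the enclosure of [Qwide 1 y] in a
    bounded box. *)
Lemma Qwide_vol_near y e : faces y -> 0 < e ->
  exists2 t, 0 < t & (mu (Qwide t y) < (nbr_vol y + e)%:E)%E.
Proof.
move=> Fy e0.
have cv : mu (Qwide n.+1%:R^-1 y) @[n --> \oo] --> mu (\bigcap_n Qwide n.+1%:R^-1 y).
  apply: (@nonincreasing_cvg_mu _ _ _ mu (fun n => Qwide n.+1%:R^-1 y)).
  - rewrite invr1; apply: (le_lt_trans _ (@leb_Rd_half_box R d)).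
    apply: le_measure; rewrite ?inE; [exact: measurable_Qwide|exact: measurable_half_box|].
    exact: Qwide_half_box.
  - by move=> n; exact: measurable_Qwide.
  - by apply: bigcapT_measurable => n; exact: measurable_Qwide.
  - move=> n m nm; apply/subsetPset => z [i zn]; exists i; apply: nerve_eball_le zn.
    by rewrite lerD2l lef_pV2 ?posrE// ler_nat.
rewrite Qwide_bigcap Qnbr_volE// in cv.
have : \forall n \near \oo, (mu (Qwide n.+1%:R^-1 y) < (nbr_vol y + e)%:E)%E.
  move/fine_cvgP : cv => [fin cvf].
  have lt : \forall n \near \oo, fine (mu (Qwide n.+1%:R^-1 y)) < nbr_vol y + e.
    by apply: (cvgr_lt _ cvf); rewrite ltrDl.
  by apply: filterS2 fin lt => n fn; rewrite -lte_fin fineK.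
by case=> n _ /(_ n (leqnn n)) H; exists n.+1%:R^-1; rewrite ?invr_gt0.
Qed.

(* After shrinking a face by a factor c < 1, every vertex can be moved by 1 - c; the
   volume of [Qnbr] grows little since it is upper semicontinuous in the face. *)
Lemma near_minimizers_pos y e : faces y -> 0 < e ->
  (0 < leb_pow d k (faces `&` [set y' | (nbr_vol y' <= nbr_vol y + e)%R]))%E.
Proof.
move=> Fy e0; have [t t0 Ht] := Qwide_vol_near Fy e0.
(* The 3 matches the enlargement in [Qnbr_move]; the cap at 1 keeps c = 1 - eta nonnegative. *)
pose eta := Num.min (t / 3) 1.
have eta0 : 0 < eta by rewrite lt_min ltr01 divr_gt0.
have eta1 : eta <= 1 by rewrite ge_min lexx orbT.
have etat : 3 * eta <= t by rewrite mulrC -ler_pdivlMr// ge_min lexx.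
pose c := 1 - eta.
have c01 : 0 <= c <= 1 by rewrite subr_ge0 eta1 gerBl ltW.
have cE : 1 - c = eta by rewrite opprB addrC subrK.
pose hh := eta / d.+1%:R.
have h0 : 0 < hh by rewrite divr_gt0.
pose box : set (k.-tuple pt) := [set y' | forall j, cube (scale_pt c (tnth y j)) hh (tnth y' j)].
have mbox : measurable box.
  apply: (@measurable_tnth_set _ _ k (fun j => cube (scale_pt c (tnth y j)) hh)) => j.
  exact: measurable_cube.
have boxP y' : box y' -> forall j, edist (scale_pt c (tnth y j)) (tnth y' j) <= 1 - c.
  move=> by' j; apply: le_trans (cube_edist (by' j)) _.
  by rewrite cE /hh mulrCA ler_piMr ?(ltW eta0)// ler_pdivrMr// mul1r ler_nat.
apply: (@lt_le_trans _ _ (leb_pow d k box)).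
  rewrite (_ : leb_pow d k box = \prod_(j < k) mu (cube (scale_pt c (tnth y j)) hh))%E; last first.
    apply: (@tuple_measure_box _ _ R mu k (fun j => cube (scale_pt c (tnth y j)) hh)) => j.
    exact: measurable_cube.
  rewrite (eq_bigr (fun=> ((2 * hh) ^+ d)%:E)); last by move=> j _; rewrite leb_Rd_cube.
  by rewrite prodEFin prodr_const lte_fin !exprn_gt0// mulr_gt0.
apply: le_measure; rewrite ?inE//.
  apply: measurableI; first exact: measurable_facesE.
  have := @measurable_vol_Qnbr R d p q k measurableT _ (@measurable_itv R `]-oo, nbr_vol y + e]).
  rewrite setTI; congr measurable; apply/seteqP; split=> y' /=; rewrite in_itv//.
move=> y' by'; have Fy' := face_move c01 Fy (boxP y' by'); split=> //=.
rewrite -lee_fin -Qnbr_volE//; apply: le_trans (ltW Ht).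
apply: le_measure; rewrite ?inE; [exact: measurable_Qnbr|exact: measurable_Qwide|].
move=> z /(Qnbr_move c01 Fy (boxP y' by'))[i zn]; exists i; apply: nerve_eball_le zn.
by rewrite lerD2l cE.
Qed.

End near_minimizers.

(** * Choice of the critical sequence *)

Section critical_sequence.
Context {R : realType}.

(** Apply ln (1 + x) <= x at x = (e / 2) y - 1; the remaining (e / 2) y absorbs the constant ln (e /
    2). *)
Lemma ln_le_linear (e : R) : 0 < e -> \forall y \near +oo, ln y <= e * y.
Proof.
move=> e0; have e20 : 0 < e / 2 by rewrite divr_gt0.
near=> y; have y0 : 0 < y by near: y; exact: nbhs_pinfty_gt.
have h : ln (e / 2 * y) <= e / 2 * y - 1.
  have := @le_ln1Dx R (e / 2 * y - 1).
  have -> : 1 + (e / 2 * y - 1) = e / 2 * y by ring.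
  apply.
  by rewrite ltrBrDl subrr mulr_gt0.
rewrite lnM ?posrE// in h.
have : - ln (e / 2) / (e / 2) <= y.
  by near: y; apply: nbhs_pinfty_ge; exact: num_real.
rewrite ler_pdivrMr// => h2; move: h h2.
have -> : e * y = e / 2 * y + y * (e / 2) by field.
by move: (ln (e / 2)) (ln y) (e / 2 * y) (y * (e / 2)) => a b c f; lra.
Unshelve. all: by end_near. Qed.

Lemma cvg_ln_natr : ln (n%:R : R) @[n --> \oo] --> +oo.
Proof.
apply/cvgryPge => A; near=> n.
have An : expR A <= n%:R by near: n; exact: nbhs_infty_ger.
by rewrite -[A]expRK ler_ln ?posrE ?expR_gt0// (lt_le_trans _ An) ?expR_gt0.
Unshelve. all: by end_near. Qed.

Lemma cvg_exprn T (F : set_system T) (FF : Filter F) (f : T -> R) (a : R) k :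
  f x @[x --> F] --> a -> f x ^+ k @[x --> F] --> a ^+ k.
Proof.
move=> fa; elim: k => [|k IH]; first by rewrite expr0; exact: cvg_cst.
under eq_fun do rewrite exprS.
by rewrite exprS; exact: cvgM.
Qed.

(** Taking c_n within 1/(n+1) of the infimum of the admissible values gives convergence to m for
    every e at once, without a diagonal choice of thresholds. *)
Lemma near_minimal_selection (P : nat -> R -> Prop) (m M : R) : m <= M ->
  (forall e, 0 < e -> \forall n \near \oo, exists2 c, m <= c <= m + e & c <= M /\ P n c) ->
  exists c : nat -> R, [/\ forall n, m <= c n <= M, c @ \oo --> m &
    \forall n \near \oo, P n (c n)].
Proof.
move=> mM H; pose S n := [set c | m <= c <= M /\ P n c].
have Sm n : has_lbound (S n) by exists m => c [/andP[]].
have /choice[c hc] : forall n, exists c, m <= c <= M /\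
    (S n !=set0 -> S n c /\ c < inf (S n) + n.+1%:R^-1).
  move=> n; have [S0|S0] := pselect (S n !=set0).
    have n0 : 0 < n.+1%:R^-1 :> R by rewrite invr_gt0.
    have [c Sc cn] := inf_adherent n0 (conj S0 (Sm n)).
    by exists c; split=> //; case: Sc.
  (* With no admissible value at this n, m is a default inside [m, M]; this happens for finitely
     many n only. *)
  by exists m; rewrite lexx mM.
exists c; split; first by move=> n; case: (hc n).
  apply/cvgrPdist_le => e e0; have e20 : 0 < e / 2 by rewrite divr_gt0.
  near=> n; have [/andP[mc cM] hS] := hc n.
  have [c' /andP[mc' c'e] [c'M Pc']] : exists2 c, m <= c <= m + e / 2 & c <= M /\ P n c.
    by near: n; exact: H.
  have Sc' : S n c' by split=> //; rewrite mc'.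
  have [|_ cn] := hS; first by exists c'.
  have ic' : inf (S n) <= c' by exact: ge_inf.
  have ne : n.+1%:R^-1 < e / 2 by near: n; exact: (near_infty_natSinv_lt (PosNum e20)).
  rewrite distrC ger0_norm ?subr_ge0//.
  by move: ne cn ic' c'e; move: (inf _) (n.+1%:R^-1) => a b; lra.
have := H 1 ltr01; apply: filterS => n [c' /andP[mc' _] [c'M Pc']].
have [_ hS] := hc n.
by have [|[]//] := hS; exists c'; split=> //; rewrite mc'.
Unshelve. all: by end_near. Qed.

(** [J] stands for the Laplace integral and [V] for |A_k|; the choice of c_n uses only the bounds
    listed below. *)
Variables (k : nat) (al m M V C : R) (J : R -> R).
Hypotheses (m0 : 0 < m) (mM : m <= M) (V0 : 0 < V).
Hypothesis J_ub : forall s, 0 <= s -> J s <= V * expR (- (s * m)).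
Hypothesis J_lb : forall s, 0 <= s -> V * expR (- (s * M)) <= J s.
Hypothesis J_lb_near : forall b, m < b ->
  exists2 v, 0 < v & forall s, 0 <= s -> v * expR (- (s * b)) <= J s.
Hypothesis J_lip : forall s t, 0 <= s -> 0 <= t -> `|J s - J t| <= C * `|s - t|.

Definition crit_num (n : nat) : R :=
  ln n%:R + k%:R * ln (ln n%:R) + ln V + al - k%:R * ln m - ln (k.+1)`!%:R.

Definition crit_mean (n : nat) (c : R) : R :=
  n%:R / (k.+1)`!%:R * (crit_num n / c) ^+ k * J (crit_num n / c).

Local Notation l n := (ln (n%:R : R)).

Lemma crit_num_equiv (e : R) : 0 < e ->
  \forall n \near \oo, `|crit_num n - l n| <= e * l n.
Proof.
move=> e0; pose K := ln V + al - k%:R * ln m - ln (k.+1)`!%:R.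
(* Half of e pays for k log log n and the other half for the constant K; k + 1 in place of k allows
   k = 0. *)
have e'0 : 0 < e / (2 * k.+1%:R) by rewrite divr_gt0// mulr_gt0.
near=> n.
have l1 : 1 <= l n by near: n; apply: (cvgryPge _).1; exact: cvg_ln_natr.
have lK : `|K| / (e / 2) <= l n.
  by near: n; apply: (cvgryPge _).1; exact: cvg_ln_natr.
have ll : ln (l n) <= e / (2 * k.+1%:R) * l n.
  by near: n; exact: (cvg_ln_natr (ln_le_linear e'0)).
have ll0 : 0 <= ln (l n) by rewrite ln_ge0.
rewrite ler_pdivrMr ?divr_gt0// in lK.
have -> : crit_num n - l n = k%:R * ln (l n) + K by rewrite /crit_num /K; ring.
apply: le_trans (ler_normD _ _) _; rewrite ger0_norm ?mulr_ge0//.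
have h : k%:R * ln (l n) <= k.+1%:R * (e / (2 * k.+1%:R) * l n).
  by apply: ler_pM => //; rewrite ler_nat.
have e2 : k.+1%:R * (e / (2 * k.+1%:R) * l n) = e / 2 * l n.
  have : k.+1%:R != 0 :> R by rewrite pnatr_eq0.
  by move: (k.+1%:R) (l n) => a b a0; field.
rewrite e2 in h; move: h lK; move: (l n) (_ * ln _) `|K| => a b c.
by lra.
Unshelve. all: by end_near. Qed.

Lemma crit_num_ge (A : R) : \forall n \near \oo, A <= crit_num n.
Proof.
near=> n.
have h : `|crit_num n - l n| <= 2^-1 * l n.
  by near: n; apply: crit_num_equiv; rewrite invr_gt0.
have l1 : 2 * A <= l n by near: n; apply: (cvgryPge _).1; exact: cvg_ln_natr.
by move: h l1; rewrite ler_norml => /andP[]; move: (l n) => a; lra.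
Unshelve. all: by end_near. Qed.

Lemma crit_num_le_linear (e : R) : 0 < e -> \forall n \near \oo, crit_num n <= e * n%:R.
Proof.
move=> e0; have e20 : 0 < e / 2 by rewrite divr_gt0.
near=> n.
have h : `|crit_num n - l n| <= 1 * l n by near: n; apply: crit_num_equiv.
have ln2 : l n <= e / 2 * n%:R.
  by near: n; exact: (cvgr_idn (ln_le_linear e20)).
by move: h ln2; rewrite ler_norml => /andP[]; move: (l n) (n%:R) => a b; lra.
Unshelve. all: by end_near. Qed.

Lemma expR_crit_num n : 0 < l n ->
  expR (- crit_num n) = (n%:R * l n ^+ k * V)^-1 * expR (- al) * (m ^+ k * (k.+1)`!%:R).
Proof.
move=> l0; have n0 : 0 < n%:R :> R.
  by rewrite lt_neqAle ler0n andbT; apply: contraTneq l0 => <-; rewrite ln0// ltxx.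
have f0 : 0 < (k.+1)`!%:R :> R by rewrite ltr0n fact_gt0.
have -> : - crit_num n = - (l n + k%:R * ln (l n) + ln V) + (- al) +
    (k%:R * ln m + ln (k.+1)`!%:R).
  rewrite /crit_num; move: (ln (k.+1)`!%:R) (ln (l n)) (l n) => a b c; ring.
rewrite !expRD expRN !expRD !expRM_natl !lnK ?posrE//.
Qed.

(** What the upper bound on [J] gives for the mean at c = m, once exp (- L_n) has cancelled every
    constant. *)
Definition crit_bound n : R := expR (- al) * (crit_num n / l n) ^+ k.

Lemma crit_bound_cvg : crit_bound n @[n --> \oo] --> expR (- al).
Proof.
suff : crit_bound n @[n --> \oo] --> expR (- al) * 1 ^+ k by rewrite expr1n mulr1.
apply: cvgMl_tmp; apply: cvg_exprn.
apply/cvgrPdist_le => e e0; near=> n.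
have h : `|crit_num n - l n| <= e * l n by near: n; exact: crit_num_equiv.
have l1 : 1 <= l n by near: n; apply: (cvgryPge _).1; exact: cvg_ln_natr.
have l0 : 0 < l n by apply: lt_le_trans l1.
have -> : 1 - crit_num n / l n = - ((crit_num n - l n) / l n) by field; rewrite gt_eqF.
by rewrite normrN normrM [X in _ * X]gtr0_norm ?invr_gt0// ler_pdivrMr.
Unshelve. all: by end_near. Qed.

Lemma crit_mean_min_le n : 0 < l n -> 0 <= crit_num n -> crit_mean n m <= crit_bound n.
Proof.
move=> l0 L0; have n0 : 0 < n%:R :> R.
  by rewrite lt_neqAle ler0n andbT; apply: contraTneq l0 => <-; rewrite ln0// ltxx.
have f0 : 0 < (k.+1)`!%:R :> R by rewrite ltr0n fact_gt0.
have L0m : 0 <= crit_num n / m by rewrite divr_ge0// ltW.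
have c0 : 0 <= n%:R / (k.+1)`!%:R * (crit_num n / m) ^+ k.
  by rewrite mulr_ge0 ?exprn_ge0// divr_ge0// ltW.
apply: le_trans (ler_wpM2l c0 (J_ub L0m)) _.
rewrite divfK ?gt_eqF// expR_crit_num// /crit_bound !expr_div_n.
rewrite le_eqVlt; apply/orP; left; apply/eqP; field.
by rewrite !expf_neq0 ?gt_eqF.
Qed.

(** When m = M the two exponential bounds on [J] coincide, so the mean at m equals
    [crit_bound n]. *)
Lemma crit_mean_min_ge n : m = M -> 0 < l n -> 0 <= crit_num n ->
  crit_bound n <= crit_mean n m.
Proof.
move=> mME l0 L0; have n0 : 0 < n%:R :> R.
  by rewrite lt_neqAle ler0n andbT; apply: contraTneq l0 => <-; rewrite ln0// ltxx.
have f0 : 0 < (k.+1)`!%:R :> R by rewrite ltr0n fact_gt0.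
have L0m : 0 <= crit_num n / m by rewrite divr_ge0// ltW.
have c0 : 0 <= n%:R / (k.+1)`!%:R * (crit_num n / m) ^+ k.
  by rewrite mulr_ge0 ?exprn_ge0// divr_ge0// ltW.
apply: le_trans _ (ler_wpM2l c0 (J_lb L0m)).
rewrite -mME divfK ?gt_eqF// expR_crit_num// /crit_bound !expr_div_n.
rewrite le_eqVlt; apply/orP; left; apply/eqP; field.
by rewrite !expf_neq0 ?gt_eqF.
Qed.

(* With [b = m + e / 2] and [c = m + e], the mean is at least of order
   [n * exp (- L b / c)], a positive power of [n] since [L ~ log n]. *)
Lemma crit_mean_far_ge e : 0 < e ->
  \forall n \near \oo, expR (- al) <= crit_mean n (m + e).
Proof.
move=> e0; have e20 : 0 < e / 2 by rewrite divr_gt0.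
have me : m < m + e / 2 by rewrite ltrDl.
have [v v0 Jv] := J_lb_near me.
pose c := m + e; have c0 : 0 < c by rewrite addr_gt0.
pose th := (m + e / 2) / c.
have th1 : 0 < 1 - th.
  rewrite subr_gt0 ltr_pdivrMr// mul1r /c; move: e0; lra.
have th0 : 0 < th by rewrite divr_gt0// addr_gt0.
have f0 : 0 < (k.+1)`!%:R :> R by rewrite ltr0n fact_gt0.
have vf : 0 < v / (k.+1)`!%:R by rewrite divr_gt0.
near=> n.
have l1 : 1 <= l n by near: n; apply: (cvgryPge _).1; exact: cvg_ln_natr.
have l0 : 0 < l n by apply: lt_le_trans l1.
have n0 : 0 < n%:R :> R.
  by rewrite lt_neqAle ler0n andbT; apply: contraTneq l0 => <-; rewrite ln0// ltxx.
have Lc : c <= crit_num n by near: n; exact: crit_num_ge.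
(* This precision, with th < 1, leaves log n - th L_n >= ((1 - th) / 2) log n, so the exponential
   beats any constant. *)
have h : `|crit_num n - l n| <= (1 - th) / 2 * l n.
  by near: n; apply: crit_num_equiv; rewrite divr_gt0.
have ll : (- al - ln (v / (k.+1)`!%:R)) / ((1 - th) / 2) <= l n.
  by near: n; apply: (cvgryPge _).1; exact: cvg_ln_natr.
have Lc1 : 1 <= crit_num n / c by rewrite ler_pdivlMr// mul1r.
have Lc0 : 0 <= crit_num n / c by apply: le_trans Lc1.
have b1 : v * expR (- (th * crit_num n)) <= J (crit_num n / c).
  apply: le_trans _ (Jv _ Lc0).
  by rewrite (_ : th * crit_num n = crit_num n / c * (m + e / 2))// /th; ring.
have b2 : 1 <= (crit_num n / c) ^+ k by exact: exprn_ege1.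
have b3 : expR (- al) <= v / (k.+1)`!%:R * expR (l n - th * crit_num n).
  rewrite -[X in X * _]lnK ?posrE// -expRD ler_expR.
  rewrite ler_pdivrMr ?divr_gt0// in ll.
  have thL : th * (crit_num n - l n) <= (1 - th) / 2 * l n.
    apply: le_trans h; apply: le_trans (ler_norm _) _.
    rewrite normrM (gtr0_norm th0) ler_piMl//.
    by rewrite -subr_ge0 ltW.
  rewrite mulrBr in thL; move: ll thL.
  have -> : (1 - th) / 2 * l n = 2^-1 * l n - 2^-1 * (th * l n) by field.
  have -> : l n * ((1 - th) / 2) = 2^-1 * l n - 2^-1 * (th * l n) by field.
  by move: (th * crit_num n) (th * l n) (l n) (ln (v / _)) => x1 x2 x3 x4; lra.
apply: le_trans b3 _; rewrite expRD lnK ?posrE// expRN.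
rewrite /crit_mean -/c (_ : v / _ * _ = n%:R / (k.+1)`!%:R * (v * (expR (th * crit_num n))^-1)); last first.
  by field; rewrite !gt_eqF ?expR_gt0.
rewrite -expRN -[leRHS]mulrA; apply: ler_wpM2l; first by rewrite divr_ge0// ltW.
apply: (le_trans b1); rewrite ler_peMl//; apply: le_trans b1.
by rewrite mulr_ge0 ?expR_ge0// ltW.
Unshelve. all: by end_near. Qed.

Lemma crit_mean_ivt n a b : 0 < a -> a <= b -> 0 < crit_num n ->
  crit_mean n a <= expR (- al) <= crit_mean n b ->
  exists2 c, a <= c <= b & crit_mean n c = expR (- al).
Proof.
move=> a0 ab L0 /andP[h1 h2].
have [||c] := @IVT R (crit_mean n) a b (expR (- al)) ab.
- apply: continuous_in_subspaceT => c /set_mem /=; rewrite in_itv/= => /andP[ac cb].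
  have c0 : 0 < c by apply: lt_le_trans ac.
  have inv : crit_num n / x @[x --> c] --> crit_num n / c.
    by apply: cvgMl_tmp; apply: cvgV => //; rewrite gt_eqF.
  rewrite /crit_mean; apply: cvgM.
    by apply: cvgMl_tmp; apply: cvg_exprn.
  apply: (@continuous_cvg _ _ _ _ _ _ J) inv.
  pose s := crit_num n / c; have s0 : 0 < s by rewrite divr_gt0.
  apply/cvgrPdist_le => e e0; near=> t.
  have t0 : 0 <= t.
    by apply: ltW; near: t; apply: (cvgr_gt s) => //; exact: cvg_id.
  apply: le_trans (J_lip (ltW s0) t0) _.
  have C1 : 0 < `|C| + 1 by rewrite ltr_wpDl.
  have st : `|s - t| <= e / (`|C| + 1).
    by near: t; apply: cvgr_dist_le; rewrite ?divr_gt0//; exact: cvg_id.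
  apply: (@le_trans _ _ ((`|C| + 1) * `|s - t|)).
    by rewrite ler_wpM2r// (le_trans (ler_norm C))// lerDl.
  by rewrite mulrC -ler_pdivlMr.
- by rewrite ge_min h1 le_max h2 orbT.
by rewrite in_itv => /= acb cE; exists c.
Unshelve. all: by end_near. Qed.

Lemma crit_sequence : exists c : nat -> R,
  [/\ forall n, m <= c n <= M, c @ \oo --> m &
      crit_mean n (c n) @[n --> \oo] --> expR (- al)].
Proof.
(* One criterion covers all cases: equality when m = M, a mean at m between exp (- alpha) and
   [crit_bound n], and an exact solution from the intermediate value theorem. *)
pose P n c := `|crit_mean n c - expR (- al)| <= `|crit_bound n - expR (- al)|.
have [e e0|c [cb cm Pc]] := @near_minimal_selection P m M mM.
  have [mME|/eqP mnM] := pselect (m = M).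
    near=> n; exists m; first by rewrite lexx lerDl ltW.
    split=> //; rewrite /P.
    have L0 : 0 <= crit_num n by near: n; exact: crit_num_ge.
    have l0 : 0 < l n by near: n; apply: (cvgryPgt _).1; exact: cvg_ln_natr.
    suff -> : crit_mean n m = crit_bound n by [].
    by apply/eqP; rewrite eq_le crit_mean_min_le// crit_mean_min_ge.
  have mltM : 0 < M - m by rewrite subr_gt0 lt_neqAle mnM.
  (* Cut off at M - m so that m + e' stays in [m, M]. *)
  pose e' := Num.min e (M - m).
  have e'0 : 0 < e' by rewrite lt_min e0.
  have e'e : e' <= e by rewrite ge_min lexx.
  have e'M : m + e' <= M by rewrite -lerBrDl ge_min lexx orbT.
  near=> n.
  have L0 : 0 < crit_num n.
    by apply: (@lt_le_trans _ _ 1) => //; near: n; exact: crit_num_ge.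
  have l0 : 0 < l n by near: n; apply: (cvgryPgt _).1; exact: cvg_ln_natr.
  have far : expR (- al) <= crit_mean n (m + e') by near: n; exact: crit_mean_far_ge.
  have near_le := crit_mean_min_le l0 (ltW L0).
  have [h|h] := leP (expR (- al)) (crit_mean n m).
    exists m; first by rewrite lexx lerDl ltW.
    split=> //; rewrite /P !ger0_norm ?subr_ge0// ?lerD2r//.
    exact: le_trans near_le.
  have [||c /andP[mc cme] cE] := @crit_mean_ivt n m (m + e') m0 _ L0.
  - by rewrite lerDl ltW.
  - by rewrite (ltW h) far.
  exists c; first by rewrite mc (le_trans cme)// lerD2l.
  by split; [exact: le_trans cme e'M|rewrite /P cE subrr normr0].
exists c; split=> //; apply/cvgrPdist_le => e e0.
have /cvgrPdist_le/(_ e e0) := crit_bound_cvg.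
apply: filterS2 Pc => n Pn; rewrite distrC => /(le_trans Pn).
by rewrite distrC.
Unshelve. all: by end_near. Qed.

End critical_sequence.

(** * The Laplace integral and its bounds *)

Section laplace.
Context {R : realType} (d k : nat) (p : complex_type) (q : connectivity).
Hypothesis k1 : (1 <= k)%N.
Local Notation pt := pt[R]_d.
Local Notation leb := (leb_pow d k).
Local Notation faces := (@faces R d k p).
Local Notation nbr_vol := (@nbr_vol R d k p q).
Local Notation m := (@minQ R d k p q).
Local Notation M := (@maxQ R d k p q).
Local Notation V := (@Avol R d k p).

Lemma leb_faces : leb faces = (V : R)%:E.
Proof.
by rewrite /Avol Aset_faces fineK// ge0_fin_numE// leb_faces_lty.
Qed.

Lemma faces_neq0 : faces !=set0.
Proof.
(* A_k does not require distinct points, so the tuple with all vertices at the origin belongs to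
   it. *)
exists [tuple origin d | i < k]; have E z : z \in cons_tuple (origin d) [tuple origin d | i < k] ->
    z = origin d :> pt.
  by rewrite inE => /orP[/eqP//|/tnthP[j ->]]; rewrite tnth_mktuple.
rewrite /faces /=; case: p => /=.
  by exists (origin d) => z /E ->; exact: eball_self.
by move=> z w /E -> /E ->; exists (origin d); split; exact: eball_self.
Qed.

Let S : set R := [set nbr_vol y | y in faces].

Let SE : [set Qvol p q y | y in @Aset R d k p] = [set r%:E | r in S].
Proof.
rewrite Aset_faces; apply/seteqP; split=> [_ [y Fy <-]|_ [_ [y Fy <-] <-]].
  by exists (nbr_vol y); [exists y|rewrite Qvol_faces].
by exists y => //; rewrite Qvol_faces.
Qed.

Let S0 : S !=set0.
Proof. by have [y Fy] := faces_neq0; exists (nbr_vol y), y. Qed.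

Let Sub : has_ubound S.
Proof.
by exists (vol (half_box (32^-1 : R) : set pt)) => _ [y Fy <-]; exact: nbr_vol_le.
Qed.

Let Slb : has_lbound S.
Proof. by exists 0 => _ [y Fy <-]; exact: vol_ge0. Qed.

Lemma minQE : m = inf S.
Proof. by rewrite /minQ SE ereal_inf_EFin. Qed.

Lemma maxQE : M = sup S.
Proof. by rewrite /maxQ SE ereal_sup_EFin. Qed.

Lemma minQ_le y : faces y -> m <= nbr_vol y.
Proof. by move=> Fy; rewrite minQE; apply: ge_inf => //; exists y. Qed.

Lemma le_maxQ y : faces y -> nbr_vol y <= M.
Proof. by move=> Fy; rewrite maxQE; apply: ub_le_sup => //; exists y. Qed.

Lemma minQ_le_maxQ : m <= M.
Proof.
by have [y Fy] := faces_neq0; exact: le_trans (minQ_le Fy) (le_maxQ Fy).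
Qed.

Lemma minQ_gt0 : 0 < (m : R).
Proof.
have [v v0 H] := @nbr_vol_lb R d k p q k1; apply: (lt_le_trans v0).
by rewrite minQE; apply: lb_le_inf => // _ [y Fy <-]; exact: H.
Qed.

Let measurable_nbr_vol_le (b : R) : measurable (faces `&` [set y | nbr_vol y <= b]).
Proof.
apply: measurableI; first exact: measurable_facesE.
have := @measurable_vol_Qnbr R d p q k measurableT _ (@measurable_itv R `]-oo, b]).
by rewrite setTI; congr measurable; apply/seteqP; split=> y' /=; rewrite in_itv.
Qed.

(** Half of b - m goes into choosing an almost minimal face, the other half into varying that
    face. *)
Lemma near_minQ b : m < b ->
  (0 < leb (faces `&` [set y | (nbr_vol y <= b)%R]))%E.
Proof.
move=> mb; have e0 : 0 < (b - m) / 2 by rewrite divr_gt0// subr_gt0.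
have [_ [y Fy <-]] := inf_adherent e0 (conj S0 Slb); rewrite -minQE => ym.
have := near_minimizers_pos q k1 Fy e0 => /lt_le_trans; apply.
apply: le_measure; rewrite ?inE//.
move=> y' [Fy' /= yy']; split=> //=; apply: (le_trans yy').
by move: ym; lra.
Qed.

Lemma Avol_gt0 : 0 < (V : R).
Proof.
rewrite -lte_fin -leb_faces; have m1 : m < m + 1 by rewrite ltrDl.
apply: (lt_le_trans (near_minQ m1)).
apply: le_measure; [|rewrite inE; exact: measurable_facesE|exact: subIsetl].
by rewrite inE; exact: measurable_nbr_vol_le.
Qed.

Definition laplace (s : R) : R := fine (\int[leb]_y (face_weight p q s y)%:E).

Lemma face_weight_le s y : 0 <= s ->
  face_weight p q s y <= \1_faces y * expR (- (s * m)).
Proof.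
move=> s0; rewrite /face_weight indicE.
have [/set_mem Fy|Fy] := boolP (y \in faces).
  rewrite mul1r (_ : `[< _ >] = true) ?mul1r; last exact/asboolP.
  by rewrite ler_expR lerN2 ler_wpM2l// minQ_le.
rewrite (_ : `[< _ >] = false) ?mul0r//; apply/asboolPn => H.
by move/negP: Fy; apply; exact/mem_set.
Qed.

Let integral_indicM (A : set (k.-tuple pt)) (c : R) : measurable A -> A `<=` faces ->
  0 <= c -> (\int[leb]_y (\1_A y * c)%:E = (fine (leb A) * c)%:E)%E.
Proof.
move=> mA AF c0; under eq_integral do rewrite mulrC EFinM.
rewrite ge0_integralZl//; last first.
  by apply/measurable_EFinP; exact: measurable_indic.
rewrite integral_indic// setIT mulrC EFinM fineK// ge0_fin_numE//.
apply: (le_lt_trans _ (@leb_faces_lty R d k p)).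
by apply: le_measure; rewrite ?inE//; exact: measurable_facesE.
Qed.

Let mface s : measurable_fun setT (fun y : k.-tuple pt => (face_weight p q s y)%:E).
Proof. by apply/measurable_EFinP; exact: measurable_face_weight. Qed.

Let face0 s (y : k.-tuple pt) : (0 <= (face_weight p q s y : R)%:E)%E.
Proof. by rewrite lee_fin face_weight_ge0. Qed.

Lemma integral_face_weight_le s : 0 <= s ->
  (\int[leb]_y (face_weight p q s y)%:E <= (V * expR (- (s * m)))%:E)%E.
Proof.
move=> s0; have mF := @measurable_facesE R d k p.
have VE : V = fine (leb faces) by rewrite leb_faces.
rewrite VE.
rewrite -(integral_indicM mF) ?expR_ge0//.
apply: ge0_le_integral => //.
- by apply/measurable_EFinP; apply: measurable_funM => //; exact: measurable_indic.
- by move=> y _; rewrite lee_fin face_weight_le.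
Qed.

Lemma laplaceE s : 0 <= s -> (\int[leb]_y (face_weight p q s y)%:E = (laplace s)%:E)%E.
Proof.
move=> s0; rewrite /laplace fineK// ge0_fin_numE; last exact: integral_ge0.
by apply: le_lt_trans (integral_face_weight_le s0) _; rewrite ltry.
Qed.

Lemma laplace_le s : 0 <= s -> laplace s <= V * expR (- (s * m)).
Proof. by move=> s0; rewrite -lee_fin -laplaceE//; exact: integral_face_weight_le. Qed.

Lemma laplace_ge (A : set (k.-tuple pt)) b s : measurable A -> A `<=` faces ->
  (forall y, A y -> nbr_vol y <= b) -> 0 <= s ->
  fine (leb A) * expR (- (s * b)) <= laplace s.
Proof.
move=> mA AF Ab s0; rewrite -lee_fin -laplaceE// -(integral_indicM mA AF) ?expR_ge0//.
apply: ge0_le_integral => //.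
- by apply/measurable_EFinP; apply: measurable_funM => //; exact: measurable_indic.
move=> y _; rewrite lee_fin indicE; have [/set_mem Ay|_] := boolP (y \in A); last first.
  by rewrite mul0r face_weight_ge0.
rewrite mul1r /face_weight (_ : `[< _ >] = true) ?mul1r; last exact/asboolP/AF.
by rewrite ler_expR lerN2 ler_wpM2l// Ab.
Qed.

Lemma laplace_ge_maxQ s : 0 <= s -> V * expR (- (s * M)) <= laplace s.
Proof.
move=> s0; have VE : V = fine (leb faces) by rewrite leb_faces.
rewrite VE.
apply: laplace_ge => //; first exact: measurable_facesE.
exact: le_maxQ.
Qed.

Lemma laplace_ge_near b : m < b ->
  exists2 v, 0 < v & forall s, 0 <= s -> v * expR (- (s * b)) <= laplace s.
Proof.
move=> mb; pose A := faces `&` [set y | nbr_vol y <= b].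
have mA : measurable A by exact: measurable_nbr_vol_le.
have AF : A `<=` faces by move=> y [].
exists (fine (leb A)); last by move=> s s0; apply: laplace_ge => // y [].
apply: fine_gt0; rewrite near_minQ//=.
apply: (le_lt_trans _ (@leb_faces_lty R d k p)).
by apply: le_measure; rewrite ?inE//; exact: measurable_facesE.
Qed.

(** For a face of volume v <= M, the inequality 1 - u <= exp (- u) gives exp (- s v) - exp (- t v)
    <= (t - s) M; integrate over A_k. This is the source of continuity of the mean in c. *)
Lemma laplace_lip s t : 0 <= s -> 0 <= t ->
  `|laplace s - laplace t| <= M * V * `|s - t|.
Proof.
wlog st : s t / s <= t.
  move=> H s0 t0; have [st|ts] := leP s t; first exact: H.
  by rewrite distrC (distrC s) H// ltW.
move=> s0 t0; have mF := @measurable_facesE R d k p.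
have Mt : 0 <= M * (t - s).
  by rewrite mulr_ge0 ?subr_ge0// (le_trans (ltW minQ_gt0))// minQ_le_maxQ.
have le1 : laplace t <= laplace s.
  rewrite -lee_fin -!laplaceE//; apply: ge0_le_integral => // y _.
  rewrite lee_fin ler_wpM2l// ler_expR lerN2 ler_wpM2r// vol_ge0//.
have le2 : laplace s <= laplace t + V * (M * (t - s)).
  have -> : V = fine (leb faces) by rewrite leb_faces.
  rewrite -lee_fin EFinD -!laplaceE//.
  rewrite -(integral_indicM mF)// -ge0_integralD//; last 2 first.
  - by move=> y _; rewrite lee_fin mulr_ge0.
  - by apply/measurable_EFinP; apply: measurable_funM => //; exact: measurable_indic.
  apply: ge0_le_integral => //.
  - by apply: emeasurable_funD => //; apply/measurable_EFinP;
      apply: measurable_funM => //; exact: measurable_indic.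
  move=> y _; rewrite -EFinD lee_fin indicE /face_weight.
  have [/set_mem Fy|Fy] := boolP (y \in faces); last first.
    rewrite (_ : `[< _ >] = false) ?mul0r ?addr0//; apply/asboolPn => H.
    by move/negP: Fy; apply; exact/mem_set.
  rewrite (_ : `[< _ >] = true) ?mul1r; last exact/asboolP.
  rewrite -/(nbr_vol y); have v0 : 0 <= nbr_vol y by exact: vol_ge0.
  have vM := le_maxQ Fy.
  have e1 : expR (- (s * nbr_vol y)) <= 1.
    by rewrite -expR0 ler_expR oppr_le0 mulr_ge0.
  have e2 : expR (- (t * nbr_vol y)) = expR (- (s * nbr_vol y)) * expR (- ((t - s) * nbr_vol y)).
    by rewrite -expRD; congr expR; ring.
  have e3 : 1 - (t - s) * nbr_vol y <= expR (- ((t - s) * nbr_vol y)).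
    exact: expR_ge1Dx.
  have e4 : (t - s) * nbr_vol y <= M * (t - s) by rewrite mulrC ler_wpM2r ?subr_ge0.
  have e0 := expR_ge0 (- (s * nbr_vol y)).
  have ts0 : 0 <= (t - s) * nbr_vol y by rewrite mulr_ge0 ?subr_ge0.
  rewrite e2; move: e1 e3 e4 e0 ts0.
  move: (M * (t - s)) ((t - s) * _) (expR (- (s * _))) => f c a.
  move: (expR (- c)) => b.
  by move=> a1 cb cf a0 c0; nra.
have -> : `|s - t| = t - s by rewrite distrC ger0_norm// subr_ge0.
rewrite ger0_norm ?subr_ge0// lerBlDl (mulrC M) -mulrA.
exact: le2.
Qed.

End laplace.

(** * The mean at the critical radius *)

Lemma crit_radiusX {R : realType} (d k : nat) (p : complex_type)
    (q : connectivity) (alpha : R) (n : nat) (c : R) : (0 < d)%N ->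
  0 <= crit_num k alpha (minQ d k p q) (Avol d k p) n / (n%:R * c) ->
  crit_radius d k p q alpha n c ^+ d =
  crit_num k alpha (minQ d k p q) (Avol d k p) n / (n%:R * c).
Proof.
by move=> d0 a0; rewrite -powR_mulrn ?powR_ge0// -powRrM mulVf ?pnatr_eq0 -?lt0n// powRr1.
Qed.

(** The last hypothesis is r_n(c) <= 1/32 raised to the power d, the range in which the unrolled
    formula is valid. *)
Lemma expected_nb_isolated_crit {R : realType} (d k : nat) (alpha : R)
    (p : complex_type) (q : connectivity) (disp : measure_display)
    (Omega : measurableType disp) (P : probability Omega R)
    (N : Omega -> {fset pt[R]_d}) (n : nat) (c : R)
    (num := crit_num k alpha (minQ d k p q) (Avol d k p) n) :
  (0 < d)%N -> (1 <= k)%N -> (0 < n)%N -> is_poisson_process P n%:R N ->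
  0 < c -> 0 < num -> num / c <= (32^-1) ^+ d * n%:R ->
  ('E_P[fun w => (nb_isolated p q (N w) (crit_radius d k p q alpha n c) k)%:R])%E =
  (crit_mean k alpha (minQ d k p q) (Avol d k p) (laplace d k p q) n c)%:E.
Proof.
move=> d0 k1 n0 PN c0 num0 numle; have n0R : 0 < n%:R :> R by rewrite ltr0n.
have a0 : 0 < num / (n%:R * c) by rewrite divr_gt0// mulr_gt0.
have rE := crit_radiusX d0 (ltW a0).
have r0 : 0 < crit_radius d k p q alpha n c by exact: powR_gt0.
have r32 : crit_radius d k p q alpha n c <= 32^-1.
  rewrite -(@ler_pXn2r _ d) ?nnegrE ?(ltW r0)// rE -/num.
  by rewrite invfM mulrCA mulrC ler_pdivrMr.
have lamE : n%:R * crit_radius d k p q alpha n c ^+ d = num / c.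
  rewrite rE -/num; field.
  by rewrite !lt0r_neq0.
rewrite (expected_nb_isolated PN n0R d0 p q r0 r32 k1) lamE.
rewrite laplaceE//; last by rewrite divr_ge0// ltW.
rewrite -EFinM /crit_mean -/num -lamE; congr (_%:E).
rewrite exprMn exprS; field.
by rewrite pnatr_eq0 -lt0n fact_gt0.
Qed.

Theorem proposition2p4 (R : realType) (d k : nat) (alpha : R)
  (p : complex_type) (q : connectivity)
  (disp : nat -> measure_display)
  (Omega : forall n : nat, measurableType (disp n))
  (P : forall n : nat, probability (Omega n) R)
  (N : forall n : nat, Omega n -> {fset pt[R]_d}) :
  (2 <= d)%N -> (1 <= k)%N ->
  (forall n, (1 <= n)%N -> is_poisson_process (P n) n%:R (N n)) ->
  exists c : nat -> R,
    [/\ (forall n, (1 <= n)%N -> minQ d k p q <= c n <= maxQ d k p q),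
        c @ \oo --> minQ d k p q &
        (fun n => ('E_(P n)[fun w =>
           (nb_isolated p q (N n w) (crit_radius d k p q alpha n (c n)) k)%:R])%E)
          @ \oo --> (expR (- alpha))%:E].
Proof.
move=> d2 k1 PN; have d0 : (0 < d)%N by exact: ltn_trans d2.
pose m : R := minQ d k p q; pose M : R := maxQ d k p q; pose V : R := Avol d k p.
have m0 : 0 < m by exact: minQ_gt0.
have [c [cmM cm mean_cvg]] := @crit_sequence R k alpha m M V (M * V)
  (laplace d k p q) m0 (minQ_le_maxQ d p q k1) (Avol_gt0 d p q k1)
  (@laplace_le R d k p q k1) (@laplace_ge_maxQ R d k p q k1)
  (@laplace_ge_near R d k p q k1) (@laplace_lip R d k p q k1).
exists c; split=> //.
(* Since c_n >= m, the radius is at most 1/32 as soon as L_n <= 32^-d m n, which holds for large n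
   because L_n grows like log n. *)
have e0 : 0 < (32^-1) ^+ d * m :> R by rewrite mulr_gt0// exprn_gt0.
have mean_cvgE : (fun n => (crit_mean k alpha m V (laplace d k p q) n (c n))%:E) @ \oo
    --> (expR (- alpha))%:E.
  by apply: cvg_EFin => //; exact: nearW.
apply: cvg_trans mean_cvgE; apply: near_eq_cvg; near=> n.
have n0 : (0 < n)%N by near: n; exact: nbhs_infty_gt.
have /andP[mc _] := cmM n; have c0 := lt_le_trans m0 mc.
rewrite -(expected_nb_isolated_crit d0 k1 n0 (PN n n0) c0)//.
- by apply: lt_le_trans ltr01 _; near: n; exact: crit_num_ge.
- rewrite ler_pdivrMr//.
  have : crit_num k alpha m V n <= (32^-1) ^+ d * m * n%:R.
    by near: n; exact: crit_num_le_linear.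
  by move/le_trans; apply; rewrite -mulrA (mulrC m) mulrA ler_wpM2l//.
Unshelve. all: by end_near.
Qed.
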